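(* Let $\lambda$ be a shape with $r=|V^o|$ interior vertices. Let $$F(x,y)=\sum_{F\in\widetilde\Delta^{NK}(\lambda)}x^{|F\setminus F_0|}y^{|F\cap F_0|},\qquad H(x,y)=\sum_{F\in\Gamma^{NF}(\lambda)}x^{|F|}y^{|\epsilon(F)|}$$ be the $F$-triangle and $H$-triangle of $\lambda$. Then $$H(x+1,y+1)=x^r\,F\!\left(\frac1x,\ \frac{1+y(x+1)}{x}\right).$$
   Context: A shape is a finite vertex-induced subgraph $\lambda$ of the square grid $\mathbb{Z}^2$ (two points are adjacent iff they differ by 1 in exactly one coordinate and agree in the other). $(a,b)$ is immediately South of $(a,b+1)$ and immediately East of $(a-1,b)$; North and West are the reverse relations. A vertex of $\lambda$ is interior if all four of its grid neighbors are in $\lambda$, and a boundary vertex otherwise; $V^o$ is the set of interior vertices. A (boundary) path is a sequence of vertices $(v_0,\ldots,v_l)$ of $\lambda$, $l>0$, with $v_0,v_l$ boundary vertices, $v_1,\dots,v_{l-1}$ interior vertices, and each $v_i$ immediately South or East of $v_{i-1}$. A segment is a sequence of interior vertices $(v_0,\ldots,v_l)$, $l\ge 0$, with each $v_i$ immediately South or East of $v_{i-1}$; it is lazy if it has only one vertex. If $t=(v_i,\dots,v_j)$ is a contiguous subsequence of a path or segment $p=(v_0,\dots,v_l)$, then $p$ starts with $t$ if $i=0$ and otherwise enters $t$ from the West (resp. North) if $v_{i-1}$ is immediately West (resp. North) of $v_i$; $p$ ends with $t$ if $j=l$ and otherwise leaves $t$ to the East (resp. South) if $v_{j+1}$ is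 immediately East (resp. South) of $v_j$. The same language is used for a single vertex $t=(v)$. Nonkissing complex: two paths $p,q$ kiss along a common segment $s$ if (up to exchanging $p$ and $q$) $p$ enters $s$ from the West and leaves $s$ to the South, while $q$ enters $s$ from the North and leaves $s$ to the East. They are nonkissing if they kiss along no segment. The reduced nonkissing complex $\widetilde\Delta^{NK}(\lambda)$ is the simplicial complex whose faces are the sets (including $\emptyset$) of pairwise nonkissing paths, none of which is horizontal (only East steps) or vertical (only South steps). An initial path is a path which turns at a unique vertex $v$, entering $v$ from the West and leaving $v$ to the South. $F_0$ is the set of all initial paths. Nonfriendly complex: two segments $s,t$ are friendly along a common (contiguous) subsegment $u$ if, up to exchanging $s$ and $t$: $s$ starts with $u$ or enters $u$ from the West, and $s$ ends with $u$ or leaves $u$ to the South; and $t$ starts with $u$ or enters $u$ from the North, and $t$ ends with $u$ or leaves $u$ to the East. They are nonfriendly if they are friendly along no segment. $\Gamma^{NF}(\lambda)$ is the simplicial complex whose faces are the sets of segments (including $\emptyset$) whose distinct members are pairwise nonfriendly. For a set $S$ of segments, $\epsilon(S)$ is the set of lazy segments in $S$ that are not contained in any other member of $S$. *)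

(* Defs.v *)
From HB Require Import structures.
From mathcomp Require Import all_boot all_order all_algebra finmap.

Set Implicit Arguments.
Unset Strict Implicit.
Unset Printing Implicit Defensive.

Import GRing.Theory.
Local Open Scope ring_scope.

Definition point : Type := (int * int)%type.

Definition north (v : point) : point := (v.1, v.2 + 1).
Definition south (v : point) : point := (v.1, v.2 - 1).
Definition east (v : point) : point := (v.1 + 1, v.2).
Definition west (v : point) : point := (v.1 - 1, v.2).

(* A finite vertex-induced subgraph of the grid is given by its vertex set. *)
Definition grid_shape := {fset point}.

Section Sequences.
Implicit Types (p s t u : seq point) (v w : point).

Definition se_step : rel point := fun v w => (w == south v) || (w == east v).
Definition se_sequence p : bool := sorted se_step p.

(* The vertices of a South-East sequence are pairwise distinct, so t occurs at
   most once in p as a contiguous subsequence.  Hence prepending to t its West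
   neighbour and asking for a contiguous subsequence of p says that the vertex
   of p preceding t is immediately West of the first vertex of t; similarly for
   the other three predicates, and for [prefix] and [suffix]. *)
Definition starts_with p t : bool := prefix t p.
Definition ends_with p t : bool := suffix t p.
Definition enters_west p t : bool :=
  if t is v :: _ then infix (west v :: t) p else false.
Definition enters_north p t : bool :=
  if t is v :: _ then infix (north v :: t) p else false.
Definition leaves_east p t : bool :=
  if t is v :: t' then infix (rcons t (east (last v t'))) p else false.
Definition leaves_south p t : bool :=
  if t is v :: t' then infix (rcons t (south (last v t'))) p else false.

Definition horizontal p : bool := sorted (fun v w => w == east v) p.
Definition vertical p : bool := sorted (fun v w => w == south v) p.

Definition turns_at p v : bool :=
     (enters_west p [:: v] && leaves_south p [:: v])
  || (enters_north p [:: v] && leaves_east p [:: v]).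

End Sequences.

Section Shape.
Variable L : grid_shape.
Implicit Types (v : point) (p q s t u : seq point).

Definition is_interior v : bool :=
  (v \in L) &&
  [&& north v \in L, south v \in L, east v \in L & west v \in L].
Definition is_boundary v : bool := (v \in L) && ~~ is_interior v.

Definition is_path p : bool :=
  if p is v0 :: v1 :: p' then
    [&& se_sequence p, is_boundary v0, is_boundary (last v1 p')
      & all is_interior (belast v1 p')]
  else false.

Definition is_segment s : bool :=
  [&& s != [::], all is_interior s & se_sequence s].

Definition is_lazy s : bool := is_segment s && (size s == 1%N).

Definition is_initial p : bool :=
  is_path p &&
  has (fun v => [&& enters_west p [:: v], leaves_south p [:: v]
                  & all (fun w => turns_at p w ==> (w == v)) p]) p.

(* A finite type containing, up to the inclusion of L in the grid, all
   South-East sequences of vertices of L (lemma [walkP] below). *)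
Definition walk := {bseq #|{: L}| of L}.
HB.instance Definition _ := Finite.on walk.
Definition points (w : walk) : seq point := [seq val x | x <- w].
Coercion points : walk >-> seq.

Definition interior_vertices : {set L} := [set x : L | is_interior (val x)].

Definition kiss_along p q s : bool :=
  [&& enters_west p s, leaves_south p s, enters_north q s & leaves_east q s].
Definition kissing p q : bool :=
  [exists s : walk, is_segment s && (kiss_along p q s || kiss_along q p s)].

Definition NK_face (F : {set walk}) : bool :=
  [forall p : walk in F, [&& is_path p, ~~ horizontal p & ~~ vertical p]] &&
  [forall p : walk in F, forall q : walk in F, (p != q) ==> ~~ kissing p q].

Definition initial_paths : {set walk} := [set p : walk | is_initial p].

Definition friendly_along s t u : bool :=
  [&& starts_with s u || enters_west s u,
      ends_with s u || leaves_south s u,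
      starts_with t u || enters_north t u
    & ends_with t u || leaves_east t u].
Definition friendly s t : bool :=
  [exists u : walk,
     is_segment u && (friendly_along s t u || friendly_along t s u)].

Definition NF_face (S : {set walk}) : bool :=
  [forall s : walk in S, is_segment s] &&
  [forall s : walk in S, forall t : walk in S, (s != t) ==> ~~ friendly s t].

Definition eps (S : {set walk}) : {set walk} :=
  [set s : walk in S
    | is_lazy s & [forall t : walk in S, (t != s) ==> ~~ infix s t]].

(* The values at (x, y) of the F- and H-polynomials, in any commutative ring. *)
Definition F_triangle (R : comNzRingType) (x y : R) : R :=
  \sum_(F : {set walk} | NK_face F)
     x ^+ #|F :\: initial_paths| * y ^+ #|F :&: initial_paths|.

Definition H_triangle (R : comNzRingType) (x y : R) : R :=
  \sum_(S : {set walk} | NF_face S) x ^+ #|S| * y ^+ #|eps S|.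

End Shape.

Lemma se_sequence_uniq (p : seq point) : se_sequence p -> uniq p.
Proof.
pose h (v : point) : int := v.1 - v.2.
pose lth (v w : point) := (h v < h w)%R.
move=> hp; apply: (@sorted_uniq _ lth).
- by move=> a b c; rewrite /lth; apply: Order.POrderTheory.lt_trans.
- by move=> a; rewrite /lth Order.POrderTheory.ltxx.
apply: sub_sorted hp => v w; rewrite /lth /h.
case/orP=> /eqP-> /=.
  by rewrite opprB addrA addrAC Num.Theory.ltrDl.
by rewrite addrAC Num.Theory.ltrDl.
Qed.

Lemma walkP (L : grid_shape) (p : seq point) :
  se_sequence p -> all (fun v => v \in L) p -> exists w : walk L, points w = p.
Proof.
move=> hp /allP pL.
have e : [seq val x | x <- pmap (insub : point -> option L) p] = p.
  rewrite (pmap_filter (insubK _)); apply/all_filterP/allP => v vp /=.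
  by rewrite isSome_insub pL.
have : (size (pmap (insub : point -> option L) p) <= #|{: L}|)%N.
  rewrite -(card_uniqP _) ?max_card //.
  by rewrite -(map_inj_uniq val_inj) e se_sequence_uniq.
by move=> le; exists (Bseq le).
Qed.

(* Main.v *)
(** Both sides are computed by sweeping the interior vertices from North-West
    to South-East, for an arbitrary finite set I of grid points in the role of
    the interior.  When a last vertex v is added to I, the walks arriving at v
    are totally ordered (compare them where they separate, West below North),
    and a nonkissing or nonfriendly family is extended through v by sending an
    initial piece of this chain East and a final piece South, so that only the
    number n of arrivals matters.  With a weight u at every exit, the sum over
    the extensions is a divided difference in the weights at the East and South
    exits of v, namely of u (1 + u) u^n for paths (an arrival may go both ways)
    and of (1 + u) (u + t) u^n for segments (a segment may start or end at v).
    For t = 1 + x the substitution u |-> (u + 1) / x turns the first recursion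
    into the second; at u = 0 this gives
      x^|I| sum_F x^(-|F|) = sum_S (1 + x)^|S|.
    The general identity follows by expanding both sides in y over sets V of
    interior vertices: the faces containing the initial paths turning at V, and
    the nonfriendly sets S with V inside epsilon(S), both reduce to I minus V. *)

Require Import Defs.
From HB Require Import structures.
From mathcomp Require Import all_boot all_order all_algebra finmap zify ring.

Set Implicit Arguments.
Unset Strict Implicit.
Unset Printing Implicit Defensive.

Import GRing.Theory.
Local Open Scope ring_scope.
Local Notation o := ((0, 0) : point).

Arguments se_sequence : simpl never.
Arguments horizontal : simpl never.
Arguments vertical : simpl never.

(** The sweep cannot stay among shapes, because [I] minus [V] need not be the interior of one: a 3
    by 3 block without its center never is, since a shape having these eight points in its interior
    contains the center and its four neighbors. Hence paths are only asked to start and end outside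
    [I], and [v] is an exit until it joins [I]. The sum for [I] is then a polynomial in the weight
    of [v], the exponent being the number of arrivals; this is what makes the recursion expressible
    by the sum for [I] alone. Segments have no exits of their own, so they are allowed one last step
    out of [I]; the value u = 0 deletes those that take it and gives each path the weight 1/x. The
    substitution can be read off the factors: for u = (a + 1)/x one has x^2 u (1 + u) = (1 + a)(a +
    1 + x), which is (1 + a)(a + t) for t = 1 + x. One factor x is absorbed by the denominator of
    the divided difference, the other is the share of [v] in x^|I|. *)

Lemma pointE (v w : point) : (v == w) = (v.1 == w.1) && (v.2 == w.2).
Proof. by case: v w => [a b] [c d]. Qed.

Lemma westK v : east (west v) = v.
Proof. by apply/eqP; rewrite pointE /east /west /=; lia. Qed.
Lemma eastK v : west (east v) = v.
Proof. by apply/eqP; rewrite pointE /east /west /=; lia. Qed.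
Lemma northK v : south (north v) = v.
Proof. by apply/eqP; rewrite pointE /south /north /=; lia. Qed.
Lemma southK v : north (south v) = v.
Proof. by apply/eqP; rewrite pointE /south /north /=; lia. Qed.

Lemma west_neq_north v : (west v == north v) = false.
Proof. by apply/negbTE; rewrite pointE /west /north /=; lia. Qed.
Lemma south_neq_east v : (south v == east v) = false.
Proof. by apply/negbTE; rewrite pointE /south /east /=; lia. Qed.

Lemma se_stepE v w : se_step v w = (v == west w) || (v == north w).
Proof.
by rewrite /se_step orbC; congr (_ || _); apply/eqP/eqP => ->;
  rewrite ?westK ?eastK ?southK ?northK.
Qed.

Lemma west_step v : se_step (west v) v.
Proof. by rewrite se_stepE eqxx. Qed.
Lemma north_step v : se_step (north v) v.
Proof. by rewrite se_stepE eqxx orbT. Qed.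
Lemma east_step v : se_step v (east v).
Proof. by rewrite /se_step eqxx orbT. Qed.
Lemma south_step v : se_step v (south v).
Proof. by rewrite /se_step eqxx. Qed.

(** Every step raises it by one, so a point of [I] where it is maximal has its East and South
    neighbors outside [I]. *)
Definition height (v : point) : int := v.1 - v.2.

Lemma height_step v w : se_step v w -> height w = height v + 1.
Proof. by rewrite /height => /orP[] /eqP-> /=; lia. Qed.


(** * Contiguous pieces of South-East sequences *)

Lemma se_cat p x q : se_sequence (p ++ x :: q) =
  [&& se_sequence p, (p != [::]) ==> se_step (last o p) x & path se_step x q].
Proof.
case: p => [|y p] //=; rewrite /se_sequence /=.
by rewrite cat_path /=.
Qed.

Lemma se_rcons p x : se_sequence (rcons p x) =
  se_sequence p && ((p != [::]) ==> se_step (last o p) x).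
Proof. by rewrite -cats1 se_cat /= andbT. Qed.

Lemma se_infix s p : infix s p -> se_sequence p -> se_sequence s.
Proof. exact: infix_sorted. Qed.

(** Since the vertices are distinct, the index of the first vertex of [u] fixes the length of what
    precedes it. *)
Lemma uniq_cat_inj (a u b c d : seq point) :
  uniq (a ++ u ++ b) -> u != [::] -> a ++ u ++ b = c ++ u ++ d ->
  a = c /\ b = d.
Proof.
case: u => [|x u] // Ua _ e.
have ia : index x (a ++ (x :: u) ++ b) = size a.
  rewrite index_cat /= eqxx addn0; case: ifP => // xa.
  by move: Ua; rewrite cat_uniq => /and3P[_ /hasPn/(_ x)]; rewrite inE eqxx xa => /(_ isT).
have ic : index x (a ++ (x :: u) ++ b) = size c.
  move: Ua; rewrite e => Uc; rewrite index_cat /= eqxx addn0; case: ifP => // xa.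
  by move: Uc; rewrite cat_uniq => /and3P[_ /hasPn/(_ x)]; rewrite inE eqxx xa => /(_ isT).
have sac : size a = size c by rewrite -ia ic.
move/eqP: e; rewrite eqseq_cat // => /andP[/eqP-> /eqP e]; split=> //.
by move/eqP: e; rewrite eqseq_cat // => /andP[_ /eqP].
Qed.

(** Accepting an empty [p] encodes the alternative in friendliness: start with [u], or enter it from
    direction [d]. For nonempty [u] the default [o] never matters. *)
Definition adj_in (d : point -> point) (p u : seq point) : bool :=
  (p == [::]) || (last o p == d (head o u)).
Definition adj_out (d : point -> point) (u p : seq point) : bool :=
  (p == [::]) || (head o p == d (last o u)).

(** The entering and the leaving condition each give a decomposition of [p] around [u]; as [u]
    occurs only once, the two decompositions coincide. *)
Lemma along_split (p u : seq point) (d e : point -> point) :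
  uniq p -> u != [::] ->
  reflect (exists p1 p2, [/\ p = p1 ++ u ++ p2, adj_in d p1 u & adj_out e u p2])
   ((prefix u p || infix (d (head o u) :: u) p) &&
    (suffix u p || infix (rcons u (e (last o u))) p)).
Proof.
move=> Up u0; apply: (iffP andP) => [[pre suf]|].
  have [p1 [p2 [ep in1]]] : exists p1 p2, p = p1 ++ u ++ p2 /\ adj_in d p1 u.
    case/orP: pre => [/prefixP[p2 ->]|/infixP[p1 [p2 ->]]].
      by exists [::], p2.
    exists (rcons p1 (d (head o u))), p2; rewrite cat_rcons; split=> //.
    by rewrite /adj_in last_rcons eqxx orbT.
  exists p1, p2; split=> //.
  move: Up; rewrite ep => Up.
  case/orP: suf => [/suffixP[p3]|/infixP[p3 [p4]]]; rewrite ep => e1.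
    rewrite -(cats0 u) -catA in e1.
    by have [_ ->] := uniq_cat_inj Up u0 e1.
  rewrite cat_rcons in e1.
  by have [_ ->] := uniq_cat_inj Up u0 e1; rewrite /adj_out /= eqxx.
case=> p1 [p2 [-> i1 i2]]; split.
  case/orP: i1 => [/eqP->|/eqP i1]; first by rewrite prefix_prefix.
  apply/orP; case: (lastP p1) i1 => [|p3 x]; first by left; rewrite prefix_prefix.
  rewrite last_rcons => ->; right; rewrite cat_rcons.
  by apply/infixP; exists p3, p2.
case/orP: i2 => [/eqP->|/eqP i2]; first by rewrite cats0 suffix_suffix.
case: p2 i2 Up => [|x p2] /=; first by rewrite cats0 suffix_suffix.
move=> -> _; apply/orP; right.
by apply/infixP; exists p1, p2; rewrite cat_rcons.
Qed.

Lemma friendly_alongP (p q u : seq point) :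
  uniq p -> uniq q -> u != [::] ->
  reflect (exists p1 p2 q1 q2, [/\ p = p1 ++ u ++ p2, q = q1 ++ u ++ q2,
      adj_in west p1 u && adj_in north q1 u & adj_out south u p2 && adj_out east u q2])
    (friendly_along p q u).
Proof.
move=> Up Uq u0.
have -> : friendly_along p q u =
   ((prefix u p || infix (west (head o u) :: u) p) &&
    (suffix u p || infix (rcons u (south (last o u))) p)) &&
   ((prefix u q || infix (north (head o u) :: u) q) &&
    (suffix u q || infix (rcons u (east (last o u))) q)).
  rewrite /friendly_along /starts_with /ends_with /enters_west /leaves_south
    /enters_north /leaves_east.
  by case: u u0 => //= x u _; rewrite !andbA.
apply: (iffP andP).
  case=> /(along_split _ _ Up u0)[p1 [p2 [ep i1 i2]]].
  case/(along_split _ _ Uq u0)=> q1 [q2 [eq j1 j2]].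
  by exists p1, p2, q1, q2; rewrite i1 i2 j1 j2.
case=> p1 [p2 [q1 [q2 [ep eq /andP[i1 j1] /andP[i2 j2]]]]]; split.
  by apply/(along_split _ _ Up u0); exists p1, p2.
by apply/(along_split _ _ Uq u0); exists q1, q2.
Qed.

(** * Conflicts of walks relative to a set of points *)

Section Conflict.
Variable L : grid_shape.
Implicit Types (I : {fset point}) (p q u : seq point).

(* The segment u must lie in I.  On paths of I, whose end points are not in I,
   friendliness in this sense is kissing. *)
Definition conf1 I p q : Prop :=
  exists u p1 p2 q1 q2, [/\ (u != [::]) && all (mem I) u,
     p = p1 ++ u ++ p2, q = q1 ++ u ++ q2,
      adj_in west p1 u && adj_in north q1 u & adj_out south u p2 && adj_out east u q2].

Definition conf I p q : bool :=
  [exists u : walk L, [&& points u != [::], all (mem I) u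
     & friendly_along p q u || friendly_along q p u]].

(** A conflicting segment is a piece of [p], hence lies in [L], so the finite search through the
    walks of [L] misses none. The boolean is symmetric, whereas [conf1] fixes the roles: West and
    South for its first walk, North and East for the second. *)
Lemma confP I p q : se_sequence p -> se_sequence q -> all (mem L) p ->
  reflect (conf1 I p q \/ conf1 I q p) (conf I p q).
Proof.
move=> sp sq pL; have Up := se_sequence_uniq sp; have Uq := se_sequence_uniq sq.
apply: (iffP existsP) => [[u /and3P[u0 uI /orP[]]]|].
- case/(friendly_alongP Up Uq u0)=> p1 [p2 [q1 [q2 [? ? ? ?]]]]; left.
  by exists (points u), p1, p2, q1, q2; rewrite u0 uI.
- case/(friendly_alongP Uq Up u0)=> p1 [p2 [q1 [q2 [? ? ? ?]]]]; right.
  by exists (points u), p1, p2, q1, q2; rewrite u0 uI.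
move=> H.
have [u [u0 uI ip H']] : exists u, [/\ u != [::], all (mem I) u, infix u p &
    friendly_along p q u || friendly_along q p u].
  case: H => -[u [p1 [p2 [q1 [q2 [/andP[u0 uI] ep eq i1 i2]]]]]]; exists u.
    split=> //; first by apply/infixP; exists p1, p2.
    by apply/orP; left; apply/friendly_alongP => //; exists p1, p2, q1, q2.
  split=> //; first by apply/infixP; exists q1, q2.
  by apply/orP; right; apply/friendly_alongP => //; exists p1, p2, q1, q2.
have uL : all (mem L) u.
  by apply/allP => x xu; apply: (allP pL); apply: (mem_infix ip).
have [w ew] := walkP (se_infix ip sp) uL.
by exists w; rewrite ew u0 uI.
Qed.

End Conflict.

(** * The order on walks arriving at a common vertex *)

Section Arrivals.
Implicit Types (a b p q u r : seq point) (x v w : point).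

(* The words a and b list, backwards, the vertices preceding x on two walks;
   at the last vertex they share, West < start of the walk < North. *)
Fixpoint rle x a b : bool :=
  match a, b with
  | [::], [::] => true
  | [::], y :: _ => y == north x
  | w :: _, [::] => w == west x
  | w :: a', y :: b' => if w == y then rle w a' b' else w == west x
  end.

Local Notation rstep := (fun x w => se_step w x).

(** Here [u] is the common part followed by the recursion. At the first difference the two
    predecessors are the West and the North neighbor of the same vertex, so testing one of them
    decides both. *)
Lemma rleP x a b : path rstep x a -> path rstep x b ->
  reflect (exists u p q, [/\ a = u ++ p, b = u ++ q
      & ((p == [::]) || (head o p == west (last x u)))
     && ((q == [::]) || (head o q == north (last x u)))]) (rle x a b).
Proof.
elim: a x b => [|w a IH] x [|y b] /=.
- by move=> _ _; constructor; exists [::], [::], [::].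
- move=> _ _; apply: (iffP eqP) => [->|].
    by exists [::], [::], (north x :: b); rewrite /= eqxx.
  by move=> [[|? ?] [p [q []]]] //= _ <- /andP[_ /eqP].
- move=> _ _; apply: (iffP eqP) => [->|].
    by exists [::], (west x :: a), [::]; rewrite /= eqxx.
  by move=> [[|? ?] [p [q []]]] //= <- _ /andP[/eqP].
case/andP=> wx wa /andP[yx yb]; case: eqVneq yx yb => [<-|wy] yx yb.
  apply: (iffP (IH w b wa yb)).
    by case=> u [p [q [-> -> H]]]; exists (w :: u), p, q.
  move=> [[|z u] [p [q []]]] /= ea eb.
    rewrite -ea -eb /= => /andP[/eqP-> /eqP/esym/eqP].
    by rewrite eq_sym west_neq_north.
  by case: ea eb => <- -> [->] H; exists u, p, q.
apply: (iffP eqP) => [ew|].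
  exists [::], (w :: a), (y :: b); rewrite /= ew eqxx /=; split=> //.
  by move: yx; rewrite se_stepE => /orP[/eqP ey|//]; rewrite ew ey eqxx in wy.
move=> [[|z u] [p [q []]]] /= ea eb; first by rewrite -ea -eb /= => /andP[/eqP].
by case: ea eb wy => -> _ [->]; rewrite eqxx.
Qed.

Lemma rle_refl x a : rle x a a.
Proof. by elim: a x => //= w a IH x; rewrite eqxx. Qed.

Lemma rle_total x a b : path rstep x a -> path rstep x b -> rle x a b || rle x b a.
Proof.
elim: a x b => [|w a IH] x [|y b] //=.
- by move=> _ /andP[+ _]; rewrite se_stepE orbC.
- by move=> /andP[+ _]; rewrite se_stepE.
case/andP=> wx wa /andP[yx yb]; case: eqVneq yx yb => [<-|wy] yx yb.
  exact: IH.
move: wx yx wy; rewrite !se_stepE.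
by move=> /orP[] /eqP-> /orP[] /eqP->; rewrite ?eqxx ?orbT.
Qed.

Lemma rle_anti x a b : path rstep x a -> path rstep x b ->
  rle x a b -> rle x b a -> a = b.
Proof.
elim: a x b => [|w a IH] x [|y b] //=.
- by move=> _ _ /eqP->; rewrite eq_sym west_neq_north.
- by move=> _ _ /eqP->; rewrite west_neq_north.
case/andP=> wx wa /andP[yx yb]; case: eqVneq yx yb => [<-|wy] yx yb.
  by move=> *; congr (_ :: _); apply: (IH w).
by move=> /eqP ew /eqP ey; rewrite ew ey eqxx in wy.
Qed.

Lemma rle_trans x a b c : path rstep x a -> path rstep x b -> path rstep x c ->
  rle x a b -> rle x b c -> rle x a c.
Proof.
elim: a x b c => [|w a IH] x [|y b] [|z c] //=.
- move=> _ _ _ /eqP ey; case: eqVneq => [<- _|_ /eqP]; first exact/eqP.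
  by rewrite ey => /esym/eqP; rewrite west_neq_north.
- by move=> _ _ _ /eqP-> /eqP->; rewrite west_neq_north.
- by move=> _ _ _; case: eqVneq => [->|].
case/andP=> wx wa /andP[yx yb] /andP[zx zc].
case: (eqVneq w y) yx yb => [<-|wy] yx yb.
  by case: eqVneq zx zc => [<-|wz] zx zc; [apply: IH | ].
move=> /eqP ew; case: (eqVneq y z) => [<- _|yz /eqP ey]; last first.
  by rewrite ew ey eqxx in wy.
by rewrite (negbTE wy) ew.
Qed.

(** Membership of [v] excludes the empty word, whose last vertex is the default [o]. *)
Definition arrives v a : bool := [&& se_sequence a, v \in a & last o a == v].

Definition ale a b : bool :=
  if (rev a, rev b) is (x :: a', _ :: b') then rle x a' b' else false.

Lemma arrives_rev v a : arrives v a ->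
  exists2 a', rev a = v :: a' & path rstep v a'.
Proof.
case: (lastP a) => [|a' x] /and3P[] // sa _; rewrite last_rcons => /eqP ex.
rewrite -ex; exists (rev a'); rewrite ?rev_rcons //.
by move: sa; rewrite /se_sequence -rev_sorted rev_rcons.
Qed.

Section At.
Variables (v : point).

Lemma ale_refl a : arrives v a -> ale a a.
Proof. by case/arrives_rev=> a' e _; rewrite /ale e rle_refl. Qed.

Lemma ale_total a b : arrives v a -> arrives v b -> ale a b || ale b a.
Proof.
case/arrives_rev=> a' e pa /arrives_rev[b' e' pb]; rewrite /ale e e'.
exact: rle_total.
Qed.

Lemma ale_anti a b : arrives v a -> arrives v b -> ale a b -> ale b a -> a = b.
Proof.
case/arrives_rev=> a' e pa /arrives_rev[b' e' pb]; rewrite /ale e e'.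
move=> ab ba; apply: (can_inj revK); rewrite e e'; congr (_ :: _).
exact: rle_anti ab ba.
Qed.

Lemma ale_trans a b c : arrives v a -> arrives v b -> arrives v c ->
  ale a b -> ale b c -> ale a c.
Proof.
case/arrives_rev=> a' e pa /arrives_rev[b' e' pb] /arrives_rev[c' e'' pc].
by rewrite /ale e e' e''; apply: rle_trans.
Qed.

(** The order is the entering half of friendliness along a common final piece; only the exits remain
    to decide a conflict. *)
Lemma aleP a b : arrives v a -> arrives v b ->
  ale a b <-> (exists u p q, [/\ u != [::], a = p ++ u, b = q ++ u
     & adj_in west p u && adj_in north q u]).
Proof.
case/arrives_rev=> a' ea pa /arrives_rev[b' eb pb]; rewrite /ale ea eb.
split=> [/(rleP pa pb)|] [u [p [q]]].
  case=> ea' eb' H; exists (rev (v :: u)), (rev p), (rev q); split.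
  - by rewrite -size_eq0 size_rev.
  - by rewrite -rev_cat -[LHS]revK ea ea'.
  - by rewrite -rev_cat -[LHS]revK eb eb'.
  move: H; rewrite /adj_in -!size_eq0 !size_rev.
  have hl s y : last y (rev s) = head y s by case: s => //= z s; rewrite rev_cons last_rcons.
  by rewrite !hl rev_cons; case: (lastP u) => [|u' z]; rewrite //= rev_rcons last_rcons.
case=> u0 ea' eb' H; case: (lastP u) u0 ea' eb' H => // u' x _ ea' eb' H.
move: ea eb pa pb; rewrite ea' eb' !rev_cat !rev_rcons /= => -[<- <-] [<-] pa pb.
apply/(rleP pa pb); exists (rev u'), (rev p), (rev q); split=> //.
have hl s y : head y (rev s) = last y s by case: (lastP s) => //= {}s z; rewrite rev_rcons last_rcons.
have lh s y : last y (rev s) = head y s by case: s => //= z s; rewrite rev_cons last_rcons.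
move: H; rewrite /adj_in -!size_eq0 !size_rev !hl !lh.
by case: (u').
Qed.

End At.

End Arrivals.

(** * Conflicts after adding a last vertex *)

Section Cut.
Variables (I : {fset point}) (v : point).
Local Notation I' := (v |` I)%fset.
Implicit Types (a b p q u r : seq point).

Definition cut p := take (index v p).+1 p.

(** The shape of every walk through the last vertex: beyond [v] there is at most one step, because
    both exits of [v] lie outside [I']. *)
Definition adm p := se_sequence p /\ (v \in p -> exists a r,
   [/\ arrives v a, p = a ++ r & r \in [:: [::]; [:: east v]; [:: south v]]]).

(** In contrast to [ale], the common final piece has to lie in [I']. For paths this rules out
    [a = b], since the piece would have to contain the starting point. *)
Definition low a b := exists u p q, [/\ (u != [::]) && all (mem I') u,
   a = p ++ u, b = q ++ u & adj_in west p u && adj_in north q u].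

Lemma arrives_rcons a : arrives v a ->
  exists2 a', a = rcons a' v & v \notin a'.
Proof.
case: (lastP a) => [|a' x] /and3P[] // sa _; rewrite last_rcons => /eqP ex.
exists a'; rewrite -?ex //.
by have := se_sequence_uniq sa; rewrite rcons_uniq => /andP[].
Qed.

Lemma cut_notin p : v \notin p -> cut p = p.
Proof. by move=> vp; rewrite /cut memNindex // take_oversize. Qed.

Lemma cut_cat a r : arrives v a -> cut (a ++ r) = a.
Proof.
case/arrives_rcons=> a' -> va'; rewrite /cut cat_rcons index_cat (negbTE va') /=.
by rewrite eqxx addn0 -cat_rcons take_size_cat // size_rcons.
Qed.

Lemma cut_arrives a : arrives v a -> cut a = a.
Proof. by move=> va; rewrite -{1}[a]cats0 cut_cat. Qed.

Hypotheses (vI : v \notin I) (eI : east v \notin I') (sI : south v \notin I').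

Lemma arrives_split a r c d : arrives v a -> uniq (a ++ r) ->
  a ++ r = c ++ v :: d -> a = rcons c v /\ r = d.
Proof.
move=> /arrives_rcons[a' -> va']; rewrite cat_rcons => Up e.
have [-> ->] := @uniq_cat_inj a' [:: v] r c d Up isT e.
by [].
Qed.

Lemma exit_notin r u : r \in [:: [::]; [:: east v]; [:: south v]] ->
  all (mem I') u -> {subset u <= r} -> u = [::].
Proof.
case: u => // x u; rewrite !inE => /or3P[] /eqP-> /= /andP[xI _] /(_ x);
  rewrite !inE eqxx => /(_ isT) // /eqP ex; rewrite ex in xI.
- by rewrite /= (negbTE eI) in xI.
- by rewrite /= (negbTE sI) in xI.
Qed.

Lemma through_in a r u p1 p2 : se_sequence (a ++ r) -> arrives v a ->
  r \in [:: [::]; [:: east v]; [:: south v]] ->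
  all (mem I') u -> v \in u -> a ++ r = p1 ++ u ++ p2 -> a = p1 ++ u /\ r = p2.
Proof.
move=> /se_sequence_uniq Up va rE uI vu; case/splitPr: vu uI => u1 u2.
rewrite all_cat /= => /and3P[_ _ u2I] e.
have e' : a ++ r = (p1 ++ u1) ++ v :: (u2 ++ p2) by rewrite e -!catA.
have [-> er] := arrives_split va Up e'.
have u20 : u2 = [::].
  by apply: (exit_notin rE u2I) => x xu; rewrite er mem_cat xu.
by rewrite er u20 /= rcons_cat cats1.
Qed.

Lemma through_out p u p1 p2 : adm p -> v \notin u -> u != [::] ->
  all (mem I') u -> p = p1 ++ u ++ p2 ->
  exists2 p2', cut p = p1 ++ u ++ p2' &
    forall d, adj_out d u p2' = adj_out d u p2.
Proof.
move=> [sp ap] vu u0 uI ep; have Up := se_sequence_uniq sp.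
case: (boolP (v \in p)) => [vp|vp]; last by exists p2; rewrite ?cut_notin.
have [a [r [va epa rE]]] := ap vp.
rewrite epa cut_cat //.
have: v \in p by []; rewrite ep !mem_cat (negbTE vu) /= => /orP[] vi.
  case/splitPr: vi ep => p3 p4 ep.
  have e : a ++ r = p3 ++ v :: (p4 ++ u ++ p2) by rewrite -epa ep -catA.
  rewrite epa in Up; have [_ er] := arrives_split va Up e.
  by case/eqP: u0; apply: (exit_notin rE uI) => x xu; rewrite er !mem_cat xu orbT.
case/splitPr: vi ep => p3 p4 ep.
have e : a ++ r = (p1 ++ u ++ p3) ++ v :: p4 by rewrite -epa ep -!catA.
rewrite epa in Up; have [-> er] := arrives_split va Up e.
exists (rcons p3 v); first by rewrite !rcons_cat.
by move=> d; rewrite /adj_out; case: (p3).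
Qed.

Lemma cut_out p u p1 p2 : adm p -> u != [::] -> all (mem I) u ->
  cut p = p1 ++ u ++ p2 ->
  exists2 p2', p = p1 ++ u ++ p2' & forall d, adj_out d u p2' = adj_out d u p2.
Proof.
move=> [sp ap] u0 uI.
case: (boolP (v \in p)) => [vp|vp]; last by rewrite cut_notin // => ?; exists p2.
have [a [r [va epa rE]]] := ap vp.
rewrite epa cut_cat // => ea; exists (p2 ++ r); first by rewrite ea -!catA.
move=> d; rewrite /adj_out; case: p2 ea => // ea.
have /and3P[_ _] := va; rewrite ea cats0 last_cat => /eqP lv.
have: v \in u by case: (u) u0 lv => //= x u' _ <-; rewrite mem_last.
by move=> /(allP uI); rewrite /= (negbTE vI).
Qed.

(** A conflicting segment without [v] lies before [v] in both walks and survives the cut. One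
    through [v] must end there, so it is a common final piece of the two cuts, and the conflict
    depends on the exits only: the lower walk must not go East, the higher one must not go South. *)
Lemma conf1_ext p q : adm p -> adm q ->
  conf1 I' p q <-> conf1 I (cut p) (cut q) \/
   [/\ v \in p, v \in q, low (cut p) (cut q)
     & (last o p != east v) && (last o q != south v)].
Proof.
move=> ap aq; split.
  case=> u [p1 [p2 [q1 [q2 [/andP[u0 uI] ep eq i1 i2]]]]].
  case: (boolP (v \in u)) => vu; last first.
    left.
    have [p2' -> ip] := through_out ap vu u0 uI ep.
    have [q2' -> iq] := through_out aq vu u0 uI eq.
    exists u, p1, p2', q1, q2'; rewrite ip iq u0; split=> //=.
    apply/allP => x xu; have := allP uI x xu; rewrite /= !inE => /orP[/eqP ex|//].
    by rewrite -ex xu in vu.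
  right; case: ap aq => [sp ap] [sq aq].
  have vp : v \in p by rewrite ep !mem_cat vu orbT.
  have vq : v \in q by rewrite eq !mem_cat vu orbT.
  have [a [r [va epa rE]]] := ap vp.
  have [b [t [vb eqb tE]]] := aq vq.
  have [ea er] : a = p1 ++ u /\ r = p2.
    by apply: through_in => //; rewrite -epa.
  have [eb et] : b = q1 ++ u /\ t = q2.
    by apply: through_in => //; rewrite -eqb.
  split=> //.
    rewrite epa eqb !cut_cat //; exists u, p1, q1; rewrite u0 uI; split=> //.
  have lu : last o u = v.
    have /and3P[_ _] := va; rewrite ea last_cat => /eqP.
    by case: (u) u0.
  move: i2; rewrite -er -et epa eqb !last_cat /adj_out lu.
  case/and3P: va => _ _ /eqP->; case/and3P: vb => _ _ /eqP->.
  have ve : v != east v by apply: contraNneq eI => <-; rewrite !inE eqxx.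
  have vs : v != south v by apply: contraNneq sI => <-; rewrite !inE eqxx.
  move: rE tE; rewrite !inE => /or3P[] /eqP-> /or3P[] /eqP-> //=;
    by rewrite ?eqxx ?ve ?vs ?south_neq_east // eq_sym south_neq_east.
case=> [[u [p1 [p2 [q1 [q2 [/andP[u0 uI] ep eq i1 i2]]]]]]|].
  have [p2' -> ip] := cut_out ap u0 uI ep.
  have [q2' -> iq] := cut_out aq u0 uI eq.
  exists u, p1, p2', q1, q2'; rewrite ip iq u0; split=> //=.
  by apply/allP => x /(allP uI) /=; rewrite !inE => ->; rewrite orbT.
case: ap aq => [sp ap] [sq aq] [vp vq].
have [a [r [va epa rE]]] := ap vp.
have [b [t [vb eqb tE]]] := aq vq.
rewrite {1}epa {1}eqb !cut_cat // => -[u [p1 [q1 [/andP[u0 uI] ea eb i1]]]] i2.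
exists u, p1, r, q1, t; rewrite u0 uI; split=> //.
- by rewrite epa ea catA.
- by rewrite eqb eb catA.
have lu : last o u = v.
  have /and3P[_ _] := va; rewrite ea last_cat => /eqP.
  by case: (u) u0.
move: i2; rewrite epa eqb !last_cat /adj_out lu.
case/and3P: va => _ _ /eqP->; case/and3P: vb => _ _ /eqP->.
by move: rE tE; rewrite !inE => /or3P[] /eqP-> /or3P[] /eqP-> //=;
  rewrite ?eqxx ?andbF.
Qed.

End Cut.

(** * Paths and segments of an arbitrary finite set *)

Definition Kp (I : {fset point}) (p : seq point) : bool :=
  if p is x :: y :: p' then
    [&& se_sequence p, x \notin I, last y p' \notin I & all (mem I) (belast y p')]
  else false.

Definition straight (p : seq point) : bool := horizontal p || vertical p.

(* Segments of I, except that a last step leaving I is allowed. *)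
Definition Fs (I : {fset point}) (p : seq point) : bool :=
  if p is x :: p' then [&& se_sequence p, x \in I & all (mem I) (belast x p')]
  else false.

Definition good (k : bool) I p := if k then Kp I p && ~~ straight p else Fs I p.

Lemma KpE I x s y : Kp I (x :: rcons s y) =
  [&& se_sequence (x :: rcons s y), x \notin I, y \notin I & all (mem I) s].
Proof. by case: s => [|z s] //=; rewrite last_rcons belast_rcons. Qed.

Lemma Kp_split I p : Kp I p -> exists x s y, p = x :: rcons s y.
Proof.
case: p => [|x [|z p]] // _.
by exists x, (belast z p), (last z p); rewrite -lastI.
Qed.

Lemma FsE I s y : Fs I (rcons s y) =
  [&& se_sequence (rcons s y), head y s \in I & all (mem I) s].
Proof. by case: s => [|z s] //=; rewrite belast_rcons. Qed.

Lemma good_se k I p : good k I p -> se_sequence p.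
Proof.
case: k => /=; first by case: p => [|x [|y p]] // /andP[/and4P[]].
by case: p => // x p /and3P[].
Qed.

Lemma Kp_se I p : Kp I p -> se_sequence p.
Proof. by case: p => [|x [|y p]] // /and4P[]. Qed.

Lemma horizontal_rcons a e : horizontal (rcons a e) =
  horizontal a && ((a != [::]) ==> (e == east (last o a))).
Proof. by case: a => // x a; rewrite /horizontal /= rcons_path. Qed.
Lemma vertical_rcons a e : vertical (rcons a e) =
  vertical a && ((a != [::]) ==> (e == south (last o a))).
Proof. by case: a => // x a; rewrite /vertical /= rcons_path. Qed.

Lemma horizontal_cat p x q : horizontal (p ++ x :: q) =
  [&& horizontal p, (p != [::]) ==> (x == east (last o p)) & horizontal (x :: q)].
Proof. by case: p => // y p; rewrite /horizontal /= cat_path. Qed.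
Lemma vertical_cat p x q : vertical (p ++ x :: q) =
  [&& vertical p, (p != [::]) ==> (x == south (last o p)) & vertical (x :: q)].
Proof. by case: p => // y p; rewrite /vertical /= cat_path. Qed.

Lemma vertical_se p : vertical p -> se_sequence p.
Proof. by apply: sub_sorted => x y /eqP->; apply: south_step. Qed.

Lemma belast_cat_cons (x w : point) s t :
  belast x (s ++ w :: t) = x :: s ++ belast w t.
Proof. by elim: s x => //= y s IH x; rewrite IH. Qed.

Section GoodExtension.
Variables (I : {fset point}) (v : point).
Local Notation I' := (v |` I)%fset.
Hypotheses (vI : v \notin I) (eI : east v \notin I') (sI : south v \notin I').
Implicit Types (a b p q r s : seq point) (k : bool).

(** Possible beginnings, up to [v], of walks of [I']. Among walks arriving at [v] they exceed
    [good k I] by the straight paths if [k] is true, and by the single vertex [[:: v]] if it is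
    false. *)
Definition pre k a := if k then Kp I a else Fs I' a.
(* The possible continuations at v: a path must leave v, a segment may end. *)
Definition outs k := if k then [:: [:: east v]; [:: south v]]
  else [:: [::]; [:: east v]; [:: south v]].

Lemma in_ext x : x != v -> (x \in I') = (x \in I).
Proof. by move=> xv; rewrite !inE (negbTE xv). Qed.

Lemma all_ext s : v \notin s -> all (mem I') s = all (mem I) s.
Proof.
move=> vs; apply: eq_in_all => x xs /=; rewrite in_ext //.
by apply: contraNneq vs => <-.
Qed.

Lemma Kp_ext p : v \notin p -> Kp I' p = Kp I p.
Proof.
move=> vp; case: (boolP (1 < size p)%N) => [|]; last by case: p vp => [|x [|]].
case: p vp => [|x p] //; case/lastP: p => // s y.
rewrite inE mem_rcons inE !negb_or => /and3P[vx vy vs] _.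
by rewrite !KpE !in_ext ?[_ == v]eq_sym // all_ext.
Qed.

Lemma Fs_ext p : v \notin p -> Fs I' p = Fs I p.
Proof.
case/lastP: p => // s y.
rewrite mem_rcons inE negb_or => /andP[vy vs].
rewrite !FsE all_ext // in_ext //.
by case: s vs => [|z s]; rewrite /= ?inE ?negb_or 1?eq_sym // => /andP[].
Qed.

Lemma good_ext k p : v \notin p -> good k I' p = good k I p.
Proof. by case: k => vp /=; rewrite ?Kp_ext ?Fs_ext. Qed.

(** The vertex after [v] is its East or South neighbor, hence outside [I'], and only the last vertex
    may be outside. *)
Lemma se_after s t : se_sequence (s ++ v :: t) -> all (mem I') (belast v t) ->
  t \in outs false.
Proof.
rewrite se_cat => /and3P[_ _]; case: t => [|x t] //= /andP[xv pt].
have xI : x \notin I' by case/orP: xv => /eqP->.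
case: t pt => [|y t] /=; last by move=> _ /and3P[_]; rewrite (negbTE xI).
by move=> _ _; move: xv => /orP[] /eqP->; rewrite !inE eqxx ?orbT.
Qed.

Lemma Fs_in p : Fs I' p -> v \in p ->
  exists a r, [/\ arrives v a, Fs I' a, p = a ++ r & r \in outs false].
Proof.
move=> Fp vp; have sp := @good_se false _ _ Fp.
case/splitPr: vp Fp sp => s t Fp sp.
exists (rcons s v), t.
have [sJ tJ] : all (mem I') s /\ all (mem I') (belast v t).
  case: s Fp {sp} => [|x s] /= /and3P[_ _]; first by [].
  by rewrite belast_cat_cons /= all_cat => /and3P[-> -> ->].
split; rewrite ?cat_rcons //.
- rewrite /arrives last_rcons eqxx mem_rcons inE eqxx /= andbT.
  by move: sp; rewrite se_rcons se_cat => /and3P[-> ->].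
- rewrite FsE sJ; move: sp; rewrite se_cat se_rcons => /and3P[-> -> _] /=.
  by case: s Fp {sJ} => [|x s] /=; [rewrite !inE eqxx|case/and3P=> _ ->].
exact: (se_after sp).
Qed.

Lemma arrives_rcons_se s : se_sequence (rcons s v) -> arrives v (rcons s v).
Proof. by move=> ss; rewrite /arrives ss last_rcons eqxx mem_rcons inE eqxx. Qed.

Lemma arrives_se a : arrives v a -> se_sequence a.
Proof. by case/and3P. Qed.

Lemma arrives_last a : arrives v a -> last o a = v.
Proof. by case/and3P=> _ _ /eqP. Qed.

Lemma arrives_mem a : arrives v a -> v \in a.
Proof. by case/and3P. Qed.

Lemma outs_sub k r : r \in outs k -> r \in outs false.
Proof. by case: k => //; rewrite !inE => ->; rewrite orbT. Qed.

Lemma Kp_in p : Kp I' p -> v \in p ->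
  exists a r, [/\ arrives v a, Kp I a, p = a ++ r & r \in outs true].
Proof.
move=> Pp; have sp := Kp_se Pp; have Up := se_sequence_uniq sp.
have [x [s [y ep]]] := Kp_split Pp; move: Pp sp Up; rewrite ep KpE.
case/and4P=> _ xI yI sJ sp Up.
have vx : v != x by apply: contraNneq xI => <-; rewrite !inE eqxx.
have vy : v != y by apply: contraNneq yI => <-; rewrite !inE eqxx.
rewrite inE mem_rcons inE (negbTE vx) (negbTE vy) /= => vs.
case/splitPr: vs sJ sp Up {ep} => s1 s2.
rewrite all_cat /= => /and3P[s1J _ s2J].
rewrite rcons_cat rcons_cons => sp Up.
have {}sp : se_sequence ((x :: s1) ++ v :: rcons s2 y) := sp.
have tO : rcons s2 y \in outs false.
  apply: (@se_after (x :: s1)) => //.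
  by rewrite belast_rcons /= !inE eqxx s2J.
exists (rcons (x :: s1) v), (rcons s2 y); split.
- by apply: arrives_rcons_se; move: sp; rewrite se_cat se_rcons => /and3P[-> ->].
- rewrite rcons_cons KpE vI; move: sp; rewrite se_cat -rcons_cons se_rcons => /and3P[-> -> _] /=.
  rewrite in_ext 1?eq_sym // in xI; rewrite xI -all_ext //.
  have : uniq (s1 ++ v :: rcons s2 y) by case/andP: Up.
  by rewrite cat_uniq /= negb_or => /and3P[_ /andP[]].
- by rewrite cat_rcons.
by move: tO; rewrite !inE; case: (s2).
Qed.

Lemma Kp_cat a r : arrives v a -> Kp I a -> r \in outs true -> Kp I' (a ++ r).
Proof.
move=> va Pa; have [x [s [y ea]]] := Kp_split Pa.
have ey : y = v by move: (arrives_last va); rewrite ea /= last_rcons.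
move: va Pa; rewrite ea ey KpE => va /and4P[sa xI _ sJ].
have xv : x != v.
  apply: contraTneq (se_sequence_uniq sa) => ->.
  by rewrite /= mem_rcons inE eqxx.
have vs : v \notin s.
  by apply/negP => /(allP sJ); rewrite /= (negbTE vI).
rewrite !inE => rO.
have [e er [eJ se]] : exists2 e, r = [:: e] & e \notin I' /\ se_step v e.
  by case/orP: rO => /eqP->; [exists (east v)|exists (south v)];
     rewrite // ?east_step ?south_step.
rewrite er cats1 rcons_cons KpE in_ext // xI eJ.
rewrite all_rcons /= !inE eqxx all_ext // sJ !andbT.
by rewrite (se_rcons (x :: rcons s v)) sa /= last_rcons.
Qed.

Lemma Fs_cat a r : arrives v a -> Fs I' a -> r \in outs false -> Fs I' (a ++ r).
Proof.
case/lastP: a => // s y va; move: (arrives_last va); rewrite last_rcons => ->.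
rewrite FsE => Fa rO.
have [->|[e er se]] : r = [::] \/ exists2 e, r = [:: e] & se_step v e.
- by move: rO; rewrite !inE => /or3P[] /eqP->; [left | right; exists (east v)
   | right; exists (south v)]; rewrite // ?east_step ?south_step.
- by rewrite cats0 FsE.
case/and3P: Fa => ss hs sJ.
rewrite er cats1 FsE se_rcons ss last_rcons se all_rcons sJ /= !inE eqxx /= andbT.
case: s hs {va ss sJ} => /=; first by rewrite eqxx.
by move=> z s; rewrite !inE.
Qed.

(** A path of [I] can contain [v] only as an end point. If it started there, its next vertex would
    already be outside [I], and a path with a single step is straight. *)
Lemma good_arrives k a : good k I a -> v \in a -> arrives v a /\ pre k a.
Proof.
case: k => /=; last first.
  case/lastP: a => // s y Fa va; have sa := @good_se false _ _ Fa.
  move: Fa; rewrite FsE => /and3P[_ hs sJ].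
  have vs : v \notin s by apply/negP => /(allP sJ); rewrite /= (negbTE vI).
  move: va; rewrite mem_rcons inE (negbTE vs) orbF => /eqP ev; rewrite -ev in sa *.
  rewrite arrives_rcons_se // FsE sa all_ext // sJ andbT /=; split=> //.
  by case: s hs {sJ sa vs} => [|z s] /=; rewrite ?ev !inE => ->; rewrite orbT.
case/andP=> Pa ns va; split=> //.
have [x [s [y ea]]] := Kp_split Pa.
have sa := Kp_se Pa; move: Pa ns va sa; rewrite ea KpE => /and4P[_ xI yI sJ].
have vs : v \notin s by apply/negP => /(allP sJ); rewrite /= (negbTE vI).
move=> ns; rewrite inE mem_rcons inE (negbTE vs) orbF => /orP[]/eqP ev sa.
  have: rcons s y \in outs false.
    apply: (@se_after [::]); rewrite ?ev // belast_rcons -ev /= !inE eqxx /=.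
    by rewrite all_ext.
  rewrite !inE; case: (s) ns => //= [|z s'].
    by rewrite -ev => ns /orP[] /eqP [ey]; rewrite ey /straight /horizontal /vertical /= eqxx ?orbT in ns.
  by move=> _; case: (s') => [|? ?] /orP[] /eqP.
by move: sa; rewrite -ev -rcons_cons; apply: arrives_rcons_se.
Qed.

Lemma pre_Fs a : arrives v a -> pre false a -> a = [:: v] \/ good false I a.
Proof.
case/lastP: a => // s y va; move: (arrives_last va); rewrite last_rcons => ev.
rewrite ev in va *.
have /arrives_rcons[s' /eqP] := va; rewrite eqseq_rcons => /andP[/eqP<- _] vs.
rewrite /= !FsE all_ext // => /and3P[-> hs ->].
case: s hs vs {va} => [|z s] /=; first by left.
by move=> zI; rewrite in_cons negb_or => /andP[vz _]; right; rewrite -in_ext 1?eq_sym // zI.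
Qed.

Lemma good_in k p : v \in p -> good k I' p ->
  exists a r, [/\ arrives v a, pre k a, p = a ++ r & r \in outs k].
Proof.
case: k => vp; last by move=> Fp; apply: Fs_in.
by case/andP=> Pp _; apply: Kp_in.
Qed.

Lemma good_cat k a r : arrives v a -> pre k a -> r \in outs k ->
  ~~ (k && straight (a ++ r)) -> good k I' (a ++ r).
Proof.
case: k => va /= pa rO; last by move=> _; apply: Fs_cat.
by move=> ->; rewrite Kp_cat.
Qed.

Lemma good_adm k p : good k I' p -> adm v p.
Proof.
move=> gp; split; first exact: good_se gp.
move=> vp; have [a [r [va _ ep rO]]] := good_in vp gp.
by exists a, r; split=> //; apply: outs_sub rO.
Qed.

Lemma horizontal_arrives a : arrives v a ->
  (horizontal (a ++ [:: east v]) = horizontal a) *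
  (vertical (a ++ [:: east v]) = false) *
  (horizontal (a ++ [:: south v]) = false) *
  (vertical (a ++ [:: south v]) = vertical a).
Proof.
move=> va; have a0 : a != [::] by case: (a) va.
rewrite !cats1 !horizontal_rcons !vertical_rcons a0 (arrives_last va) /= !eqxx.
by rewrite south_neq_east [east v == _]eq_sym south_neq_east !andbF !andbT.
Qed.

(** A piece of [a] inside [I] is not final, since [v] is not in [I]; and it occurs once, so the
    vertex after it would have to be both South and East. *)
Lemma conf1_irr a : arrives v a -> ~ conf1 I a a.
Proof.
move=> va [u [p1 [p2 [q1 [q2 [/andP[u0 uI] e1 e2 _ i2]]]]]].
have Ua := se_sequence_uniq (arrives_se va).
move: (Ua) e2; rewrite e1 => Ua' e2.
have [_ e] := uniq_cat_inj Ua' u0 e2; rewrite -e in i2.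
case: p2 e1 i2 {Ua' e2 e} => [|x p2] e1.
  move=> _; move: (arrives_last va); rewrite e1 cats0 last_cat => lv.
  have: v \in u by case: (u) u0 lv => //= x u' _ <-; rewrite mem_last.
  by move=> /(allP uI); rewrite /= (negbTE vI).
by rewrite /adj_out /= => /andP[/eqP-> ]; rewrite south_neq_east.
Qed.

Lemma conf1_single b : ~ conf1 I [:: v] b /\ ~ conf1 I b [:: v].
Proof.
have H (u p1 p2 : seq point) : (u != [::]) && all (mem I) u -> [:: v] = p1 ++ u ++ p2 -> False.
  case: u => // x u /andP[_ /= /andP[xI _]] e.
  have : x \in [:: v] by rewrite e !mem_cat inE eqxx orbT.
  by rewrite inE => /eqP ex; rewrite ex (negbTE vI) in xI.
by split=> -[u [p1 [p2 [q1 [q2 [uI e1 e2 _ _]]]]]]; [apply: H uI e1|apply: H uI e2].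
Qed.

Lemma lowP_F a b : arrives v a -> arrives v b -> pre false a -> pre false b ->
  low I v a b <-> ale a b.
Proof.
move=> va vb pa pb; rewrite (aleP va vb); split.
  by case=> u [p [q [/andP[u0 uI] ? ? ?]]]; exists u, p, q.
case=> u [p [q [u0 ea eb i]]]; exists u, p, q; rewrite u0; split=> //=.
have: all (mem I') a.
  case/lastP: (a) pa (arrives_last va) => // s y; rewrite last_rcons /pre FsE all_rcons.
  by move=> /and3P[_ _ ->] ->; rewrite /= !inE eqxx.
by rewrite ea all_cat => /andP[].
Qed.

Lemma Kp_suffix a u p : Kp I a -> arrives v a -> a = p ++ u -> p != [::] ->
  all (mem I') u.
Proof.
move=> Pa va; have [x [s [y ea]]] := Kp_split Pa.
have ey : y = v by move: (arrives_last va); rewrite ea /= last_rcons.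
move: Pa; rewrite ea KpE ey => /and4P[_ _ _ sJ].
case: p => // z p /= [_ e] _.
have: all (mem I') (rcons s v).
  rewrite all_rcons /= !inE eqxx /=; apply: sub_all sJ => w /= wI.
  by rewrite !inE wI orbT.
by rewrite e all_cat => /andP[].
Qed.

(** Otherwise the start of [a], which is outside [I], would be an inner vertex or the last vertex of
    [b]. *)
Lemma Kp_head_in a b p : Kp I a -> Kp I b -> arrives v a -> arrives v b ->
  b = p ++ a -> p = [::].
Proof.
move=> Pa Pb va vb; case: p => // z p eb.
have [x [s [y ea]]] := Kp_split Pa.
have aI := Kp_suffix Pb vb eb isT.
move: Pa va aI; rewrite ea KpE => /and4P[sa xI _ _] va.
rewrite /= => /andP[+ _]; rewrite !inE (negbTE xI) orbF => /eqP ex.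
have := se_sequence_uniq sa; rewrite ex /=.
have -> : v = y by move: (arrives_last va); rewrite /= last_rcons.
by rewrite mem_rcons inE eqxx.
Qed.

(** A common final piece inside [I'] is never a whole path, so both paths enter it, from different
    sides, and they differ. Conversely, of two distinct paths neither is a final piece of the other,
    which keeps their common piece inside [I']. *)
Lemma lowP_K a b : arrives v a -> arrives v b -> pre true a -> pre true b ->
  low I v a b <-> a <> b /\ ale a b.
Proof.
move=> va vb pa pb; rewrite (aleP va vb); split.
  case=> u [p [q [/andP[u0 uI] ea eb i]]]; split; last by exists u, p, q.
  have H c r : pre true c -> arrives v c -> c = r ++ u -> r != [::].
    move=> pc vc ec; apply: contraTneq uI => r0; move: ec; rewrite r0 /= => <-.
    have [x [s [y ec]]] := Kp_split pc.
    move: pc; rewrite /= ec KpE => /and4P[sc xI _ _].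
    rewrite /= !inE (negbTE xI) orbF negb_and; apply/orP; left.
    have := se_sequence_uniq sc; apply: contraTneq => ->.
    have -> : v = y by move: (arrives_last vc); rewrite ec /= last_rcons.
    by rewrite /= mem_rcons inE eqxx.
  have p0 := H _ _ pa va ea; have q0 := H _ _ pb vb eb.
  move: i; rewrite /adj_in (negbTE p0) (negbTE q0) /= => /andP[/eqP i1 /eqP i2] ab.
  have : p ++ u = q ++ u by rewrite -ea -eb.
  move/eqP; rewrite eqseq_cat.
    by move=> /andP[/eqP epq _]; move/eqP: i1; rewrite epq i2 eq_sym west_neq_north.
  have : size (p ++ u) = size (q ++ u) by rewrite -ea -eb ab.
  by rewrite !size_cat => /addIn.
case=> ab [u [p [q [u0 ea eb i]]]]; exists u, p, q; split=> //.
rewrite u0 /=; apply: (Kp_suffix pa va ea).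
apply/eqP => p0; rewrite p0 /= in ea; rewrite -ea in eb.
by apply: ab; rewrite eb (Kp_head_in pa pb va vb eb).
Qed.

(** A path below [a] would force [a] to enter the common piece from the North, or to be a final
    piece of that path. *)
Lemma horizontal_min a b : arrives v a -> arrives v b -> Kp I a -> Kp I b ->
  horizontal a -> ale a b.
Proof.
move=> va vb pa pb ha; have /orP[//|] := ale_total va vb.
case/(aleP vb va)=> u [p [q [u0 eb ea i]]].
suff q0 : q = [::].
  rewrite q0 /= in ea; rewrite -ea in eb.
  by rewrite eb (Kp_head_in pa pb va vb eb) (ale_refl va).
case: q ea i => // z q ea /andP[_]; rewrite /adj_in /= => /eqP i.
move: ha; rewrite ea; case: (u) u0 i => // x u' _ /= i.
rewrite -cat_cons horizontal_cat /= => /and3P[_ /eqP ex _].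
by move/eqP: ex; rewrite i /= -{1}[x]northK south_neq_east.
Qed.

Lemma vertical_max a b : arrives v a -> arrives v b -> Kp I a -> Kp I b ->
  vertical a -> ale b a.
Proof.
move=> va vb pa pb ha; have /orP[|//] := ale_total va vb.
case/(aleP va vb)=> u [p [q [u0 ea eb i]]].
suff p0 : p = [::].
  rewrite p0 /= in ea; rewrite -ea in eb.
  by rewrite eb (Kp_head_in pa pb va vb eb) (ale_refl va).
case: p ea i => // z p ea /andP[+ _]; rewrite /adj_in /= => /eqP i.
move: ha; rewrite ea; case: (u) u0 i => // x u' _ /= i.
rewrite -cat_cons vertical_cat /= => /and3P[_ /eqP ex _].
by move/eqP: ex; rewrite i /= -{1}[x]westK eq_sym south_neq_east.
Qed.

End GoodExtension.

Lemma Kp_inner I a u p1 p2 : Kp I a -> a = p1 ++ u ++ p2 ->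
  (u != [::]) && all (mem I) u -> p1 != [::] /\ p2 != [::].
Proof.
move=> Pa ea /andP[u0 uI]; have [x [s [y ea']]] := Kp_split Pa.
move: Pa ea; rewrite ea' KpE => /and4P[_ xI yI _] e; split.
  apply: contraNneq xI => p10; case: u u0 uI e => // z u _ /= /andP[zI _].
  by rewrite p10 /= => -[->].
apply: contraNneq yI => p20; case/lastP: u u0 uI e => // u z _.
rewrite all_rcons => /andP[/= zI _]; rewrite p20 cats0 -rcons_cons -rcons_cat.
by move/eqP; rewrite eqseq_rcons => /andP[_ /eqP->].
Qed.

(** Both roles in a conflict between paths require a change of direction: West to South, or North to
    East. *)
Lemma conf1_straight I a b : Kp I a -> straight a ->
  ~ conf1 I a b /\ ~ conf1 I b a.
Proof.
have nse x y : south x = east y -> x = y -> False.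
  by move=> e exy; move/eqP: e; rewrite exy south_neq_east.
move=> Pa sa; split=> -[u [p1 [p2 [q1 [q2 [uI e1 e2 i1 i2]]]]]].
  have [p10 p20] := Kp_inner Pa e1 uI.
  case/andP: i1 i2 => + _ /andP[+ _]; rewrite /adj_in /adj_out (negbTE p10) (negbTE p20) /=.
  case: p2 e1 p20 {e2} => // y p2; case: u uI => // x u _ e1 _ /= /eqP lw /eqP hs.
  move: sa; rewrite /straight e1 horizontal_cat vertical_cat p10 /=.
  rewrite -cat_cons horizontal_cat /= hs south_neq_east !andbF /= lw.
  by case/and3P=> _ /eqP; rewrite -{1}[x]westK => /esym/nse/(_ erefl).
have [p10 p20] := Kp_inner Pa e2 uI.
case/andP: i1 i2 => _ + /andP[_ +]; rewrite /adj_in /adj_out (negbTE p10) (negbTE p20) /=.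
case: q2 e2 p20 {e1} => // y r; case: u uI => // x u _ e1 _ /= /eqP lw /eqP hs.
move: sa; rewrite /straight e1 horizontal_cat vertical_cat p10 /=.
rewrite -cat_cons vertical_cat /= hs [east _ == _]eq_sym south_neq_east !andbF orbF /= lw.
by case/and3P=> _ /eqP; rewrite -{1}[x]northK => /nse/(_ erefl).
Qed.

(** The vertices of the ray are distinct, so it cannot have more than |I| of them in [I] after its
    start. *)
Lemma ray_to_boundary (d : point -> point) (I : {fset point}) v :
  (forall s, path (fun x y => y == d x) v s -> uniq (v :: s)) ->
  exists s e, [/\ all (mem I) s, e \notin I & path (fun x y => y == d x) v (rcons s e)].
Proof.
move=> dU.
have [//|[s [sz sI ss]]] : (exists s e, [/\ all (mem I) s, e \notin I
     & path (fun x y => y == d x) v (rcons s e)]) \/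
    exists s, [/\ size s = #|` I|.+1, all (mem I) s & path (fun x y => y == d x) v s].
  elim: (#|` I|.+1) => [|n [|[s [sz sI ss]]]]; [by right; exists [::]|by left|].
  have ss' : path (fun x y => y == d x) v (rcons s (d (last v s))) by rewrite rcons_path ss /=.
  case: (boolP (d (last v s) \in I)) => dI; last by left; exists s, (d (last v s)).
  by right; exists (rcons s (d (last v s))); rewrite size_rcons sz all_rcons /= dI.
have /andP[_ Us] : uniq (v :: s) by apply: dU.
have : (size s <= #|` I|)%N by apply: uniq_leq_size => // x /(allP sI).
by rewrite sz ltnn.
Qed.

(** The ray is built backwards from [v] and then reversed; [d] will be [west] or [north]. *)
Lemma ray_ex (d : point -> point) (L I : {fset point}) v :
  (forall x, se_step (d x) x) -> v \notin I -> v \in L -> d v \in L ->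
  (forall x, x \in I -> x \in L /\ d x \in L) ->
  exists a, [/\ arrives v a, Kp I a, all (mem L) a
    & sorted (fun x y => x == d y) a].
Proof.
move=> ds vI vL dvL IL.
have rev_ray s : path (fun x y => y == d x) v s ->
    sorted (fun x y => x == d y) (rev (v :: s)) by rewrite rev_sorted.
have [s ps|s [e [sI eI ps]]] := @ray_to_boundary d I v.
  rewrite -rev_uniq; apply: se_sequence_uniq.
  by apply: sub_sorted (rev_ray s ps) => x y /eqP->.
have := rev_ray _ ps; rewrite rev_cons rev_rcons rcons_cons => ra.
have sa : se_sequence (e :: rcons (rev s) v) by apply: sub_sorted ra => x y /eqP->.
exists (e :: rcons (rev s) v); split=> //.
- exact: (@arrives_rcons_se v (e :: rev s)).
- by rewrite KpE sa eI vI all_rev.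
rewrite /= all_rcons /= vL all_rev.
have -> : e = d (last v s) by move: ps; rewrite rcons_path => /andP[_ /eqP].
apply/andP; split; last by apply: sub_all sI => x /IL[].
by case/lastP: s sI {ps ra sa} => //= s x; rewrite last_rcons all_rcons => /andP[/IL[]].
Qed.

(** * Splittings of a finite chain *)

Section Chain.
Variables (T : finType) (A : {set T}) (le : rel T).
Hypotheses (le_anti : {in A &, antisymmetric le}) (le_tot : {in A &, total le})
  (le_tr : {in A & &, transitive le}).
Implicit Types (X Y : {set T}).

Definition down X := (X \subset A) && [forall x in X, forall a in A, le a x ==> (a \in X)].

Lemma downP X : reflect (X \subset A /\
  forall x a, x \in X -> a \in A -> le a x -> a \in X) (down X).
Proof.
apply: (iffP andP) => -[XA H]; split=> //.
  move=> x a xX aA ax.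
  by move/forallP/(_ x)/implyP/(_ xX)/forallP/(_ a)/implyP/(_ aA)/implyP/(_ ax): H.
by apply/forallP => x; apply/implyP => xX; apply/forallP => a;
   apply/implyP => aA; apply/implyP => /H; apply.
Qed.

(** Initial pieces of a chain are nested. Hence they are determined by their sizes, which reduces
    all families at [v] to numbers. *)
Lemma down_sub X Y : down X -> down Y -> (#|X| <= #|Y|)%N -> X \subset Y.
Proof.
case/downP=> XA dX /downP[YA dY] lXY.
apply/subsetP => x xX; apply: contraTT lXY => xY.
have xA := subsetP XA x xX.
rewrite -ltnNge; apply: proper_card; apply/properP; split; last by exists x.
apply/subsetP => y yY; have yA := subsetP YA y yY.
have /orP[] := le_tot xA yA; last exact: dX.
by move=> xy; rewrite (dY y x) in xY.
Qed.

Lemma down_inj X Y : down X -> down Y -> #|X| = #|Y| -> X = Y.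
Proof.
move=> dX dY e; apply/eqP; rewrite eqEcard e leqnn andbT.
by apply: down_sub; rewrite // e.
Qed.

Lemma down_ex i : (i <= #|A|)%N -> exists2 X, down X & #|X| = i.
Proof.
elim: i => [|i IH] iA.
  exists set0; rewrite ?cards0 //; apply/downP.
  by split; [apply: sub0set | move=> x a; rewrite inE].
have [X dX cX] := IH (ltnW iA); have /downP[XA dX'] := dX.
have [m0 m0AX] : exists m, m \in A :\: X.
  by apply/set0Pn; rewrite -card_gt0 cardsD (setIidPr XA) subn_gt0 cX.
(* An element with fewest elements below it is the least one; adding the least element of [A :\: X]
   enlarges the initial piece [X] by one. *)
pose rk m := #|[set b in A | le b m]|.
have [m mAX mmin] := @arg_minnP _ m0 (mem (A :\: X)) rk m0AX.
have /andP[mX mA] : (m \notin X) && (m \in A) by rewrite -in_setD.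
have mle b : b \in A :\: X -> le m b.
  move=> bAX; move: (bAX); rewrite inE => /andP[bX bA].
  have /orP[//|bm] := le_tot mA bA.
  have: [set c in A | le c b] = [set c in A | le c m].
    apply/eqP; rewrite eqEcard [X in _ && X]mmin // andbT.
    apply/subsetP => c; rewrite !inE => /andP[cA cb]; rewrite cA /=.
    exact: le_tr cb bm.
  move/setP/(_ m); rewrite !inE mA /= => ->.
  by have /orP[] := le_tot mA mA.
exists (m |: X); last by rewrite cardsU1 mX cX.
apply/downP; split; first by rewrite subUset sub1set mA XA.
move=> x a; rewrite in_setU1 => /orP[/eqP->|xX] aA ax; last first.
  by rewrite in_setU1 (dX' x a) ?orbT.
rewrite in_setU1; case: (boolP (a \in X)) => aX; first by rewrite orbT.
have ma : le m a by apply: mle; rewrite inE aX aA.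
by rewrite (le_anti aA mA) ?eqxx // ax ma.
Qed.

(* X goes East and Y goes South; a path arriving at v may be continued both ways. *)
Definition overlap X Y := X :|: Y = A /\ {in X & Y, forall x y, le x y}.

(** An overlap amounts to the two initial pieces [X] and [A :\: Y], so the two cardinals determine
    it. *)
Lemma overlap_down X Y : overlap X Y -> down X /\ down (A :\: Y).
Proof.
case=> XYA H.
have inA z : (z \in A) = (z \in X) || (z \in Y) by rewrite -XYA inE.
split; apply/downP; split.
- by rewrite -XYA subsetUl.
- move=> x a xX aA ax; have := aA; rewrite inA => /orP[//|aY].
  have xA : x \in A by rewrite inA xX.
  by rewrite (le_anti aA xA) // ax H.
- exact: subsetDl.
move=> x a; rewrite !inE => /andP[xY xA] aA ax; rewrite aA andbT.
apply: contra (xY) => aY; have xX : x \in X.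
  by move: xA; rewrite inA (negbTE xY) orbF.
by rewrite (le_anti xA aA) // ax H.
Qed.

(** Any two elements of the intersection are below each other, so at most one element is counted
    twice. *)
Lemma overlap_card X Y : overlap X Y ->
  (#|X| + #|Y| = #|A| \/ #|X| + #|Y| = #|A|.+1)%N.
Proof.
case=> XYA H; rewrite -cardsUI XYA.
suff : (#|X :&: Y| <= 1)%N.
  by case: #|_| => [|[|]] // _; [left|right]; rewrite ?addn0 ?addn1.
apply/card_le1P => x; rewrite inE => /andP[xX xY] y.
have inA z : z \in X -> z \in A by rewrite -XYA inE => ->.
rewrite !inE; apply/andP/eqP => [[yX yY]|->] //.
by apply: le_anti; rewrite ?inA // !H.
Qed.

Lemma overlap_inj X Y X' Y' : overlap X Y -> overlap X' Y' ->
  #|X| = #|X'| -> #|Y| = #|Y'| -> X = X' /\ Y = Y'.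
Proof.
move=> oXY oXY' eX eY.
have [dX dY] := overlap_down oXY; have [dX' dY'] := overlap_down oXY'.
have YA : Y \subset A by case: oXY => <- _; apply: subsetUr.
have YA' : Y' \subset A by case: oXY' => <- _; apply: subsetUr.
split; first exact: down_inj.
have/(congr1 (fun Z => A :\: Z)) : A :\: Y = A :\: Y'.
  by apply: down_inj; rewrite // !cardsD (setIidPr YA) (setIidPr YA') eY.
by rewrite !setDDr !setDv !set0U (setIidPr YA) (setIidPr YA').
Qed.

Lemma not_down_le X x y : down X -> x \in X -> y \in A -> y \notin X -> ~~ le y x.
Proof. by move=> /downP[_ dX] xX yA; apply: contra => /(dX x y xX yA). Qed.

Lemma overlap_ex0 i : (i <= #|A|)%N ->
  exists X Y, [/\ overlap X Y, #|X| = i & #|Y| = (#|A| - i)%N].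
Proof.
move=> iA; have [X dX cX] := down_ex iA; have /downP[XA _] := dX.
exists X, (A :\: X); split=> //; last by rewrite cardsD (setIidPr XA) cX.
split; first by apply/setP => z; rewrite !inE; case: (boolP (z \in X)) => [/(subsetP XA)->|].
move=> x y xX; rewrite inE => /andP[yX yA].
have /orP[//|] := le_tot (subsetP XA x xX) yA.
by rewrite (negbTE (not_down_le dX xX yA yX)).
Qed.

Lemma overlap_ex1 i : (i < #|A|)%N ->
  exists X Y, [/\ overlap X Y, #|X| = i.+1 & #|Y| = (#|A| - i)%N].
Proof.
move=> iA; have [X dX cX] := down_ex iA; have /downP[XA _] := dX.
(* [B] is [X] without its greatest element; that element will belong to both members of the pair
   [X], [A :\: B]. *)
have [B dB cB] := down_ex (ltnW iA); have /downP[BA _] := dB.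
have BX : B \subset X by apply: down_sub; rewrite // cX cB.
exists X, (A :\: B); split=> //; last by rewrite cardsD (setIidPr BA) cB.
split.
  apply/setP => z; rewrite !inE; case: (boolP (z \in X)) => [/(subsetP XA)->//|zX].
  by rewrite (contra (subsetP BX z) zX).
move=> x y xX; rewrite inE => /andP[yB yA]; have xA := subsetP XA x xX.
have /orP[//|yx] := le_tot xA yA.
case: (boolP (y \in X)) => yX; last by rewrite (negbTE (not_down_le dX xX yA yX)) in yx.
case: (boolP (x \in B)) => xB; first by rewrite (negbTE (not_down_le dB xB yA yB)) in yx.
have /card_le1_eqP : (#|X :\: B| <= 1)%N by rewrite cardsD (setIidPr BX) cX cB subSnn.
by move=> /(_ x y); rewrite !inE xX yX xB yB => -> //; have /orP[] := le_tot xA xA.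
Qed.

(* X goes East, M ends at v and Y goes South. *)
Definition gap X M Y := X :|: M :|: Y = A /\
  [/\ {in X & Y, forall x y, ~~ le y x}, {in X & M, forall x y, ~~ le y x},
     {in M & Y, forall x y, ~~ le y x} & {in M &, forall x y, x != y -> ~~ le x y}].

Lemma gap_card_le1 X M Y : gap X M Y -> (#|M| <= 1)%N.
Proof.
case=> e [_ _ _ H]; apply/card_le1_eqP => x y xM yM.
have inA z : z \in M -> z \in A by rewrite -e !inE => ->; rewrite orbT.
apply: contraTeq (le_tot (inA x xM) (inA y yM)) => xy.
by rewrite negb_or !H // eq_sym.
Qed.

Lemma gap_card X M Y : gap X M Y -> (#|X| + #|M| + #|Y| = #|A|)%N.
Proof.
case=> e [XY XM MY _].
have inA z : z \in A = [|| z \in X, z \in M | z \in Y] by rewrite -e !inE orbA.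
have rf z : z \in A -> le z z by move=> zA; have /orP[] := le_tot zA zA.
rewrite -e cardsU cardsU.
have -> : X :&: M = set0.
  apply/setP => z; rewrite !inE; apply/negP => /andP[zX zM].
  by have := XM z z zX zM; rewrite rf // inA zX.
have -> : (X :|: M) :&: Y = set0.
  apply/setP => z; rewrite !inE; apply/negP => /andP[/orP[zX|zM] zY].
    by have := XY z z zX zY; rewrite rf // inA zX.
  by have := MY z z zM zY; rewrite rf // inA zM orbT.
by rewrite cards0 !subn0.
Qed.

(** A gap amounts to the nested initial pieces [X] and [X :|: M], so the sizes of [X] and [M]
    determine it. *)
Lemma gap_down X M Y : gap X M Y -> down X /\ down (X :|: M).
Proof.
case=> e [XY XM MY _].
have inA z : z \in A = [|| z \in X, z \in M | z \in Y] by rewrite -e !inE orbA.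
split; apply/downP; split.
- by apply/subsetP => z; rewrite inA => ->.
- move=> x a xX; rewrite inA => /or3P[//|aM|aY] ax.
    by rewrite (negbTE (XM _ _ xX aM)) in ax.
  by rewrite (negbTE (XY _ _ xX aY)) in ax.
- by apply/subsetP => z; rewrite inA inE orbA => ->.
move=> x a; rewrite !inE inA => /orP[xX|xM] /or3P[->|->|aY] ax //; rewrite ?orbT //.
  by rewrite (negbTE (XY _ _ xX aY)) in ax.
by rewrite (negbTE (MY _ _ xM aY)) in ax.
Qed.

Lemma gap_setD X M Y : gap X M Y -> M = (X :|: M) :\: X /\ Y = A :\: (X :|: M).
Proof.
case=> e [XY XM MY _].
have inA z : z \in A = [|| z \in X, z \in M | z \in Y] by rewrite -e !inE orbA.
have rf z : z \in A -> le z z by move=> zA; have /orP[] := le_tot zA zA.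
have nXM z : z \in M -> z \notin X.
  by move=> zM; apply/negP => zX; have := XM z z zX zM; rewrite rf // inA zX.
have nXY z : z \in Y -> z \notin X.
  by move=> zM; apply/negP => zX; have := XY z z zX zM; rewrite rf // inA zX.
have nMY z : z \in Y -> z \notin M.
  by move=> zY; apply/negP => zM; have := MY z z zM zY; rewrite rf // inA zM orbT.
split; apply/setP => z; rewrite !inE.
  case: (boolP (z \in M)) => [/nXM-> //|]; rewrite ?orbF ?orbT //.
  by case: (z \in X).
rewrite inA; case: (boolP (z \in Y)) => [zY|]; first by rewrite (negbTE (nXY _ zY)) (negbTE (nMY _ zY)).
by case: (z \in X); case: (z \in M).
Qed.

Lemma gap_inj X M Y X' M' Y' : gap X M Y -> gap X' M' Y' ->
  #|X| = #|X'| -> #|M| = #|M'| -> [/\ X = X', M = M' & Y = Y'].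
Proof.
move=> g g' eX eM; have [dX dM] := gap_down g; have [dX' dM'] := gap_down g'.
have [-> ->] := gap_setD g; have [-> ->] := gap_setD g'.
have cU X0 M0 Y0 : gap X0 M0 Y0 -> (#|X0 :|: M0| = #|X0| + #|M0|)%N.
  move=> g0; have [e0 _] := gap_setD g0; rewrite cardsU.
  have -> : X0 :&: M0 = set0 by apply/setP => z; rewrite e0 !inE; case: (z \in X0).
  by rewrite cards0 subn0.
have e1 : X = X' by apply: down_inj.
have e2 : X :|: M = X' :|: M'.
  by apply: down_inj; rewrite // (cU _ _ _ g) (cU _ _ _ g') eX eM.
by rewrite e2 e1.
Qed.

Lemma gap_ex0 i : (i <= #|A|)%N ->
  exists X Y, [/\ gap X set0 Y, #|X| = i & #|Y| = (#|A| - i)%N].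
Proof.
move=> iA; have [X dX cX] := down_ex iA; have /downP[XA _] := dX.
exists X, (A :\: X); split=> //; last by rewrite cardsD (setIidPr XA) cX.
split; first by rewrite setU0; apply/setP => z; rewrite !inE; case: (boolP (z \in X)) => [/(subsetP XA)->|].
split=> x y; rewrite ?inE // => xX /andP[yX yA].
exact: not_down_le dX xX yA yX.
Qed.

Lemma gap_ex1 i : (i < #|A|)%N ->
  exists X M Y, [/\ gap X M Y, #|X| = i, #|M| = 1%N & #|Y| = (#|A| - i.+1)%N].
Proof.
move=> iA; have [B dB cB] := down_ex iA; have /downP[BA _] := dB.
have [X dX cX] := down_ex (ltnW iA); have /downP[XA _] := dX.
have XB : X \subset B by apply: down_sub; rewrite // cX cB.
exists X, (B :\: X), (A :\: B).
have cM : #|B :\: X| = 1%N by rewrite cardsD (setIidPr XB) cX cB subSnn.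
split=> //; last by rewrite cardsD (setIidPr BA) cB.
split.
  apply/setP => z; rewrite !inE; case: (boolP (z \in B)) => [zB|zB].
    by rewrite andbT orbN (subsetP BA).
  by rewrite (negbTE (contra (subsetP XB z) zB)).
have XBA x : x \in X -> x \in A by apply: (subsetP XA).
split=> x y; rewrite !inE.
- move=> xX /andP[yB yA]; apply: not_down_le dX xX yA _.
  exact: contra (subsetP XB y) yB.
- by move=> xX /andP[yX /(subsetP BA) yA]; apply: not_down_le dX xX yA yX.
- by move=> /andP[xX xB] /andP[yB yA]; apply: not_down_le dB xB yA yB.
move=> xM yM; have /card_le1_eqP : (#|B :\: X| <= 1)%N by rewrite cM.
by move=> /(_ x y); rewrite !inE => -> //; rewrite eqxx.
Qed.

End Chain.

(** Meant for a [phi] that reads off cardinals: a fiber is then enumerated by a list of numerical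
    splittings. *)
Lemma big_injection (R : Type) (idx : R) (op : Monoid.com_law idx)
  (J : finType) (C : eqType) (D : pred J) (phi : J -> C) (s : seq C) (f : C -> R) :
  {in D &, injective phi} -> uniq s ->
  (forall j, D j -> phi j \in s) -> (forall c, c \in s -> exists2 j, D j & phi j = c) ->
  \big[op/idx]_(j | D j) f (phi j) = \big[op/idx]_(c <- s) f c.
Proof.
move=> inj us Ds sD.
rewrite -big_filter; set e := filter _ _.
rewrite -(big_map phi xpredT) /=; apply: perm_big; apply: uniq_perm => //.
  rewrite map_inj_in_uniq ?filter_uniq ?index_enum_uniq //.
  by move=> x y; rewrite !mem_filter => /andP[Dx _] /andP[Dy _]; apply: inj.
move=> c; apply/mapP/idP => [[j]|/sD[j Dj <-]].
  by rewrite mem_filter => /andP[Dj _] ->; apply: Ds.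
by exists j; rewrite // mem_filter Dj mem_index_enum.
Qed.

(** * Families of walks and their weights *)

Section Walks.
Variable L : grid_shape.
Local Notation walk := (walk L).
Implicit Types (I : {fset point}) (F : {set walk}) (k : bool).

(** The empty walk is only a default for sequences that are not South-East or leave [L]. *)
Definition mkW (p : seq point) : walk :=
  if [pick w : walk | points w == p] is Some w then w
  else @Bseq _ L [::] (leq0n _).

Lemma mkWK p : se_sequence p -> all (mem L) p -> points (mkW p) = p.
Proof.
move=> sp pL; have [w ew] := walkP sp pL; rewrite /mkW.
by case: pickP => [w' /eqP //|/(_ w)]; rewrite ew eqxx.
Qed.

Lemma points_inj : injective (@points L).
Proof. by move=> a b /(inj_map val_inj) /val_inj. Qed.

Lemma points_in (w : walk) : all (mem L) w.
Proof. by apply/allP => x /mapP[y _ ->]; apply: valP. Qed.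

Definition face k I F : bool :=
  [forall p : walk in F, good k I p] &&
  [forall p : walk in F, forall q : walk in F, (p != q) ==> ~~ conf L I p q].

Lemma faceP k I F : reflect
  ((forall p : walk, p \in F -> good k I p) /\
   (forall p q : walk, p \in F -> q \in F -> p != q -> ~ conf1 I p q))
  (face k I F).
Proof.
have Hc (p q : walk) : good k I p -> good k I q ->
    reflect (conf1 I p q \/ conf1 I q p) (conf L I p q).
  by move=> gp gq; exact: (confP I (good_se gp) (good_se gq) (points_in p)).
apply: (iffP andP) => -[H1 H2]; split.
- by move=> p pF; move/forallP/(_ p)/implyP/(_ pF): H1.
- move=> p q pF qF pq.
  have gp : good k I p by move/forallP/(_ p)/implyP/(_ pF): H1.
  have gq : good k I q by move/forallP/(_ q)/implyP/(_ qF): H1.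
  move/forallP/(_ p)/implyP/(_ pF)/forallP/(_ q)/implyP/(_ qF)/implyP/(_ pq): H2.
  by move=> /(Hc _ _ gp gq) nc c; apply: nc; left.
- by apply/forallP => p; apply/implyP/H1.
apply/forallP => p; apply/implyP => pF; apply/forallP => q; apply/implyP => qF.
apply/implyP => pq; apply/(Hc _ _ (H1 _ pF) (H1 _ qF)) => -[].
  exact: H2.
by apply: H2; rewrite // eq_sym.
Qed.

Definition wt (R : comNzRingType) I (u : point -> R) (t : R) (p : seq point) : R :=
  if last o p \in I then t else u (last o p).

(* Walks ended inside I have weight t, the others the weight u of their exit. *)
Definition Z (R : comNzRingType) k I (u : point -> R) (t : R) : R :=
  \sum_(F : {set walk} | face k I F) \prod_(p in F) wt I u t (points p).

End Walks.

(** * Families passing through a last vertex *)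

Section Step.
Variables (L : grid_shape) (I : {fset point}) (v : point).
Local Notation walk := (walk L).
Local Notation I' := (v |` I)%fset.
Hypotheses (vI : v \notin I) (eI : east v \notin I') (sI : south v \notin I').
Hypothesis IL : forall x, x \in I' ->
  [/\ x \in L, north x \in L, south x \in L, east x \in L & west x \in L].
Implicit Types (F X Y M : {set walk}) (k : bool) (a b p q : walk) (d : point).

Local Notation E := (east v).
Local Notation S := (south v).

Definition ext d (a : walk) : walk := mkW L (rcons (points a) d).

Lemma vI' : v \in I'. Proof. by rewrite !inE eqxx. Qed.

Lemma extK d a : d \in [:: E; S] -> arrives v a -> points (ext d a) = rcons a d.
Proof.
move=> dES va; have [_ _ sL eL _] := IL vI'; apply: mkWK.
  rewrite se_rcons (arrives_se va) (arrives_last va) /=; apply/implyP => _.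
  by move: dES; rewrite !inE => /orP[] /eqP->; rewrite ?east_step ?south_step.
rewrite all_rcons points_in andbT /=.
by move: dES; rewrite !inE => /orP[] /eqP->.
Qed.

Lemma E_in : E \in [:: E; S]. Proof. by rewrite inE eqxx. Qed.
Lemma S_in : S \in [:: E; S]. Proof. by rewrite !inE eqxx orbT. Qed.
Hint Resolve E_in S_in : core.

(** Collects the beginnings instead of the walks, so that walks with different exits are compared in
    one chain. *)
Definition thru d F : {set walk} := [set a : walk | arrives v (points a) & ext d a \in F].
Definition ends F : {set walk} := [set a in F | arrives v (points a)].
Definition avoid F : {set walk} := [set p in F | v \notin points p].

(* F0 avoids v; the walks in X, M, Y arrive at v and go East, stop, go South. *)
Definition assemble (F0 X M Y : {set walk}) : {set walk} :=
  F0 :|: (ext E @: X) :|: (ext S @: Y) :|: M.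

Lemma ext_inj d X : d \in [:: E; S] -> {in X, forall a, arrives v (points a)} ->
  {in X &, injective (ext d)}.
Proof.
move=> dES Xv a b aX bX /(congr1 (@points L)).
by rewrite !extK ?Xv // => /rcons_inj[/points_inj].
Qed.

Lemma walk_in k p : v \in points p -> good k I' p ->
  exists a, [/\ arrives v a, pre I v k a &
     [\/ ~~ k /\ p = a, p = ext E a | p = ext S a]].
Proof.
move=> vp gp; have [a [r [va pa ep rO]]] := good_in vI eI sI vp gp.
have sa := arrives_se va.
have aL : all (mem L) a by move: (points_in p); rewrite ep all_cat => /andP[].
have ea := mkWK sa aL; exists (mkW L a); rewrite ea; split=> //.
move: rO; case: (k); rewrite !inE => /orP[/eqP er|].
- by constructor 2; apply: points_inj; rewrite extK ?ea // ep er cats1.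
- by move=> /eqP er; constructor 3; apply: points_inj; rewrite extK ?ea // ep er cats1.
- by constructor 1; split=> //; apply: points_inj; rewrite ea ep er cats0.
case/orP=> /eqP er; [constructor 2|constructor 3];
  by apply: points_inj; rewrite extK ?ea // ep er cats1.
Qed.

Lemma assembleK k F : (forall p, p \in F -> good k I' p) ->
  F = assemble (avoid F) (thru E F) (ends F) (thru S F).
Proof.
move=> gF; apply/setP => p; rewrite !inE; apply/idP/idP => [pF|].
  case: (boolP (v \in points p)) => vp; last by rewrite pF.
  have [a [va pa]] := walk_in vp (gF _ pF).
  case=> [[_ e]|e|e]; rewrite e in pF *.
  - by rewrite pF va orbT.
  - by rewrite imset_f ?orbT // inE va.
  - by rewrite [X in _ || X || _]imset_f ?orbT // inE va.
case/orP=> [/orP[/orP[/andP[]|]|]|/andP[]] //; by case/imsetP => a; rewrite inE => /andP[_ ? ->].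
Qed.

Section Assemble.
Variables (F0 X M Y : {set walk}).
Hypotheses (F0v : {in F0, forall p : walk, v \notin points p})
  (Xv : {in X, forall a, arrives v (points a)}) (Mv : {in M, forall a, arrives v (points a)})
  (Yv : {in Y, forall a, arrives v (points a)}).
Local Notation F := (assemble F0 X M Y).

Lemma v_neq : (v == E = false) * (v == S = false).
Proof.
by split; apply/negbTE; [apply: contraNneq eI|apply: contraNneq sI] => <-; rewrite !inE eqxx.
Qed.

Lemma ext_mem d a : d \in [:: E; S] -> arrives v a -> v \in points (ext d a).
Proof. by move=> dE va; rewrite extK // mem_rcons inE (arrives_mem va) orbT. Qed.

Lemma ext_last d a : d \in [:: E; S] -> arrives v a -> last o (points (ext d a)) = d.
Proof. by move=> dE va; rewrite extK // last_rcons. Qed.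

Lemma ext_arrives d a : d \in [:: E; S] -> arrives v a -> arrives v (ext d a) = false.
Proof.
move=> dE va; apply/negP => /arrives_last; rewrite ext_last // => e.
by move: dE; rewrite e !inE v_neq.1 v_neq.2.
Qed.

Lemma avoid_assemble : avoid F = F0.
Proof.
apply/setP => p; rewrite !inE; apply/andP/idP => [[]|pF0]; last by rewrite pF0 F0v.
case/orP=> [/orP[/orP[//|]|]|/Mv/arrives_mem ->] //.
  by case/imsetP=> a /Xv va ->; rewrite ext_mem.
by case/imsetP=> a /Yv va ->; rewrite ext_mem.
Qed.

Lemma ends_assemble : ends F = M.
Proof.
apply/setP => p; rewrite !inE; apply/andP/idP => [[]|pM]; last by rewrite pM Mv ?orbT.
case/orP=> [/orP[/orP[/F0v + /arrives_mem|]|]|//]; first by move=> /negbTE->.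
  by case/imsetP=> a /Xv va ->; rewrite ext_arrives.
by case/imsetP=> a /Yv va ->; rewrite ext_arrives.
Qed.

Lemma ext_neq a b : arrives v a -> arrives v b -> ext E a != ext S b.
Proof.
move=> va vb; apply/eqP => /(congr1 (fun p : walk => last o (points p))).
by rewrite !ext_last // => /eqP; rewrite eq_sym south_neq_east.
Qed.

Lemma thru_E_assemble : thru E F = X.
Proof.
apply/setP => a; rewrite !inE; apply/andP/idP => [[va]|aX]; last first.
  by rewrite Xv // imset_f ?orbT.
case/orP=> [/orP[/orP[/F0v|]|]|/Mv]; rewrite ?ext_mem ?ext_arrives //.
  case/imsetP=> b bX /(congr1 (@points L)).
  rewrite (extK E_in va) (extK E_in (Xv bX)).
  by move=> /rcons_inj[/points_inj->].
by case/imsetP=> b /Yv vb e; have := ext_neq va vb; rewrite e eqxx.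
Qed.

Lemma thru_S_assemble : thru S F = Y.
Proof.
apply/setP => a; rewrite !inE; apply/andP/idP => [[va]|aX]; last first.
  by rewrite Yv // imset_f ?orbT.
case/orP=> [/orP[/orP[/F0v|]|]|/Mv]; rewrite ?ext_mem ?ext_arrives //.
  by case/imsetP=> b /Xv vb e; have := ext_neq vb va; rewrite e eqxx.
case/imsetP=> b bX /(congr1 (@points L)).
rewrite (extK S_in va) (extK S_in (Yv bX)).
by move=> /rcons_inj[/points_inj->].
Qed.

Lemma prod_assemble (R : comNzRingType) (u : point -> R) t :
  \prod_(p in F) wt I' u t (points p) =
  \prod_(p in F0) wt I' u t (points p) * u E ^+ #|X| * u S ^+ #|Y| * t ^+ #|M|.
Proof.
have dis1 : [disjoint F0 :|: (ext E @: X) :|: (ext S @: Y) & M].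
  apply/pred0P => p /=; apply/negP => /andP[+ /Mv pv]; rewrite !inE.
  case/orP=> [/orP[/F0v|]|]; rewrite ?(arrives_mem pv) //.
    by case/imsetP=> a /Xv va e; rewrite e ext_arrives in pv.
  by case/imsetP=> a /Yv va e; rewrite e ext_arrives in pv.
have dis2 : [disjoint F0 :|: (ext E @: X) & (ext S @: Y)].
  apply/pred0P => p /=; apply/negP => /andP[+ /imsetP[b /Yv vb e]]; rewrite !inE.
  case/orP=> [/F0v|]; rewrite e ?ext_mem //.
  by case/imsetP=> a /Xv va e'; have := ext_neq va vb; rewrite e' eqxx.
have dis3 : [disjoint F0 & (ext E @: X)].
  apply/pred0P => p /=; apply/negP => /andP[/F0v + /imsetP[b /Xv vb e]].
  by rewrite e ext_mem.
have bigUs (A B : {set walk}) : [disjoint A & B] -> \prod_(p in A :|: B) wt I' u t (points p) =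
    \prod_(p in A) wt I' u t (points p) * \prod_(p in B) wt I' u t (points p).
  by move=> dAB; rewrite -bigU //; apply: eq_bigl => p; rewrite !inE.
rewrite /assemble (bigUs _ _ dis1) (bigUs _ _ dis2) (bigUs _ _ dis3).
rewrite !big_imset /=; try exact: ext_inj.
congr (_ * _ * _ * _).
- rewrite -prodr_const; apply: eq_bigr => a /Xv va.
  by rewrite /wt ext_last // (negbTE eI).
- rewrite -prodr_const; apply: eq_bigr => a /Yv va.
  by rewrite /wt ext_last // (negbTE sI).
rewrite -prodr_const; apply: eq_bigr => a /Mv va.
by rewrite /wt (arrives_last va) vI'.
Qed.

End Assemble.


Lemma cut_ext d a : d \in [:: E; S] -> arrives v a -> cut v (ext d a) = a.
Proof. by move=> dE va; rewrite extK // -cats1 cut_cat. Qed.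

Definition through F : {set walk} := thru E F :|: ends F :|: thru S F.

Definition cutset k F : {set walk} :=
  [set a : walk | good k I (points a) & [exists p in F, points a == cut v (points p)]].

Lemma pre_ext k d a : d \in [:: E; S] -> arrives v a -> good k I' (ext d a) -> pre I v k a.
Proof.
move=> dE va ga; have [b [vb pb]] := walk_in (ext_mem dE va) ga.
have H d' : d' \in [:: E; S] -> ext d a = ext d' b -> pre I v k a.
  move=> d'E /(congr1 (fun p : walk => cut v p)); rewrite !cut_ext // => /points_inj->.
  by [].
case=> [[_ e]|/H|/H]; [|exact|exact].
by have := ext_arrives dE va; rewrite e vb.
Qed.

Lemma through_pre k F a : (forall p, p \in F -> good k I' p) -> a \in through F ->
  arrives v a /\ pre I v k a.
Proof.
move=> gF; rewrite !inE => /orP[/orP[|]|] /andP[].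
- by move=> va /gF/(pre_ext E_in va).
- move=> aF va; split=> //; have [b [vb pb]] := walk_in (arrives_mem va) (gF _ aF).
  by case=> [[_ ->]//||] e; move: va; rewrite e ext_arrives.
by move=> va /gF/(pre_ext S_in va).
Qed.

Lemma walk_through k F p : (forall p, p \in F -> good k I' p) -> p \in F ->
  v \in points p -> exists a, [/\ a \in through F, cut v p = a &
     [\/ a \in ends F /\ p = a, a \in thru E F /\ p = ext E a
       | a \in thru S F /\ p = ext S a]].
Proof.
move=> gF pF vp; have [a [va pa H]] := walk_in vp (gF _ pF).
exists a; rewrite !inE va; case: H => [[_ e]|e|e]; rewrite e in pF *.
- by rewrite pF orbT; split; [|apply: cut_arrives|constructor 1].
- by rewrite pF; split; [|apply: cut_ext|constructor 2].
- by rewrite pF !orbT; split; [|apply: cut_ext|constructor 3].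
Qed.

Lemma cutsetE k F : (forall p, p \in F -> good k I' p) ->
  cutset k F = avoid F :|: [set a in through F | good k I (points a)].
Proof.
move=> gF; apply/setP => a; rewrite in_set inE in_set [in RHS]in_set.
apply/andP/orP => [[ga /existsP[p /andP[pF /eqP ap]]]|].
  case: (boolP (v \in points p)) => vp; [right|left].
    have [b [bF eb _]] := walk_through gF pF vp.
    have -> : a = b by apply: points_inj; rewrite ap eb.
    by rewrite bF -(points_inj (etrans ap eb)).
  move: ap; rewrite cut_notin // => /points_inj->.
  by rewrite pF.
case=> [/andP[aF va]|/andP[aF ga]].
  split; first by have := gF a aF; rewrite good_ext.
  by apply/existsP; exists a; rewrite aF cut_notin // eqxx.
split=> //; apply/existsP.
move: aF; rewrite !inE => /orP[/orP[|]|] /andP[].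
- by move=> va aF; exists (ext E a); rewrite aF cut_ext ?eqxx.
- by move=> aF va; exists a; rewrite aF cut_arrives ?eqxx.
- by move=> va aF; exists (ext S a); rewrite aF cut_ext ?eqxx.
Qed.

(* Whether a and b, arriving at v, conflict once a goes South and b East; for
   paths a = b is allowed, since equal arrivals of paths may do both. *)
Definition below k (a b : walk) : bool :=
  if k then (a != b) && ale a b else ale a b.

Lemma belowP k a b : arrives v a -> arrives v b -> pre I v k a -> pre I v k b ->
  low I v a b <-> below k a b.
Proof.
case: k => va vb pa pb /=; last exact: (lowP_F va vb pa pb).
rewrite (lowP_K va vb pa pb); split.
  by case=> ab ->; rewrite andbT; apply/eqP => e; apply: ab; rewrite e.
by case/andP=> ab ->; split=> // /points_inj e; rewrite e eqxx in ab.
Qed.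

(** In a conflict through [v] the lower beginning goes South or stops and the higher one goes East
    or stops. The four clauses exclude these four combinations. *)
Definition ordered k (X M Y : {set walk}) := [/\ {in X & Y, forall x y, ~~ below k y x},
   {in X & M, forall x y, ~~ below k y x}, {in M & Y, forall x y, ~~ below k y x}
   & {in M &, forall x y, x != y -> ~~ below k x y}].

(** Discarded beginnings carry no constraint: a straight path conflicts with nothing, and [[:: v]]
    has no vertex in [I]. This is why the projection [cutset] may forget them. *)
Lemma nconf_extra k a b : arrives v a -> pre I v k a -> ~~ good k I a ->
  ~ conf1 I a b /\ ~ conf1 I b a.
Proof.
case: k => va pa /=.
  by rewrite /pre in pa; rewrite pa /= negbK => sa; apply: conf1_straight.
have [ea|/= ->//] := pre_Fs va pa.
by rewrite ea => _; apply: conf1_single.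
Qed.

(** The two cases of [conf1_ext] separate: conflicts before [v] are seen by the cut family,
    conflicts through [v] only involve the order of the beginnings and their exits. *)
Lemma face_criterion k F : (forall p, p \in F -> good k I' p) ->
  face k I' F <-> face k I (cutset k F) /\ ordered k (thru E F) (ends F) (thru S F).
Proof.
move=> gF; have adF p : p \in F -> adm v p by move/gF/(good_adm vI eI sI).
have ce := conf1_ext vI eI sI.
have inG a : (a \in through F) = [|| a \in thru E F, a \in ends F | a \in thru S F].
  by rewrite /through in_setU in_setU orbA.
have lowF a b : a \in through F -> b \in through F -> low I v a b <-> below k a b.
  move=> /(through_pre gF)[va pa] /(through_pre gF)[vb pb].
  exact: belowP.
split.
  case/faceP=> _ nF; split.
    apply/faceP; split=> [a|a b]; rewrite ?inE; first by case/andP.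
    case/andP=> _ /existsP[p /andP[pF /eqP ap]] /andP[_ /existsP[q /andP[qF /eqP bq]]].
    move=> ab c; have pq : p != q.
      by apply: contraNneq ab => e; apply/eqP/points_inj; rewrite ap bq e.
    apply: (nF p q pF qF pq); apply/(ce _ _ (adF _ pF) (adF _ qF)); left.
    by rewrite -ap -bq.
  have key (p q a b : walk) : p \in F -> q \in F -> p != q ->
      a \in through F -> b \in through F -> cut v p = a -> cut v q = b ->
      v \in points p -> v \in points q ->
      (last o p != E) && (last o q != S) -> ~~ below k a b.
    move=> pF qF pq aF bF ea eb vp vq lpq; apply/negP => /(lowF _ _ aF bF) lab.
    apply: (nF p q pF qF pq); apply/(ce _ _ (adF _ pF) (adF _ qF)); right.
    by rewrite ea eb.
  have [vE vS] := v_neq.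
  split=> a b aX bX; have aG : a \in through F by rewrite inG aX ?orbT.
  - have bG : b \in through F by rewrite inG bX ?orbT.
    move: aX bX; rewrite !inE => /andP[va aF] /andP[vb bF].
    apply: (key (ext S b) (ext E a)); rewrite ?cut_ext ?ext_mem ?ext_last //.
      by rewrite eq_sym ext_neq.
    by rewrite south_neq_east eq_sym south_neq_east.
  - have bG : b \in through F by rewrite inG bX ?orbT.
    move: aX bX; rewrite !inE => /andP[va aF] /andP[bF vb].
    apply: (key b (ext E a)); rewrite ?cut_ext ?cut_arrives ?ext_mem ?ext_last //.
    + by apply: contraTneq vb => ->; rewrite ext_arrives.
    + exact: arrives_mem.
    by rewrite (arrives_last vb) vE eq_sym south_neq_east.
  - have bG : b \in through F by rewrite inG bX ?orbT.
    move: aX bX; rewrite !inE => /andP[aF va] /andP[vb bF].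
    apply: (key (ext S b) a); rewrite ?cut_ext ?cut_arrives ?ext_mem ?ext_last //.
    + by apply: contraTneq va => <-; rewrite ext_arrives.
    + exact: arrives_mem.
    by rewrite (arrives_last va) vS south_neq_east.
  have bG : b \in through F by rewrite inG bX ?orbT.
  move: aX bX; rewrite !inE => /andP[aF va] /andP[bF vb] ab.
  apply: (key a b); rewrite ?cut_arrives ?arrives_mem //.
  by rewrite (arrives_last va) (arrives_last vb) vE vS.
case=> /faceP[_ nC] [XY XM MY MM]; apply/faceP; split=> // p q pF qF pq.
case/(ce _ _ (adF _ pF) (adF _ qF)) => [c|[vp vq lpq lasts]].
  have side (r : walk) : r \in F -> exists a : walk, [/\ cut v r = a, v \in points r -> arrives v a
      & (a \in cutset k F) \/ forall b : walk, ~ conf1 I a b /\ ~ conf1 I b a].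
    move=> rF; case: (boolP (v \in points r)) => vr.
      have [a [aG ea _]] := walk_through gF rF vr; exists a.
      have [va pa] := through_pre gF aG; split=> //.
      case: (boolP (good k I a)) => ga; last by right=> b; apply: nconf_extra va pa ga.
      by left; rewrite (cutsetE gF) in_setU in_set [in X in _ || X]in_set aG ga orbT.
    exists r; rewrite cut_notin //; split=> //; left.
    by rewrite (cutsetE gF) in_setU in_set rF vr.
  have [a [ea va aC]] := side p pF; have [b [eb vb bC]] := side q qF.
  (* Equal cuts do not conflict: if they end at [v] this is [conf1_irr], and if neither walk meets
     [v] the two walks are equal. *)
  rewrite ea eb in c; case: (eqVneq a b) => ab.
    rewrite -ab in c eb vb.
    case: (boolP (v \in points p)) => [/va/(conf1_irr vI)//|vp].
    case: (boolP (v \in points q)) => [/vb/(conf1_irr vI)//|vq].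
    move: ea eb; rewrite !cut_notin // => /points_inj ea /points_inj eb.
    by rewrite ea eb eqxx in pq.
  case: aC => [aC|/(_ b)[]//]; case: bC => [bC|/(_ a)[]//].
  exact: nC aC bC ab c.
have [a [aG ea pa]] := walk_through gF pF vp.
have [b [bG eb pb]] := walk_through gF qF vq.
have [va _] := through_pre gF aG; have [vb _] := through_pre gF bG.
move: lpq; rewrite ea eb => /(lowF _ _ aG bG) lab; move: lab; apply/negP.
move: lasts pq; case: pa => -[aX ->]; case: pb => -[bX ->]; rewrite ?ext_last // ?eqxx ?andbF //.
- by move=> _; apply: MM.
- by move=> _ _; apply: XM.
- by move=> _ _; apply: MY.
by move=> _ _; apply: XY.
Qed.

End Step.

(** * The fiber over a family on the smaller set *)

Section Fibers.
Variables (L : grid_shape) (I : {fset point}) (v : point).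
Local Notation walk := (walk L).
Local Notation I' := (v |` I)%fset.
Hypotheses (vI : v \notin I) (eI : east v \notin I') (sI : south v \notin I').
Hypothesis IL : forall x, x \in I' ->
  [/\ x \in L, north x \in L, south x \in L, east x \in L & west x \in L].
Implicit Types (F X Y M A : {set walk}) (k : bool) (a b p q : walk) (d : point).

Local Notation E := (east v).
Local Notation S := (south v).
Local Notation arr := (fun a : walk => arrives v (points a)).
Let sle : rel walk := fun a b => ale (points a) (points b).

Lemma sle_order A : {in A, forall a, arr a} ->
  [/\ {in A &, antisymmetric sle}, {in A &, total sle} & {in A & &, transitive sle}].
Proof.
move=> Av; split.
- by move=> a b /Av va /Av vb /andP[ab ba]; apply: points_inj; apply: (ale_anti va vb).
- by move=> a b /Av va /Av vb; apply: (ale_total va vb).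
by move=> b a c /Av vb /Av va /Av vc; apply: (ale_trans va vb vc).
Qed.

Variable F' : {set walk}.
Definition arrivals : {set walk} := [set a in F' | arrives v (points a)].
Local Notation A := arrivals.

Lemma arrivalsP a : a \in A -> arr a.
Proof. by rewrite inE => /andP[]. Qed.

Section Fiber.
Variable k : bool.
Hypothesis fF' : face k I F'.

Lemma face_good p : p \in F' -> good k I p.
Proof. by have /faceP[+ _] := fF'; apply. Qed.

Lemma arrivalsE p : p \in F' -> (p \in A) = (v \in points p).
Proof.
move=> pF; rewrite inE pF /=; apply/idP/idP; first exact: arrives_mem.
by case/(good_arrives vI eI sI (face_good pF)).
Qed.

Lemma avoidF' : avoid v F' = F' :\: A.
Proof.
apply/setP => p; rewrite in_set in_setD.
by case: (boolP (p \in F')) => pF; rewrite ?andbF // arrivalsE // andbT.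
Qed.

Definition in_fiber F := face k I' F && (cutset I v k F == F').

Lemma fiber_in F : in_fiber F ->
  [/\ forall p, p \in F -> good k I' p, avoid v F = F' :\: A,
     [set a in through v F | good k I (points a)] = A
    & ordered k (thru v E F) (ends v F) (thru v S F)].
Proof.
case/andP=> fF /eqP eF.
have gF : forall p, p \in F -> good k I' p by case/faceP: fF.
have [_ ord] := (face_criterion vI eI sI IL gF).1 fF.
have eC := cutsetE vI eI sI IL gF; rewrite eF in eC.
have tv a : a \in through v F -> arr a by case/(through_pre vI eI sI IL gF).
have F'E a : (a \in F') = (a \in F) && (v \notin points a) || (a \in through v F) && good k I (points a).
  by rewrite {1}eC in_setU !in_set.
split=> //.
  rewrite -avoidF'; apply/setP => p; rewrite !in_set F'E.
  case: (boolP (v \in points p)) => vp; rewrite ?andbF ?andbT //=.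
  suff -> : (p \in through v F) = false by rewrite orbF.
  by apply/negP => /tv/arrives_mem; apply/negP.
apply/setP => a; rewrite [LHS]in_set [RHS]in_set F'E.
case: (boolP (a \in through v F)) => aT /=.
  have va := tv _ aT; rewrite va (arrives_mem va) andbF andbT //.
rewrite orbF; apply/esym/negP => /andP[/andP[_ vn] /arrives_mem].
by rewrite (negbTE vn).
Qed.

Lemma fiber_eq F F1 : in_fiber F -> in_fiber F1 -> thru v E F = thru v E F1 ->
  thru v S F = thru v S F1 -> ends v F = ends v F1 -> F = F1.
Proof.
move=> DF DF1 eX eY eM.
have [gF aF _ _] := fiber_in DF; have [gF1 aF1 _ _] := fiber_in DF1.
rewrite (assembleK vI eI sI IL gF) (assembleK vI eI sI IL gF1).
by rewrite aF aF1 eX eY eM.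
Qed.

Section Make.
Variables (X M Y : {set walk}).
Hypotheses (Xv : {in X, forall a, arr a /\ pre I v k a})
  (Mv : {in M, forall a, arr a /\ pre I v k a})
  (Yv : {in Y, forall a, arr a /\ pre I v k a}).
Hypotheses (kX : k -> {in X, forall a : walk, ~~ horizontal a})
  (kY : k -> {in Y, forall a : walk, ~~ vertical a})  (kM : k -> M = set0).
Hypothesis (goodXMY : [set a in X :|: M :|: Y | good k I (points a)] = A).
Hypothesis ord : ordered k X M Y.
Let F := assemble v (F' :\: A) X M Y.

Let F0v : {in F' :\: A, forall p : walk, v \notin points p}.
Proof. by move=> p; rewrite -avoidF' in_set => /andP[]. Qed.
Let Xa : {in X, forall a, arr a}. Proof. by move=> a /Xv[]. Qed.
Let Ma : {in M, forall a, arr a}. Proof. by move=> a /Mv[]. Qed.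
Let Ya : {in Y, forall a, arr a}. Proof. by move=> a /Yv[]. Qed.

Lemma make_sets : [/\ avoid v F = F' :\: A, thru v E F = X, ends v F = M & thru v S F = Y].
Proof.
by split; [apply: avoid_assemble IL _ _ _ _ _ _ _ _|apply: thru_E_assemble eI sI IL _ _ _ _ _ _ _ _
  |apply: ends_assemble eI sI IL _ _ _ _ _ _ _ _|apply: thru_S_assemble eI sI IL _ _ _ _ _ _ _ _].
Qed.

Lemma make_good p : p \in F -> good k I' p.
Proof.
rewrite /F /assemble !in_setU => /orP[/orP[/orP[pF|]|]|].
- have vp := F0v pF; rewrite good_ext //; apply: face_good.
  by move: pF; rewrite in_setD => /andP[].
- case/imsetP=> a aX ->; have [va pa] := Xv aX.
  rewrite (extK IL) ?inE ?eqxx // -cats1; apply: (good_cat vI eI sI va pa).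
    by rewrite /outs; case: (k); rewrite !inE eqxx ?orbT.
  case: k kX => //= /(_ isT _ aX) ha.
  by rewrite /straight !(horizontal_arrives va) // orbF.
- case/imsetP=> a aY ->; have [va pa] := Yv aY.
  rewrite (extK IL) ?inE ?eqxx ?orbT // -cats1; apply: (good_cat vI eI sI va pa).
    by rewrite /outs; case: (k); rewrite !inE eqxx ?orbT.
  case: k kY => //= /(_ isT _ aY) ha.
  by rewrite /straight !(horizontal_arrives va).
move=> pM; have [va pa] := Mv pM; case: k kM pa => [/(_ isT) M0|_ pa].
  by rewrite M0 inE in pM.
by have := @good_cat I v vI eI sI false p [::] va pa; rewrite cats0; apply.
Qed.

Lemma make_in_fiber : in_fiber F.
Proof.
have [sa sX sM sY] := make_sets.
have gF p : p \in F -> good k I' p := @make_good p.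
have eC : cutset I v k F = F'.
  rewrite (cutsetE vI eI sI IL gF) sa /through sX sM sY goodXMY.
  apply/setP => p; rewrite in_setU in_setD; case: (boolP (p \in A)) => //=.
    by rewrite inE => /andP[->].
  by rewrite orbF.
rewrite /in_fiber eC eqxx andbT; apply/(face_criterion vI eI sI IL gF).
by rewrite eC sX sM sY.
Qed.

End Make.
End Fiber.

Lemma prod_fiber (R : comNzRingType) k F (u : point -> R) t : face k I F' -> in_fiber k F ->
  \prod_(p in F) wt I' u t (points p) = \prod_(p in F' :\: A) wt I' u t (points p) *
    (u E ^+ #|thru v E F| * u S ^+ #|thru v S F| * t ^+ #|ends v F|).
Proof.
move=> fF' DF; have [gF aF _ _] := fiber_in fF' DF.
rewrite {1}(assembleK vI eI sI IL gF) (prod_assemble eI sI IL) ?aF -?mulrA //.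
- by move=> p; rewrite -(avoidF' fF') in_set => /andP[].
- by move=> a; rewrite in_set => /andP[].
- by move=> a; rewrite in_set => /andP[].
by move=> a; rewrite in_set => /andP[].
Qed.

End Fibers.

Lemma Kp_last I a : Kp I a -> last o a \notin I.
Proof. by case: a => [|x [|y a]] // /and4P[]. Qed.

Lemma Kp_not_both I a : Kp I a -> horizontal a -> vertical a -> False.
Proof.
case: a => [|x [|y a]] // _; rewrite /horizontal /vertical /= => /andP[/eqP-> _].
by rewrite eq_sym south_neq_east.
Qed.

(** * Continuations of a nonkissing family *)

Definition path_splits n : seq (nat * nat) :=
  [seq (i, n - i)%N | i <- iota 0 n.+1] ++ [seq (i, n.+1 - i)%N | i <- iota 0 n.+2].

(** The total [n.+1] belongs to the case in which one beginning is counted both East and South. *)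
Lemma path_splitsP n a b :
  ((a, b) \in path_splits n) = (a + b == n)%N || (a + b == n.+1)%N.
Proof.
have H m : ((a, b) \in [seq (i, m - i)%N | i <- iota 0 m.+1]) = (a + b == m)%N.
  apply/mapP/eqP => [[i]|<-].
    by rewrite mem_iota => /andP[_ i1] [-> ->]; apply: subnKC.
  by exists a; rewrite ?mem_iota ?addKn // add0n ltnS leq_addr.
by rewrite mem_cat !H.
Qed.

Lemma path_splits_uniq n : uniq (path_splits n).
Proof.
rewrite cat_uniq; apply/and3P; split.
- by rewrite map_inj_uniq ?iota_uniq // => i j [].
- apply/hasPn => c /mapP[i]; rewrite mem_iota => /andP[_ i1] ->.
  have H (m j : nat) : (j < m.+1)%N -> (m.+1 - j)%N = (m - j)%N -> False by lia.
  by apply/negP => /mapP[j]; rewrite mem_iota => /andP[_ j1] [->]; apply: H.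
by rewrite map_inj_uniq ?iota_uniq // => i j [].
Qed.

Section PathFiber.
Variables (L : grid_shape) (I : {fset point}) (v : point).
Local Notation walk := (walk L).
Local Notation I' := (v |` I)%fset.
Hypotheses (vI : v \notin I) (eI : east v \notin I') (sI : south v \notin I').
Hypothesis IL : forall x, x \in I' ->
  [/\ x \in L, north x \in L, south x \in L, east x \in L & west x \in L].
Implicit Types (F X Y M : {set walk}) (a b p q : walk).

Local Notation E := (east v).
Local Notation S := (south v).
Local Notation arr := (fun a : walk => arrives v (points a)).
Local Notation sle := (fun a b : walk => ale (points a) (points b)).

Lemma straight_arrivals : exists hor ver : walk,
  [/\ arr hor, Kp I hor & horizontal hor] /\ [/\ arr ver, Kp I ver & vertical ver].
Proof.
have [vL nL _ _ wL] := IL (vI' I v).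
have IW x : x \in I -> x \in L /\ west x \in L.
  by move=> xI; have [|? _ _ _ ?] := @IL x; rewrite // !inE xI orbT.
have IN x : x \in I -> x \in L /\ north x \in L.
  by move=> xI; have [|? ? _ _ _] := @IL x; rewrite // !inE xI orbT.
have [h [hv hK hL hh]] := ray_ex west_step vI vL wL IW.
have [w [wv wK vwL ww]] := ray_ex north_step vI vL nL IN.
exists (mkW L h), (mkW L w); rewrite !mkWK ?(arrives_se hv) ?(arrives_se wv) //.
split; split=> //.
  by apply: sub_sorted hh => x y /eqP->; rewrite westK.
by apply: sub_sorted ww => x y /eqP->; rewrite northK.
Qed.

Variable F' : {set walk}.
Hypothesis fF' : face true I F'.
Local Notation A := (arrivals v F').

(** The horizontal and the vertical path into [v] are the least and the greatest possible beginning.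
    Letting the first go East and the second South adds two straight paths, which no face contains
    and which disturb nothing. After this completion the families are exactly the overlaps of a
    chain with two more elements than [A], and removing the two formal members restores the
    counts. *)
Lemma path_fiber (R : comNzRingType) (f : nat * nat -> R) :
  \sum_(F | in_fiber I v F' true F) f (#|thru v E F|, #|thru v S F|) =
  \sum_(c <- path_splits #|A|) f c.
Proof.
have [hor [ver [[hv hK hh] [wv wK ww]]]] := straight_arrivals.
pose Ap := hor |: (ver |: A).
have Agood a : a \in A -> good true I a.
  by rewrite inE => /andP[aF _]; apply: (face_good fF' aF).
have ApK a : a \in Ap -> arr a /\ Kp I a.
  rewrite !in_setU1 => /or3P[/eqP->|/eqP->|aA] //.
  by split; [apply: arrivalsP aA|case/andP: (Agood a aA)].
have isH a : arr a -> Kp I a -> horizontal a -> a = hor.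
  move=> va Ka ha; apply: points_inj; apply: (ale_anti va hv).
    exact: horizontal_min hv Ka hK ha.
  exact: horizontal_min va hK Ka hh.
have isV a : arr a -> Kp I a -> vertical a -> a = ver.
  move=> va Ka ha; apply: points_inj; apply: (ale_anti va wv).
    exact: vertical_max va wK Ka ww.
  exact: vertical_max wv Ka wK ha.
have nA a : a \in A -> ~~ horizontal a && ~~ vertical a.
  by move=> /Agood /andP[_]; rewrite negb_or.
have hA : hor \notin A by apply/negP => /nA; rewrite hh.
have wA : ver \notin A by apply/negP => /nA; rewrite ww andbF.
have hw : hor != ver by apply/eqP => e; apply: (Kp_not_both hK hh); rewrite e.
have cAp : #|Ap| = #|A|.+2.
  by rewrite /Ap !cardsU1 in_setU1 negb_or hw hA wA.
have [an tot tr] := sle_order (fun a aA => (ApK a aA).1).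
have inA a : a \in Ap -> a != hor -> a != ver -> a \in A.
  by rewrite !in_setU1 => /or3P[->|->|].
have fib F : in_fiber I v F' true F ->
   [/\ overlap Ap sle (hor |: thru v E F) (ver |: thru v S F),
     hor \notin thru v E F, ver \notin thru v S F & ends v F = set0].
  move=> DF; have [gF _ eA [XY _ _ _]] := fiber_in vI eI sI IL fF' DF.
  have tp := through_pre vI eI sI IL gF.
  have M0 : ends v F = set0.
    apply/setP => a; rewrite !inE; apply/negP => /andP[/gF/andP[/Kp_last + _] /arrives_last e].
    by rewrite e !inE eqxx.
  have XG a : a \in thru v E F -> a \in through v F by rewrite /through !in_setU => ->.
  have YG a : a \in thru v S F -> a \in through v F by rewrite /through !in_setU => ->; rewrite orbT.
  have GA a : a \in through v F -> a \in Ap.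
    move=> aG; have [va /= Ka] := tp _ aG.
    rewrite !in_setU1; case: (boolP (straight a)) => [/orP[ha|wa]|sa].
    - by rewrite (isH a) ?eqxx.
    - by rewrite (isV a) ?eqxx ?orbT.
    by rewrite -eA in_set aG /= Ka sa !orbT.
  split=> //.
  - split.
      apply/setP => a; rewrite in_setU !in_setU1; apply/idP/idP.
        case/orP=> /orP[/eqP->|].
        + by rewrite ?in_setU1 eqxx.
        + by move/XG/GA; rewrite !in_setU1.
        + by rewrite ?in_setU1 eqxx orbT.
        by move/YG/GA; rewrite !in_setU1.
      rewrite ?in_setU1 => /or3P[->|->|] //; rewrite ?orbT //.
      by rewrite -eA in_set /through M0 setU0 in_setU => /andP[/orP[]-> _]; rewrite ?orbT.
    move=> x y; rewrite !in_setU1 => xX yY.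
    have [vx Kx] : arr x /\ Kp I (points x) by case/orP: xX => [/eqP->|/XG/tp[]].
    have [vy Ky] : arr y /\ Kp I (points y) by case/orP: yY => [/eqP->|/YG/tp[]].
    case/orP: xX => [/eqP->|xX]; first exact: (horizontal_min hv vy hK Ky hh).
    case/orP: yY => [/eqP->|yY]; first exact: (vertical_max wv vx wK Kx ww).
    have := XY x y xX yY; rewrite /= negb_and negbK => /orP[/eqP->|].
      exact: (ale_refl vx).
    by have /orP[->|->] := ale_total vx vy.
  - rewrite in_set hv /=; apply/negP => /gF/andP[_].
    by rewrite (extK IL) ?inE ?eqxx // -cats1 /straight !(horizontal_arrives hv) hh.
  rewrite in_set wv /=; apply/negP => /gF/andP[_].
  by rewrite (extK IL) ?inE ?eqxx ?orbT // -cats1 /straight !(horizontal_arrives wv) ww orbT.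
pose phi F := (#|thru v E F|, #|thru v S F|).
rewrite -(@big_injection _ _ _ _ _ (in_fiber I v F' true) phi) //.
- move=> F F1 DF DF1 [eX eY].
  have [o1 h1 w1 m1] := fib F DF; have [o2 h2 w2 m2] := fib F1 DF1.
  have cXX : #|hor |: thru v E F| = #|hor |: thru v E F1| by rewrite !cardsU1 h1 h2 eX.
  have cYY : #|ver |: thru v S F| = #|ver |: thru v S F1| by rewrite !cardsU1 w1 w2 eY.
  have [e1 e2] := overlap_inj an tot o1 o2 cXX cYY.
  apply: (fiber_eq vI eI sI IL fF' DF DF1); last by rewrite m1 m2.
    by rewrite -(setU1K h1) e1 setU1K.
  by rewrite -(setU1K w1) e2 setU1K.
- exact: path_splits_uniq.
- move=> F DF; have [o1 h1 w1 m1] := fib F DF.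
  have := overlap_card an o1; rewrite cAp !cardsU1 h1 w1 /phi path_splitsP !add1n addSn addnS.
  by case=> -[->]; rewrite eqxx ?orbT.
move=> c cs.
suff [XX [YY [ov cX cY]]] : exists XX YY, [/\ overlap Ap sle XX YY, #|XX| = c.1.+1 & #|YY| = c.2.+1].
  have XYA := ov.1.
  have XA a : a \in XX -> a \in Ap by rewrite -XYA in_setU => ->.
  have YA a : a \in YY -> a \in Ap by rewrite -XYA in_setU => ->; rewrite orbT.
  (* [XX] is a nonempty initial piece, so it contains the least element. *)
  have hX : hor \in XX.
    have /card_gt0P[x xX] : (0 < #|XX|)%N by rewrite cX.
    have [dX _] := overlap_down an ov; have /downP[_ H] := dX.
    have [vx Kx] := ApK _ (XA _ xX).
    apply: (H x) => //; first by rewrite !in_setU1 eqxx.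
    exact: (horizontal_min hv vx hK Kx hh).
  (* If the greatest element lies in [XX], it is below every member of the nonempty set [YY], hence
     equal to one. *)
  have wY : ver \in YY.
    have /card_gt0P[y yY] : (0 < #|YY|)%N by rewrite cY.
    have wAp : ver \in Ap by rewrite !in_setU1 eqxx orbT.
    have := wAp; rewrite -XYA in_setU => /orP[wX|//].
    have [vy Ky] := ApK _ (YA _ yY).
    rewrite (_ : ver = y) //; apply: an => //; first exact: YA.
    apply/andP; split; first exact: (ov.2 _ _ wX yY).
    exact: (vertical_max wv vy wK Ky ww).
  have G0 : forall a, a \in (XX :\ hor) :|: set0 :|: (YY :\ ver) -> a \in Ap.
    by move=> a; rewrite setU0 in_setU !in_setD1 => /orP[/andP[_ /XA]|/andP[_ /YA]].
  exists (assemble v (F' :\: A) (XX :\ hor) set0 (YY :\ ver)).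
    apply: (make_in_fiber vI eI sI IL) => //.
    + by move=> a; rewrite in_setD1 => /andP[_ /XA/ApK].
    + by move=> a; rewrite inE.
    + by move=> a; rewrite in_setD1 => /andP[_ /YA/ApK].
    + move=> _ a; rewrite in_setD1 => /andP[ah /XA/ApK[va Ka]].
      by apply: contra ah => ha; apply/eqP/isH.
    + move=> _ a; rewrite in_setD1 => /andP[ah /YA/ApK[va Ka]].
      by apply: contra ah => ha; apply/eqP/isV.
    + apply/setP => a; rewrite in_set; apply/andP/idP.
        case=> /G0 aAp /andP[_]; rewrite negb_or => /andP[nh nw].
        apply: inA => //; first by apply: contraNneq nh => ->.
        by apply: contraNneq nw => ->.
      move=> aA; split; last exact: Agood.
      have aAp : a \in Ap by rewrite !in_setU1 aA !orbT.
      have /andP[nh nw] := nA a aA.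
      have ah : a != hor by apply: contraNneq nh => ->.
      have aw : a != ver by apply: contraNneq nw => ->.
      by move: aAp; rewrite -XYA setU0 !in_setU !in_setD1 ah aw.
    split; try by move=> x y; rewrite ?inE ?andbF.
    move=> x y; rewrite !in_setD1 => /andP[_ xX] /andP[_ yY] /=.
    rewrite negb_and negbK; case: (boolP (sle y x)) => yx; rewrite ?orbT // orbF.
    apply/eqP; apply: an; [exact: YA|exact: XA|].
    by apply/andP; split; [exact: yx|exact: (ov.2 x y xX yY)].
  have [||| _ sX _ sY] := @make_sets L I v vI eI sI IL F' true fF' (XX :\ hor) set0 (YY :\ ver).
  + by move=> a; rewrite in_setD1 => /andP[_ /XA/ApK].
  + by move=> a; rewrite inE.
  + by move=> a; rewrite in_setD1 => /andP[_ /YA/ApK].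
  rewrite /phi sX sY; case: (c) cX cY => c1 c2 /=.
  by rewrite (cardsD1 hor XX) hX (cardsD1 ver YY) wY !add1n => -[->] [->].
case: c cs => c1 c2; rewrite path_splitsP => /orP[] /eqP cs.
  have le1 : (c1.+1 <= #|Ap|)%N by rewrite cAp ltnS -cs leqW ?leq_addr.
  have [XX [YY [ov cX cY]]] := overlap_ex0 an tot tr le1.
  by exists XX, YY; split=> //; rewrite cY cAp -cs subSS -addnS addKn.
have le1 : (c1 < #|Ap|)%N by rewrite cAp ltnS -cs leq_addr.
have [XX [YY [ov cX cY]]] := overlap_ex1 an tot tr le1.
by exists XX, YY; split=> //; rewrite cY cAp -cs -addnS addKn.
Qed.

End PathFiber.

(** * Continuations of a nonfriendly family *)

Definition gap_splits n : seq (nat * nat * nat) :=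
  [seq (i, n - i, 0)%N | i <- iota 0 n.+1] ++ [seq (i, n - i.+1, 1)%N | i <- iota 0 n].

Lemma gap_splitsP n a b m :
  ((a, b, m) \in gap_splits n) = (a + b + m == n)%N && (m <= 1)%N.
Proof.
rewrite mem_cat; apply/orP/andP => [[]|[/eqP <-]].
- move=> /mapP[i]; rewrite mem_iota => /andP[_ i1] [-> -> ->]; split=> //.
  have H (k : nat) : (k < 0 + n.+1)%N -> (k + (n - k) + 0)%N == n by lia.
  exact: H.
- move=> /mapP[i]; rewrite mem_iota => /andP[_ i1] [-> -> ->]; split=> //.
  have H (k : nat) : (k < 0 + n)%N -> (k + (n - k.+1) + 1)%N == n by lia.
  exact: H.
case: m => [|[|m]] // _; [left|right]; apply/mapP; exists a; rewrite ?mem_iota.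
- by lia.
- by congr (_, _, _); lia.
- by lia.
by congr (_, _, _); lia.
Qed.

Lemma gap_splits_uniq n : uniq (gap_splits n).
Proof.
rewrite cat_uniq; apply/and3P; split.
- by rewrite map_inj_uniq ?iota_uniq // => i j [].
- by apply/hasPn => c /mapP[i _ ->]; apply/negP => /mapP[j _ []].
by rewrite map_inj_uniq ?iota_uniq // => i j [].
Qed.

(** The second list is for the families in which some segment starts at [v]: such a start is one
    more arrival. *)
Definition segment_splits n := gap_splits n ++ gap_splits n.+1.

Lemma segment_splits_uniq n : uniq (segment_splits n).
Proof.
rewrite cat_uniq !gap_splits_uniq andbT andTb; apply/hasPn => -[[a b] m].
rewrite !gap_splitsP => /andP[/eqP-> _]; apply/negP => /andP[/eqP/esym].
by move/n_Sn.
Qed.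

Section SegmentFiber.
Variables (L : grid_shape) (I : {fset point}) (v : point).
Local Notation walk := (walk L).
Local Notation I' := (v |` I)%fset.
Hypotheses (vI : v \notin I) (eI : east v \notin I') (sI : south v \notin I').
Hypothesis IL : forall x, x \in I' ->
  [/\ x \in L, north x \in L, south x \in L, east x \in L & west x \in L].
Implicit Types (F X Y M G : {set walk}) (a b p q : walk).

Local Notation E := (east v).
Local Notation S := (south v).
Local Notation arr := (fun a : walk => arrives v (points a)).
Local Notation sle := (fun a b : walk => ale (points a) (points b)).

Variable F' : {set walk}.
Hypothesis fF' : face false I F'.
Local Notation A := (arrivals v F').

(** The single vertex [b0] is the only beginning not seen in [F'], and it is optional. With or
    without it every beginning has exactly one continuation, and at most one of them stops at [v],
    so the families are the gaps of [A] and of [b0 |: A]. *)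
Lemma segment_fiber (R : comNzRingType) (f : nat * nat * nat -> R) :
  \sum_(F | in_fiber I v F' false F) f (#|thru v E F|, #|thru v S F|, #|ends v F|) =
  \sum_(c <- segment_splits #|A|) f c.
Proof.
pose b0 := mkW L [:: v].
have [vL _ _ _ _] := IL (vI' I v).
have eb : points b0 = [:: v] by rewrite mkWK //= vL.
have vb : arr b0 by rewrite /= eb /arrives inE eqxx.
have nb : ~~ good false I b0 by apply/negP; rewrite eb => /and3P[_]; rewrite (negbTE vI).
have pb : pre I v false b0 by rewrite eb; apply/and3P; split; rewrite ?(vI' I v).
have Agood a : a \in A -> good false I a.
  by rewrite inE => /andP[aF _]; apply: (face_good fF' aF).
have bA : b0 \notin A by apply/negP => /Agood; apply/negP.
have Apre a : a \in b0 |: A -> arr a /\ pre I v false a.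
  rewrite in_setU1 => /orP[/eqP->|aA] //.
  have va := arrivalsP aA.
  exact: (good_arrives vI eI sI (Agood _ aA) (arrives_mem va)).
have fib F : in_fiber I v F' false F ->
  [/\ gap (through v F) sle (thru v E F) (ends v F) (thru v S F),
      through v F = A \/ through v F = b0 |: A & {in through v F, forall a, arr a}].
  move=> DF; have [gF _ eA ord] := fiber_in vI eI sI IL fF' DF.
  have tp := through_pre vI eI sI IL gF.
  have [o1 o2 o3 o4] := ord.
  split; [by split| |by move=> a /tp[]].
  have GA a : a \in through v F -> a != b0 -> a \in A.
    move=> aG ab; have [va pa] := tp _ aG.
    rewrite -eA in_set aG; have [ea|//] := pre_Fs va pa.
    by move: ab; rewrite (_ : a = b0) ?eqxx //; apply: points_inj; rewrite eb.
  have AG a : a \in A -> a \in through v F by rewrite -eA in_set => /andP[].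
  case: (boolP (b0 \in through v F)) => bG; [right|left]; apply/setP => a; last first.
    apply/idP/idP => [aG|/AG//]; apply: GA => //.
    by apply: contraNneq bG => <-.
  rewrite in_setU1; apply/idP/orP => [aG|[/eqP->|/AG]//].
  by case: (eqVneq a b0) => [|ab]; [left|right; apply: GA].
pose phi F := (#|thru v E F|, #|thru v S F|, #|ends v F|).
rewrite -(@big_injection _ _ _ _ _ (in_fiber I v F' false) phi) //.
- move=> F F1 DF DF1 [eX eY eM].
  have [g1 t1 a1] := fib F DF; have [g2 t2 a2] := fib F1 DF1.
  have [an tot tr] := sle_order a1; have [an2 tot2 _] := sle_order a2.
  (* The two candidates for the set of beginnings differ in size by one, so the total of the three
     cardinals tells which one occurs. *)
  have eG : through v F = through v F1.
    have : #|through v F| = #|through v F1|.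
      by rewrite -(gap_card tot g1) -(gap_card tot2 g2) eX eM eY.
    by case: t1 t2 => -> [] -> //; rewrite cardsU1 bA add1n; [move/n_Sn|move/esym/n_Sn].
  rewrite -eG in g2; have [e1 e2 e3] := gap_inj tot g1 g2 eX eM.
  exact: (fiber_eq vI eI sI IL fF' DF DF1).
- exact: segment_splits_uniq.
- move=> F DF; have [g1 t1 a1] := fib F DF.
  have [an tot tr] := sle_order a1.
  have := gap_card tot g1; have := gap_card_le1 tot g1.
  rewrite /phi mem_cat !gap_splitsP => -> H; rewrite !andbT.
  have {H}H : (#|thru v E F| + #|thru v S F| + #|ends v F|)%N = #|through v F|.
    by rewrite -H addnAC.
  by rewrite H; case: t1 => ->; rewrite ?cardsU1 ?bA ?add1n eqxx ?orbT.
move=> c cs.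
suff [G [X [M [Y [g eX eM eY GA]]]]] : exists G X M Y,
  [/\ gap G sle X M Y, #|X| = c.1.1, #|M| = c.2, #|Y| = c.1.2 & G = A \/ G = b0 |: A].
  have Gpre a : a \in G -> arr a /\ pre I v false a.
    by case: GA => -> aG; apply: Apre; rewrite // in_setU1 aG orbT.
  have [gU gO] := g.
  have GX : {in X, forall a, arr a /\ pre I v false a}.
    by move=> a aX; apply: Gpre; rewrite -gU !in_setU aX.
  have GM : {in M, forall a, arr a /\ pre I v false a}.
    by move=> a aM; apply: Gpre; rewrite -gU !in_setU aM orbT.
  have GY : {in Y, forall a, arr a /\ pre I v false a}.
    by move=> a aY; apply: Gpre; rewrite -gU !in_setU aY orbT.
  exists (assemble v (F' :\: A) X M Y).
    apply: (make_in_fiber vI eI sI IL) => //.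
    rewrite gU; apply/setP => a; rewrite in_set.
    case: GA => ->; first by case: (boolP (a \in A)) => // /Agood.
    rewrite in_setU1; case: (eqVneq a b0) => [->|_].
      by rewrite (negbTE nb) (negbTE bA).
    by case: (boolP (a \in A)) => // /Agood.
  have [_ sX sM sY] := @make_sets L I v vI eI sI IL F' false fF' X M Y GX GM GY.
  by rewrite /phi sX sM sY eX eM eY; case: (c) => [[]].
case: c cs => [[a b] m]; rewrite mem_cat !gap_splitsP => cs /=.
have [G GA [eG m1]] : exists2 G : {set walk}, G = A \/ G = b0 |: A & (a + b + m)%N = #|G| /\ (m <= 1)%N.
  case/orP: cs => /andP[/eqP-> ->]; first by exists A; [left|].
  by exists (b0 |: A); [right|rewrite cardsU1 bA].
have Garr : {in G, forall a, arr a}.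
  by move=> x xG; case: (Apre x) => //; case: GA xG => ->; rewrite // in_setU1 => ->; rewrite orbT.
have [an tot tr] := sle_order Garr.
exists G; case: m m1 eG {cs} => [|[|m]] // _ eG.
  have le1 : (a <= #|G|)%N by rewrite -eG addn0 leq_addr.
  have [X [Y [g cX cY]]] := gap_ex0 an tot tr le1.
  by exists X, set0, Y; rewrite cards0 cY -eG addn0 addKn.
have le1 : (a < #|G|)%N by rewrite -eG addn1 ltnS leq_addr.
have [X [M [Y [g cX cM cY]]]] := gap_ex1 an tot tr le1.
by exists X, M, Y; rewrite cY -eG addn1 subSS addKn.
Qed.

End SegmentFiber.

(** * The two recursions as divided differences *)

Lemma geometric_split (R : comNzRingType) (a b : R) n :
  (a - b) * \sum_(i <- iota 0 n.+1) a ^+ i * b ^+ (n - i) = a ^+ n.+1 - b ^+ n.+1.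
Proof.
rewrite -[RHS]opprB subrXX -mulNr opprB; congr (_ * _).
rewrite -[iota 0 n.+1]/(index_iota 0 n.+1) big_mkord.
by apply: eq_bigr => i _; rewrite mulrC ?subSS.
Qed.

(** The list yields h_n + h_(n+1), complete homogeneous polynomials in [a] and [b]. *)
Lemma sum_path_splits (R : comNzRingType) (a b : R) n :
  (a - b) * \sum_(c <- path_splits n) a ^+ c.1 * b ^+ c.2 =
  a * (1 + a) * a ^+ n - b * (1 + b) * b ^+ n.
Proof.
rewrite /path_splits big_cat !big_map mulrDr !geometric_split.
by rewrite !exprS; ring.
Qed.

(** The list yields h_n + t h_(n-1), the second term for a walk stopped at [v]; adding the same for
    n + 1 produces the factor 1 + a of the segment recursion. *)
Lemma sum_gap_splits (R : comNzRingType) (a b t : R) n :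
  (a - b) * \sum_(c <- gap_splits n) a ^+ c.1.1 * b ^+ c.1.2 * t ^+ c.2 =
  (a + t) * a ^+ n - (b + t) * b ^+ n.
Proof.
rewrite /gap_splits big_cat !big_map /= mulrDr.
under eq_bigr do rewrite expr0 mulr1.
under [X in _ + _ * X]eq_bigr do rewrite expr1.
rewrite geometric_split -mulr_suml mulrA.
(* For n = 0 no walk can be stopped; otherwise the exponents are shifted by one to get h_(n-1). *)
case: n => [|n]; first by rewrite big_nil !expr0 !expr1; ring.
under [X in _ + _ * X * _]eq_bigr do rewrite subSS.
by rewrite geometric_split !exprS; ring.
Qed.

Lemma sum_segment_splits (R : comNzRingType) (a b t : R) n :
  (a - b) * \sum_(c <- segment_splits n) a ^+ c.1.1 * b ^+ c.1.2 * t ^+ c.2 =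
  (1 + a) * (a + t) * a ^+ n - (1 + b) * (b + t) * b ^+ n.
Proof.
rewrite /segment_splits big_cat mulrDr !sum_gap_splits !exprS.
by ring.
Qed.

(** Before [v] is added it is an exit of [I] with a weight of its own; the recursions give it the
    weights of its two neighbors in turn. *)
Definition upd (T : Type) (u : point -> T) v s : point -> T :=
  fun x => if x == v then s else u x.

Section Transfer.
Variables (L : grid_shape) (I : {fset point}) (v : point).
Local Notation walk := (walk L).
Local Notation I' := (v |` I)%fset.
Hypotheses (vI : v \notin I) (eI : east v \notin I') (sI : south v \notin I').
Hypothesis IL : forall x, x \in I' ->
  [/\ x \in L, north x \in L, south x \in L, east x \in L & west x \in L].
Local Notation E := (east v).
Local Notation S := (south v).
Local Notation A := (arrivals v).
Variables (R : comNzRingType) (u : point -> R) (t : R).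
Local Notation wt' := (fun p : walk => wt I' u t (points p)).

Lemma Z_fibers k : Z L k I' u t =
  \sum_(F' : {set walk} | face k I F')
    \sum_(F : {set walk} | in_fiber I v F' k F) \prod_(p in F) wt' p.
Proof.
rewrite /Z (partition_big (cutset I v k) (face k I)) //= => F fF.
have gF : forall p : walk, p \in F -> good k I' p by case/faceP: (fF).
by have [] := (face_criterion vI eI sI IL gF).1 fF.
Qed.

(** As a polynomial in the weight [s] of the exit [v], the sum for [I] has one monomial per face,
    with the number of arrivals as exponent. *)
Lemma Z_upd k s : Z L k I (upd u v s) t =
  \sum_(F' : {set walk} | face k I F') (\prod_(p in F' :\: A F') wt' p) * s ^+ #|A F'|.
Proof.
apply: eq_bigr => F' fF'; rewrite (big_setID (A F')) /= mulrC; congr (_ * _).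
  apply: eq_bigr => p; rewrite -(avoidF' vI eI sI fF') in_set => /andP[pF vp].
  have lv : last o p != v.
    have := face_good fF' pF; case: (points p) vp => [|x q]; first by case: (k).
    by move=> vp _; apply: contraNneq vp => <- /=; rewrite mem_last.
  by rewrite /wt /upd !inE (negbTE lv).
rewrite (setIidPr _); last by apply/subsetP => a; rewrite in_set => /andP[].
rewrite -prodr_const; apply: eq_bigr => a; rewrite in_set => /andP[_ /arrives_last e].
by rewrite /wt e (negbTE vI) /upd eqxx.
Qed.

(** Each fiber sum depends on [F'] through its number n of arrivals only and is a difference of
    terms in [u E ^+ n] and [u S ^+ n]; by [Z_upd] these add up to two evaluations of the sum for
    [I]. *)
Lemma transfer_path : (u E - u S) * Z L true I' u t =
  u E * (1 + u E) * Z L true I (upd u v (u E)) t -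
  u S * (1 + u S) * Z L true I (upd u v (u S)) t.
Proof.
rewrite Z_fibers !Z_upd !mulr_sumr -sumrB; apply: eq_bigr => F' fF'.
under [X in _ * X = _]eq_bigr => F DF do rewrite (prod_fiber vI eI sI IL u t fF' DF).
rewrite -mulr_sumr.
under [X in _ * (_ * X) = _]eq_bigr => F DF.
  have -> : ends v F = set0.
    apply/setP => a; rewrite !inE; apply/negP => /andP[aF /arrives_last e].
    have [gF _ _ _] := fiber_in vI eI sI IL fF' DF.
    by have /andP[/Kp_last] := gF a aF; rewrite e !inE eqxx.
  rewrite cards0 expr0 mulr1; over.
rewrite (path_fiber vI eI sI IL fF' (fun c => u E ^+ c.1 * u S ^+ c.2)).
by rewrite mulrCA sum_path_splits mulrBr; congr (_ - _); apply: mulrCA.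
Qed.

Lemma transfer_segment : (u E - u S) * Z L false I' u t =
  (1 + u E) * (u E + t) * Z L false I (upd u v (u E)) t -
  (1 + u S) * (u S + t) * Z L false I (upd u v (u S)) t.
Proof.
rewrite Z_fibers !Z_upd !mulr_sumr -sumrB; apply: eq_bigr => F' fF'.
under [X in _ * X = _]eq_bigr => F DF do rewrite (prod_fiber vI eI sI IL u t fF' DF).
rewrite -mulr_sumr.
rewrite (segment_fiber vI eI sI IL fF' (fun c => u E ^+ c.1.1 * u S ^+ c.1.2 * t ^+ c.2)).
by rewrite mulrCA sum_segment_splits mulrBr; congr (_ - _); apply: mulrCA.
Qed.

End Transfer.


(** * Comparison of the two recursions *)

Lemma Z_ext L (R : comNzRingType) k I (u w : point -> R) t :
  u =1 w -> Z L k I u t = Z L k I w t.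
Proof.
move=> e; apply: eq_bigr => F _; apply: eq_bigr => p _.
by rewrite /wt e.
Qed.

(** Lets an identity proved with a polynomial weight be evaluated at an actual weight. *)
Lemma Z_morph L (R S : comNzRingType) (f : {rmorphism R -> S}) k I u t :
  f (Z L k I u t) = Z L k I (f \o u) (f t).
Proof.
rewrite rmorph_sum; apply: eq_bigr => F _; rewrite rmorph_prod.
by apply: eq_bigr => p _; rewrite /wt /=; case: ifP.
Qed.

Lemma Z_fset0 L (R : comNzRingType) k u (t : R) : Z L k fset0 u t = 1.
Proof.
have g0 p : good k fset0 p = false.
  case: k => /=; last by case: p => [|x p] //=; rewrite andbF.
  case: p => [|x [|y [|z p]]] //=; last by rewrite !andbF.
  rewrite /straight /horizontal /vertical /= !andbT.
  by case: (boolP (se_step x y)) => [/orP[]->|/negbTE]; rewrite ?orbT ?andbF //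
    /se_sequence /= => ->.
rewrite /Z (bigD1 (set0 : {set walk L})) /=; last first.
  by apply/faceP; split=> p; rewrite inE.
rewrite big_set0 big1 ?addr0 // => F /andP[/faceP[gF _] /set0Pn[p pF]].
by have := gF p pF; rewrite g0.
Qed.

Lemma max_height (I : {fset point}) : I != fset0 ->
  exists2 v, v \in I & forall w, w \in I -> (height w <= height v)%R.
Proof.
case/fset0Pn=> x xI.
have : forall s : seq point, s != [::] -> exists2 v, v \in s & forall w, w \in s -> (height w <= height v)%R.
  elim=> // y s IH _; case: (eqVneq s [::]) => [->|/IH[v vs vm]].
    by exists y; rewrite ?inE // => w; rewrite inE => /eqP->.
  case: (Num.Theory.lerP (height y) (height v)) => yv.
    exists v; rewrite ?inE ?vs ?orbT // => w; rewrite inE => /orP[/eqP->|/vm] //.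
  exists y; rewrite ?inE ?eqxx // => w; rewrite inE => /orP[/eqP->|/vm wv] //.
  exact: Order.POrderTheory.le_trans wv (Order.POrderTheory.ltW yv).
move=> /(_ (enum_fset I))[|v vI vm]; first by apply: contraTneq xI => e; rewrite -[_ \in I]/(x \in enum_fset I) e.
by exists v.
Qed.

(** Passing to the substituted weights multiplies the difference [a - b] by [z]; the second [x]
    repairs this, the first belongs to the added vertex. *)
Lemma scale_difference (R : comNzRingType) (x z a b c d : R) : x * z = 1 ->
  (a - b) * (x * c * d) = x ^+ 2 * c * ((z * (a + 1) - z * (b + 1)) * d).
Proof.
move=> xz; transitivity ((x * z) * ((a - b) * (x * c * d))); first by rewrite xz mul1r.
by ring.
Qed.

Lemma scale_factor (R : comNzRingType) (x z a : R) : x * z = 1 ->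
  x ^+ 2 * (z * (a + 1) * (1 + z * (a + 1))) = (1 + a) * (a + (1 + x)).
Proof.
move=> xz; transitivity ((x * z) * (a + 1) * (x + (x * z) * (a + 1))); first by ring.
by rewrite xz; ring.
Qed.

Lemma scale_transfer (R : comNzRingType) (x c a1 a2 t1 t2 : R) :
  x ^+ 2 * c * (a1 * t1 - a2 * t2) =
  (x ^+ 2 * a1) * (c * t1) - (x ^+ 2 * a2) * (c * t2).
Proof. by ring. Qed.

Section Shift.
Variable L : grid_shape.

(* The recursions determine (u (east v) - u (south v)) Z only; the cancellation
   is made over {poly R}, with u (east v) replaced by 'X. *)
Lemma Z_shift (I : {fset point}) : (forall x, x \in I ->
    [/\ x \in L, north x \in L, south x \in L, east x \in L & west x \in L]) ->
  forall (R : idomainType) (x z : R) (u : point -> R), x * z = 1 ->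
  x ^+ #|` I| * Z L true I (fun p => z * (u p + 1)) (1 + x) = Z L false I u (1 + x).
Proof.
(* The ring stays quantified inside the induction, because each step applies the hypothesis over a
   polynomial ring. *)
move: {2}#|` I| (leqnn #|` I|) => n; elim: n I => [|n IH] I.
  rewrite leqn0 cardfs_eq0 => /eqP-> _ R x z u _.
  by rewrite !Z_fset0 cardfs0 mul1r.
case: (eqVneq I fset0) => [->|I0].
  by move=> _ _ R x z u _; rewrite !Z_fset0 cardfs0 mul1r.
have [v vI vm] := max_height I0.
move: vI vm; set J := (I `\ v)%fset => vI vm.
have eI : I = (v |` J)%fset by rewrite fsetD1K.
have vJ : v \notin J by rewrite !inE eqxx.
have far w : se_step v w -> w \notin I.
  by move=> /height_step hw; apply/negP => /vm; rewrite hw Num.Theory.gerDl.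
have eJ := far _ (east_step v); have sJ := far _ (south_step v).
rewrite eI in eJ sJ *; rewrite cardfsU1 vJ add1n ltnS => cJ IL R x z u xz.
have JL : forall x, x \in J ->
    [/\ x \in L, north x \in L, south x \in L, east x \in L & west x \in L].
  by move=> y yJ; apply: IL; rewrite inE yJ orbT.
pose w p : {poly R} := if p == east v then 'X else (u p)%:P.
suff : x%:P ^+ #|` J|.+1 * Z L true (v |` J)%fset (fun p => z%:P * (w p + 1)) (1 + x%:P) =
    Z L false (v |` J)%fset w (1 + x%:P).
  move/(congr1 (horner_eval (u (east v)))).
  rewrite rmorphM rmorphXn !Z_morph /= !rmorphD /= rmorph1 /horner_eval !hornerC.
  have ew p : (w p).[u (east v)] = u p.
    by rewrite /w; case: eqP => [->|_]; rewrite ?hornerX ?hornerC.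
  rewrite (_ : Z _ _ _ (horner_eval _ \o _) _ = Z L true (v |` J)%fset (fun p => z * (u p + 1)) (1 + x)).
    by move=> ->; apply: Z_ext.
  apply: Z_ext => p /=; rewrite /horner_eval hornerM hornerD !hornerC ew.
  by [].
have xz' : x%:P * z%:P = 1 by rewrite -polyCM xz.
move: (x%:P) (z%:P) xz' => X Zp XZ.
have nz : w (east v) - w (south v) != 0.
  by rewrite /w eqxx south_neq_east polyXsubC_eq0.
apply: (mulfI nz).
rewrite (transfer_segment vJ eJ sJ IL).
rewrite exprS (scale_difference _ _ _ _ XZ) (transfer_path vJ eJ sJ IL (fun p => Zp * (w p + 1))).
have IHu s : X ^+ #|`J| * Z L true J (upd (fun p => Zp * (w p + 1)) v (Zp * (s + 1))) (1 + X) =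
    Z L false J (upd w v s) (1 + X).
  rewrite -(IH J cJ JL _ X Zp) //; congr (_ * _); apply: Z_ext => p.
  by rewrite /upd; case: ifP.
rewrite -!IHu scale_transfer !(scale_factor _ XZ).
by [].
Qed.

End Shift.

(** * Paths that do not kiss a given initial path *)

Arguments Kp : simpl never.

Section Link.
Variables (L : grid_shape) (I : {fset point}) (v : point).
Local Notation walk := (walk L).
Local Notation I' := (v |` I)%fset.
Hypothesis vI : v \notin I.
Hypothesis IL : forall x, x \in I' ->
  [/\ x \in L, north x \in L, south x \in L, east x \in L & west x \in L].
Implicit Types (a b p q r s u x y : seq point).

Variables (r s : seq point).
Hypotheses (rK : Kp I (rcons r v)) (rh : horizontal (rcons r v)).
Hypotheses (sK : Kp I (v :: s)) (sv : vertical (v :: s)).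

Definition corner := r ++ v :: s.
(* [corner] is the initial path turning at v, and [extend] identifies the paths
   of I with the other paths of v |` I that do not kiss it: these follow the
   whole West ray before v or the whole South ray after v. *)
Definition extend p :=
  if head o p == v then r ++ p else if last o p == v then p ++ s else p.

Lemma horizontal_in_out x u y w : horizontal x -> x = y ++ u ++ w ->
  u != [::] -> (y != [::] -> adj_in north y u = false) /\
   (w != [::] -> adj_out south u w = false).
Proof.
case: u => // z u hx ex _; split.
  case: y ex => // z' y ex _; rewrite /adj_in /=; apply/negP => /eqP e.
  have {}ex : x = (z' :: y) ++ z :: (u ++ w) := ex.
  move: hx; rewrite ex horizontal_cat /= => /and3P[_ /eqP ez _].
  by move/eqP: ez; rewrite e -{1}[z]northK south_neq_east.
case: w ex => // z' w ex _; rewrite /adj_out /=; apply/negP => /eqP e.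
move: hx; rewrite ex catA horizontal_cat last_cat /= => /and3P[_ /implyP H _].
have : z' == east (last z u) by apply: H; case: (y).
by rewrite e south_neq_east.
Qed.

Lemma vertical_in_out x u y w : vertical x -> x = y ++ u ++ w ->
  u != [::] -> (y != [::] -> adj_in west y u = false) /\
   (w != [::] -> adj_out east u w = false).
Proof.
case: u => // z u hx ex _; split.
  case: y ex => // z' y ex _; rewrite /adj_in /=; apply/negP => /eqP e.
  have {}ex : x = (z' :: y) ++ z :: (u ++ w) := ex.
  move: hx; rewrite ex vertical_cat /= => /and3P[_ /eqP ez _].
  by move/eqP: ez; rewrite e -{1}[z]westK eq_sym south_neq_east.
case: w ex => // z' w ex _; rewrite /adj_out /=; apply/negP => /eqP e.
move: hx; rewrite ex catA vertical_cat last_cat /= => /and3P[_ /implyP H _].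
have : z' == south (last z u) by apply: H; case: (y).
by rewrite e eq_sym south_neq_east.
Qed.

Lemma rcons_in_split x u y w t : uniq (x ++ v :: t) -> v \in u ->
  x ++ v :: t = y ++ u ++ w ->
  exists u1 u2, [/\ u = u1 ++ v :: u2, rcons x v = y ++ rcons u1 v ++ [::] & v :: t = [::] ++ (v :: u2) ++ w].
Proof.
move=> Ux; case/splitPr=> u1 u2; rewrite -catA /= catA => e.
have [ex et] := @uniq_cat_inj x [:: v] t _ _ Ux isT e.
by exists u1, u2; rewrite ex et cats0 -cats1 -catA cats1.
Qed.

Lemma Kp_join x y : Kp I (rcons x v) -> Kp I (v :: y) -> Kp I' (x ++ v :: y).
Proof.
case: x => [|z x]; first by [].
case/lastP: y => [|y w] //; rewrite rcons_cons !KpE cat_cons.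
case/and4P=> sx zI _ xI /and4P[sy _ wI yI].
have sxy : se_sequence (z :: x ++ v :: rcons y w).
  rewrite -cat_cons se_cat; move: sx; rewrite -rcons_cons se_rcons => /andP[-> ->].
  exact: sy.
have Uxy := se_sequence_uniq sxy.
rewrite -rcons_cons -rcons_cat KpE rcons_cat rcons_cons sxy all_cat /= !inE eqxx /=.
have [zv wv] : z != v /\ w != v.
  split; apply: contraTneq Uxy => ->; first by rewrite /= mem_cat inE eqxx orbT.
  by rewrite /= cat_uniq /= mem_rcons inE eqxx !andbF.
rewrite (negbTE zv) (negbTE wv) zI wI /=.
have sub t : all (mem I) t -> all (mem I') t.
  by apply: sub_all => c /= cI; rewrite !inE cI orbT.
by rewrite !sub.
Qed.

Lemma corner_Kp : Kp I' corner.
Proof. exact: Kp_join. Qed.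

Lemma Kp_split_at q : Kp I' q -> v \in q ->
  exists x y, [/\ q = x ++ v :: y, Kp I (rcons x v) & Kp I (v :: y)].
Proof.
move=> Kq vq; have sq := Kp_se Kq; have [z [t [w eq]]] := Kp_split Kq.
move: Kq vq sq; rewrite eq KpE => /and4P[_ zI wI tI].
have zv : z != v by apply: contraNneq zI => ->; rewrite !inE eqxx.
have wv : w != v by apply: contraNneq wI => ->; rewrite !inE eqxx.
rewrite inE mem_rcons inE ![v == _]eq_sym (negbTE zv) (negbTE wv) /= => vt.
case/splitPr: vt tI {eq} => t1 t2; rewrite all_cat /= => /and3P[t1I _ t2I] sq.
have Uq := se_sequence_uniq sq.
have e : z :: rcons (t1 ++ v :: t2) w = (z :: t1) ++ v :: rcons t2 w.
  by rewrite rcons_cat rcons_cons.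
rewrite e in sq Uq *; exists (z :: t1), (rcons t2 w); split=> //.
  move: sq; rewrite se_cat rcons_cons KpE -rcons_cons se_rcons => /and3P[-> -> _] /=.
  rewrite -(in_ext I zv) zI vI -(@all_ext I v) //.
  by move: Uq; rewrite cat_uniq /= negb_or => /and3P[_ /andP[+ _] _]; rewrite inE negb_or => /andP[].
change (is_true (Kp I (v :: rcons t2 w))).
move: sq; rewrite se_cat KpE => /and3P[_ _ p2].
rewrite -[se_sequence _]/(path se_step v (rcons t2 w)) p2 vI -(in_ext I wv) wI -(@all_ext I v) //.
by move: Uq; rewrite cat_uniq => /and3P[_ _ /andP[+ _]]; rewrite mem_rcons inE negb_or => /andP[].
Qed.


(** Only the end points of a path of [I] are outside [I], so [p] avoids [v], starts there or ends
    there. *)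
Lemma extendP p : Kp I p ->
  [\/ v \notin p /\ extend p = p,
      exists2 t, p = v :: t /\ Kp I (v :: t) & extend p = r ++ v :: t
    | exists2 t, p = rcons t v /\ Kp I (rcons t v) & extend p = t ++ v :: s].
Proof.
move=> Kq; have [x [t [y ep]]] := Kp_split Kq; have := Kq; rewrite ep KpE.
case/and4P=> sq xI yI tI; have Uq := se_sequence_uniq sq.
rewrite /extend /= last_rcons; case: (eqVneq x v) => xv.
  by constructor 2; exists (rcons t y); rewrite -xv //; split; rewrite // -ep.
case: (eqVneq y v) => yv.
  constructor 3; exists (x :: t); first by rewrite -yv rcons_cons; split; rewrite // -ep.
  by rewrite yv /= cat_rcons.
constructor 1; split=> //; rewrite inE mem_rcons inE !negb_or ![v == _]eq_sym xv yv /=.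
by apply/negP => /(allP tI); rewrite /= (negbTE vI).
Qed.

Lemma conf1_sub (K K' : {fset point}) p q : {subset K <= K'} -> conf1 K p q -> conf1 K' p q.
Proof.
move=> KK [u [p1 [p2 [q1 [q2 [/andP[u0 uK] ep eq i1 i2]]]]]].
exists u, p1, p2, q1, q2; rewrite u0; split=> //.
by apply: sub_all uK => x /KK.
Qed.

Lemma sub_ext : {subset I <= I'}.
Proof. by move=> x xI; rewrite inE xI orbT. Qed.

Lemma extend_pad p : Kp I p -> exists y w, extend p = y ++ p ++ w.
Proof.
move=> /extendP[[_ ->]|[t [-> _] ->]|[t [-> _] ->]].
- by exists [::], [::]; rewrite cats0.
- by exists r, [::]; rewrite cats0.
by exists [::], s; rewrite cat_rcons.
Qed.

(** Between paths of [I] the conflicting piece has a neighbor on both sides already, so lengthening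
    the ends changes nothing. *)
Lemma extend_conf p q : Kp I p -> Kp I q -> conf1 I p q -> conf1 I' (extend p) (extend q).
Proof.
move=> Kq Kq' [u [p1 [p2 [q1 [q2 [/andP[u0 uI] ep eq i1 i2]]]]]].
have uI0 : (u != [::]) && all (mem I) u by rewrite u0.
have [y [w e1]] := extend_pad Kq; have [y' [w' e2]] := extend_pad Kq'.
have [p10 p20] := Kp_inner Kq ep uI0; have [q10 q20] := Kp_inner Kq' eq uI0.
exists u, (y ++ p1), (p2 ++ w), (y' ++ q1), (q2 ++ w').
have nz (a b : seq point) : b != [::] -> (a ++ b == [::]) = false.
  by case: a => //=; case: b.
split.
- by rewrite u0; apply: sub_all uI; apply: sub_ext.
- by rewrite e1 ep -!catA.
- by rewrite e2 eq -!catA.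
- move: i1; rewrite /adj_in !nz // (negbTE p10) (negbTE q10) !last_cat.
  by case: (p1) p10; case: (q1) q10.
move: i2; rewrite /adj_out.
by case: (p2) p20; case: (q2) q20.
Qed.

(** Extended paths come into [v] along the West ray or leave it along the South ray. Either makes it
    impossible to enter from the North and leave to the East a piece that contains [v]. *)
Lemma extend_cross p u y w : Kp I p -> u != [::] -> v \in u -> extend p = y ++ u ++ w ->
  y != [::] -> w != [::] -> adj_in north y u -> adj_out east u w -> False.
Proof.
move=> Kq u0 vu e y0 w0 iy iw.
have: v \in extend p by rewrite e !mem_cat vu orbT.
have Kx t : Kp I (v :: t) -> uniq (r ++ v :: t).
  by move=> Kt; have := Kp_join rK Kt => /Kp_se/se_sequence_uniq.
have Ky t : Kp I (rcons t v) -> uniq (t ++ v :: s).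
  by move=> Kt; have := Kp_join Kt sK => /Kp_se/se_sequence_uniq.
case: (extendP Kq) => [[vp ->]|[t [ep Kt] e']|[t [ep Kt] e']]; first by rewrite (negbTE vp).
- rewrite e' in e => _; have [u1 [u2 [eu e1 e2]]] := rcons_in_split (Kx t Kt) vu e.
  have u1v : rcons u1 v != [::] by case: (u1).
  have [/(_ y0) + _] := horizontal_in_out rh e1 u1v.
  by move: iy; rewrite eu /adj_in (negbTE y0); case: (u1) => [|? ?] /= ->.
rewrite e' in e => _; have [u1 [u2 [eu e1 e2]]] := rcons_in_split (Ky t Kt) vu e.
have [_ /(_ w0)] := vertical_in_out sv e2 isT.
by move: iw; rewrite eu /adj_out last_cat /= => ->.
Qed.

(** A piece inside an added ray is entered and left in the direction of that ray, against the given
    pairs of directions. So it lies in [p] itself, at worst with [v] as its neighbor. *)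
Lemma restrict_in d p u y w : Kp I p -> u != [::] -> v \notin u -> extend p = y ++ u ++ w ->
  y != [::] -> w != [::] ->
  (d = west /\ adj_out south u w) \/ (d = north /\ adj_out east u w) -> adj_in d y u ->
  exists y' w', [/\ p = y' ++ u ++ w', adj_in d y' u,
    adj_out south u w -> adj_out south u w' & adj_out east u w -> adj_out east u w'].
Proof.
move=> Kq u0 vu e y0 w0 od iy.
case: (extendP Kq) => [[vp e']|[t [ep Kt] e']|[t [ep Kt] e']].
- by exists y, w; rewrite -e e'.
- rewrite e' in e; have Ux : uniq (r ++ v :: t).
    by have := Kp_join rK Kt => /Kp_se/se_sequence_uniq.
  have: v \in r ++ v :: t by rewrite mem_cat inE eqxx orbT.
  rewrite e !mem_cat (negbTE vu) /= => /orP[] vi; case/splitPr: vi e iy y0 w0 od => c1 c2 e iy y0 w0 od.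
    have e1 : r ++ v :: t = c1 ++ [:: v] ++ (c2 ++ u ++ w) by rewrite e -catA.
    have [_ et] := @uniq_cat_inj r [:: v] t _ _ Ux isT e1.
    exists (v :: c2), w; rewrite ep et; split=> //.
    by move: iy; rewrite /adj_in last_cat; case: (c1).
  have e1 : r ++ v :: t = (y ++ u ++ c1) ++ [:: v] ++ c2 by rewrite e -!catA.
  have [er _] := @uniq_cat_inj r [:: v] t _ _ Ux isT e1.
  have e2 : rcons r v = y ++ u ++ rcons c1 v by rewrite er -!rcons_cat.
  have [/(_ y0) h1 h2] := horizontal_in_out rh e2 u0.
  case: od => -[ed od]; last by move: iy; rewrite ed h1.
  have : rcons c1 v != [::] by case: (c1).
  by move=> /h2; move: od; rewrite /adj_out; case: (c1) => [|? ?] /= ->.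
rewrite e' in e; have Ux : uniq (t ++ v :: s).
  by have := Kp_join Kt sK => /Kp_se/se_sequence_uniq.
have: v \in t ++ v :: s by rewrite mem_cat inE eqxx orbT.
rewrite e !mem_cat (negbTE vu) /= => /orP[] vi; case/splitPr: vi e iy y0 w0 od => c1 c2 e iy y0 w0 od.
  have e1 : t ++ v :: s = c1 ++ [:: v] ++ (c2 ++ u ++ w) by rewrite e -catA.
  have [_ es] := @uniq_cat_inj t [:: v] s _ _ Ux isT e1.
  have e2 : v :: s = (v :: c2) ++ u ++ w by rewrite es.
  have [h1 h2] := vertical_in_out sv e2 u0.
  case: od => -[ed od]; last by rewrite h2 in od.
  have := h1 isT; move: iy; rewrite ed /adj_in last_cat /=.
  by case: (c1) => [|? ?] /= ->.
have e1 : t ++ v :: s = (y ++ u ++ c1) ++ [:: v] ++ c2 by rewrite e -!catA.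
have [er _] := @uniq_cat_inj t [:: v] s _ _ Ux isT e1.
exists y, (rcons c1 v); rewrite ep er !rcons_cat; split=> //;
  by rewrite /adj_out; case: (c1).
Qed.

Lemma extend_Kp p : Kp I p -> Kp I' (extend p).
Proof.
move=> Kq; case: (extendP Kq) => [[vp ->]|[t [ep Kt] ->]|[t [ep Kt] ->]].
- by rewrite Kp_ext.
- exact: Kp_join.
exact: Kp_join.
Qed.

Lemma conf_restrict p q : Kp I p -> Kp I q -> conf1 I' (extend p) (extend q) -> conf1 I p q.
Proof.
move=> Kq Kq' [u [p1 [p2 [q1 [q2 [uI' ep eq /andP[i1 j1] /andP[i2 j2]]]]]]].
have [p10 p20] := Kp_inner (extend_Kp Kq) ep uI'.
have [q10 q20] := Kp_inner (extend_Kp Kq') eq uI'.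
case/andP: uI' => u0 uI.
have vu : v \notin u by apply/negP => vu; apply: (extend_cross Kq' u0 vu eq q10 q20 j1 j2).
have [y [w [-> iy ow _]]] := restrict_in Kq u0 vu ep p10 p20 (or_introl (conj erefl i2)) i1.
have [y' [w' [-> iy' _ ow']]] := restrict_in Kq' u0 vu eq q10 q20 (or_intror (conj erefl j2)) j1.
exists u, y, w, y', w'; rewrite u0 -(@all_ext I v) // uI iy iy' ow // ow' //.
Qed.

Lemma extend_ray : extend (v :: s) = corner.
Proof. by rewrite /extend /= eqxx. Qed.

(** The initial path at [v] is itself an extension, that of the vertical ray from [v], and a
    straight path conflicts with nothing. *)
Lemma corner_conf p : Kp I p -> ~ conf1 I' corner (extend p) /\ ~ conf1 I' (extend p) corner.
Proof.
move=> Kq; rewrite -extend_ray.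
have st : straight (v :: s) by rewrite /straight sv orbT.
have [n1 n2] := conf1_straight p sK st.
by split; [move/(conf_restrict sK Kq)|move/(conf_restrict Kq sK)].
Qed.

Lemma straight_infix p y w : straight (y ++ p ++ w) -> straight p.
Proof.
have ip : infix p (y ++ p ++ w) by apply: infix_infix.
by case/orP=> h; apply/orP; [left|right]; apply: infix_sorted h.
Qed.

Lemma extend_good p : good true I p -> good true I' (extend p).
Proof.
case/andP=> Kq ns /=; rewrite extend_Kp //=.
by have [y [w ->]] := extend_pad Kq; apply: contra ns => /straight_infix.
Qed.

Lemma uniq_ray t : Kp I (v :: t) -> uniq (r ++ v :: t).
Proof. by move=> Kt; have := Kp_join rK Kt => /Kp_se/se_sequence_uniq. Qed.

Lemma extend_corner p : good true I p -> extend p != corner.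
Proof.
case/andP=> Kq; apply: contra => /eqP e.
case: (extendP Kq) => [[vp e']|[t [ep Kt] e']|[t [ep Kt] e']].
- by move: vp; rewrite -e' e mem_cat inE eqxx orbT.
- have [_ et] : r = r /\ t = s.
    by apply: (@uniq_cat_inj _ [:: v]); rewrite ?uniq_ray //= -e' e.
  by rewrite ep et /straight sv orbT.
have [et _] : r = t /\ s = s.
  by apply: (@uniq_cat_inj _ [:: v]); rewrite ?uniq_ray //= -e' e.
by rewrite ep -et /straight rh.
Qed.

(** Straight paths have to be excluded: the horizontal ray into [v] and the vertical ray out of [v]
    both extend to the corner. *)
Lemma extend_inj p q : good true I p -> good true I q -> extend p = extend q -> p = q.
Proof.
move=> /andP[Kq np] /andP[Kq' nq] e.
case: (extendP Kq) => [[vp e1]|[t [ep Kt] e1]|[t [ep Kt] e1]];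
case: (extendP Kq') => [[vq e2]|[t' [eq Kt'] e2]|[t' [eq Kt'] e2]].
- by rewrite -e1 e.
- by move: vp; rewrite -e1 e e2 mem_cat inE eqxx orbT.
- by move: vp; rewrite -e1 e e2 mem_cat inE eqxx orbT.
- by move: vq; rewrite -e2 -e e1 mem_cat inE eqxx orbT.
- have [_ et] : r = r /\ t = t'.
    by apply: (@uniq_cat_inj _ [:: v]); rewrite ?uniq_ray //= -e1 e.
  by rewrite ep eq et.
- have [_ et] : r = t' /\ t = s.
    by apply: (@uniq_cat_inj _ [:: v]); rewrite ?uniq_ray //= -e1 e.
  by move: np; rewrite ep et /straight sv orbT.
- by move: vq; rewrite -e2 -e e1 mem_cat inE eqxx orbT.
- have [_ et] : r = t /\ t' = s.
    by apply: (@uniq_cat_inj _ [:: v]); rewrite ?uniq_ray //= -e2 -e.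
  by move: nq; rewrite eq et /straight sv orbT.
have U : uniq (t ++ v :: s) by have := Kp_join Kt sK => /Kp_se/se_sequence_uniq.
have [et _] : t = t' /\ s = s.
  by apply: (@uniq_cat_inj _ [:: v]) => //=; rewrite -e1 e.
by rewrite ep eq et.
Qed.

(** Both sequences stay in [I] between their start and their end outside, so neither is a proper
    initial piece of the other. At their first difference the vertical one goes South and the other
    one East. *)
Lemma vertical_diverge (w : point) y t : path (fun a b : point => b == south a) w y -> path se_step w t ->
  (y != [::]) && (t != [::]) ->
  last w y \notin I -> last w t \notin I ->
  all (mem I) (behead (belast w y)) -> all (mem I) (behead (belast w t)) -> y <> t ->
  exists u y' t', [/\ all (mem I) u, y = u ++ y', t = u ++ t',
    (y' != [::]) && (head o y' == south (last w u)) &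
    (t' != [::]) && (head o t' == east (last w u))].
Proof.
elim: y w t => // a y IH w [|b t] //= /andP[/eqP ea py] /andP[wb pt] _ ly lt yI tI yt.
case/orP: wb => /eqP eb; last first.
  by exists [::], (a :: y), (b :: t); rewrite /= ea eb !eqxx.
have eab : a = b by rewrite ea.
rewrite -eab in eb pt lt tI yt *.
have [y0 t0] : y != [::] /\ t != [::].
  case: (y) (t) ly lt yI tI yt => [|a1 y1] [|b1 t1] //= ly lt yI tI yt.
    by move: tI; rewrite (negbTE ly).
  by move: yI; rewrite (negbTE lt).
have [aI yI'] : a \in I /\ all (mem I) (behead (belast a y)).
  by case: (y) y0 yI => //= a1 y1 _ /andP[].
have tI' : all (mem I) (behead (belast a t)).
  by case: (t) t0 tI => //= a1 y1 _ /andP[].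
have [||u [y' [t' [uI ey et hy ht]]]] := IH a t py pt _ ly lt yI' tI'.
- by rewrite y0 t0.
- by move=> e; apply: yt; rewrite e.
by exists (a :: u), y', t'; rewrite /= aI uI ey et.
Qed.

Lemma ray_diverge t : Kp I (v :: t) -> s <> t ->
  exists u y' t', [/\ all (mem I) u, s = u ++ y', t = u ++ t',
    (y' != [::]) && (head o y' == south (last v u)) &
    (t' != [::]) && (head o t' == east (last v u))].
Proof.
have K y : Kp I (v :: y) -> [/\ path se_step v y, y != [::], last v y \notin I & all (mem I) (behead (belast v y))].
  by case: y => // a y /and4P[].
move=> /K[pt t0 lt tI]; have [_ y0 ly yI] := K _ sK => st.
by apply: vertical_diverge; rewrite ?y0 ?t0.
Qed.

Lemma left_ray x : Kp I (rcons x v) -> horizontal (rcons x v) -> x = r.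
Proof.
move=> xK xh.
have vx : arrives v (rcons x v) by apply: arrives_rcons_se (Kp_se xK).
have vr : arrives v (rcons r v) by apply: arrives_rcons_se (Kp_se rK).
have := ale_anti vx vr (horizontal_min vx vr xK rK xh) (horizontal_min vr vx rK xK rh).
by move/rcons_inj => [].
Qed.

Lemma down_ray t : Kp I (v :: t) -> vertical (v :: t) -> t = s.
Proof.
move=> tK tv; case: (eqVneq s t) => // /eqP st.
have [u [y' [t' [_ _ et _ /andP[t0 /eqP ht]]]]] := ray_diverge tK st.
move: tv; rewrite et; case: t' t0 ht {et} => // a t' _ /= ->.
by rewrite -cat_cons vertical_cat /= eq_sym south_neq_east !andbF.
Qed.

(** A path through [v] that leaves the corner on both sides has entered their common piece from the
    North and leaves it to the East, whereas the corner goes from West to South: they kiss. So [q]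
    shares a whole ray with the corner, and cutting that ray off gives [p]. *)
Lemma extend_onto q : good true I' q -> ~ conf1 I' corner q -> q != corner ->
  exists2 p, good true I p & q = extend p.
Proof.
case/andP=> Kq nq nc qc; case: (boolP (v \in q)) => vq; last first.
  have Kq' : Kp I q by rewrite -(@Kp_ext I v).
  exists q; first by rewrite /= Kq'.
  case: (extendP Kq') => [[_ ->]//|[t [e _] _]|[t [e _] _]]; move: vq; rewrite e.
    by rewrite inE eqxx.
  by rewrite mem_rcons inE eqxx.
have [x [y [eq Kx Ky]]] := Kp_split_at Kq vq.
case: (eqVneq r x) => [rx|/eqP rx].
  exists (v :: y); last by rewrite /extend /= eqxx eq rx.
  rewrite /= Ky; apply/negP => /orP[h|h].
    case/negP: nq; apply/orP; left.
    rewrite eq horizontal_cat h andbT -rx.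
    by move: rh; rewrite horizontal_rcons.
  by move: qc; rewrite eq -rx (down_ray Ky h) eqxx.
case: (eqVneq s y) => [sy|/eqP sy].
  exists (rcons x v).
    rewrite /= Kx; apply/negP => /orP[h|h].
      by move: qc; rewrite eq -sy (left_ray Kx h) eqxx.
    case/negP: nq; apply/orP; right.
    rewrite eq vertical_cat -sy sv andbT.
    by move: h; rewrite vertical_rcons.
  rewrite eq /extend last_rcons eqxx cat_rcons sy.
  case: x Kx eq {rx} => [|z x] //= Kx eq; case: eqVneq => // ez.
  by have := se_sequence_uniq (Kp_se Kx); rewrite ez /= mem_rcons inE eqxx.
have vr : arrives v (rcons r v) by apply: arrives_rcons_se (Kp_se rK).
have vx : arrives v (rcons x v) by apply: arrives_rcons_se (Kp_se Kx).
have ne : rcons r v <> rcons x v by move=> /rcons_inj[].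
have [_ /(_ (conj ne (horizontal_min vr vx rK Kx rh)))] := lowP_K vr vx rK Kx.
case=> u1 [p1 [q1 [/andP[u10 u1I] ep eq1 i1]]].
have [u2 [s' [y' [u2I es ey /andP[s'0 hs] /andP[y'0 hy]]]]] := ray_diverge Ky sy.
(* The kissing segment glues the common piece up to [v] with the common piece after [v]. *)
case: nc; exists (u1 ++ u2), p1, s', q1, y'.
have lu : last o u1 = v.
  have : last o (rcons r v) = v by rewrite last_rcons.
  by rewrite ep last_cat; case: (u1) u10.
have lu2 : last o (u1 ++ u2) = last v u2 by rewrite last_cat lu.
split.
- rewrite all_cat u1I; apply/andP; split; first by case: (u1) u10.
  by apply: sub_all u2I; apply: sub_ext.
- by rewrite /corner -cat_rcons ep es -!catA.
- by rewrite eq -cat_rcons eq1 ey -!catA.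
- by move: i1; rewrite /adj_in; case: (u1) u10.
by rewrite /adj_out lu2 hs hy !orbT.
Qed.


(** The initial path turning at [w], described by its two straight halves, which both contain
    [w]. *)
Definition init (K : {fset point}) (w : point) p : bool :=
  [&& Kp K p, w \in p, horizontal (cut w p) & vertical (drop (index w p) p)].

Lemma initP K w p : reflect (exists x y, [/\ p = x ++ w :: y, Kp K p,
   horizontal (rcons x w) & vertical (w :: y)]) (init K w p).
Proof.
have ind x y : Kp K (x ++ w :: y) -> index w (x ++ w :: y) = size x.
  move=> /Kp_se/se_sequence_uniq U; rewrite index_cat /= eqxx addn0.
  case: ifP => // wx; move: U; rewrite cat_uniq => /and3P[_ /hasPn/(_ w)].
  by rewrite inE eqxx wx => /(_ isT).
apply: (iffP and4P) => [[Kq wp]|[x [y [-> Kq hx vy]]]].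
  case/splitPr: wp Kq => x y Kq; rewrite /cut ind //.
  rewrite drop_size_cat // -cat_rcons take_size_cat ?size_rcons // => h1 h2.
  by exists x, y; rewrite cat_rcons.
rewrite mem_cat inE eqxx orbT /cut ind // drop_size_cat // -cat_rcons.
by rewrite take_size_cat ?size_rcons // cat_rcons.
Qed.

Lemma init_cornerE p : init I' v p = (p == corner).
Proof.
apply/initP/eqP => [[x [y [-> Kq hx vy]]]|->]; last first.
  by exists r, s; rewrite corner_Kp.
have vq : v \in x ++ v :: y by rewrite mem_cat inE eqxx orbT.
have [x' [y' [e Kx Ky]]] := Kp_split_at Kq vq.
have U := se_sequence_uniq (Kp_se Kq).
have [ex ey] := @uniq_cat_inj x [:: v] y x' y' U isT e.
rewrite -ex in Kx; rewrite -ey in Ky.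
by rewrite /corner (left_ray Kx hx) (down_ray Ky vy).
Qed.

(** If [p] starts at [v], the West ray prolongs its horizontal half; if it ends at [v], the South
    ray prolongs its vertical half. *)
Lemma init_extend w p : w != v -> Kp I p -> init I w p -> init I' w (extend p).
Proof.
move=> wv Kq /initP[x [y [ep _ hx vy]]]; apply/initP.
have Ke := extend_Kp Kq.
case: (extendP Kq) => [[_ e]|[t [et Kt] e]|[t [et Kt] e]].
- by exists x, y; rewrite Ke e.
- rewrite Ke e -et ep; exists (r ++ x), y; rewrite catA; split=> //.
  rewrite rcons_cat; have : exists x', rcons x w = v :: x'.
    move: et; rewrite ep; case: (x) => [[ew]|z x' [-> _]]; last by exists (rcons x' w).
    by rewrite ew eqxx in wv.
  case=> x' ex; rewrite ex horizontal_cat -ex hx andbT.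
  by move: rh; rewrite horizontal_rcons.
rewrite Ke e -cat_rcons -et ep; exists x, (y ++ s); rewrite -catA /=; split=> //.
have [y' ey] : exists y', w :: y = rcons y' v.
  move: et; rewrite ep; case/lastP: (y) => [|y' z].
    by rewrite cats1 => /rcons_inj[_ ew]; rewrite ew eqxx in wv.
  rewrite -rcons_cons -rcons_cat => /rcons_inj[_ ->].
  by exists (w :: y').
rewrite -cat_cons ey cat_rcons vertical_cat sv andbT.
by move: vy; rewrite ey vertical_rcons.
Qed.

Definition initW (K : {fset point}) (w : point) : walk :=
  if [pick p : walk | init K w (points p)] is Some p then p else mkW L [::].

Hypotheses (rL : all (mem L) r) (sL : all (mem L) s).

Lemma extend_in (p : walk) : Kp I p -> points (mkW L (extend p)) = extend p.
Proof.
move=> Kq; apply: mkWK; first exact: Kp_se (extend_Kp Kq).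
have [vL _ _ _ _] := IL (vI' I v).
case: (extendP Kq) => [[_ ->]|[t [et Kt] ->]|[t [et Kt] ->]]; first exact: points_in.
  by rewrite all_cat rL -et points_in.
by rewrite -cat_rcons -et all_cat points_in.
Qed.

Lemma initW_corner : points (initW I' v) = corner.
Proof.
rewrite /initW; case: pickP => [p|/(_ (mkW L corner))]; first by rewrite init_cornerE => /eqP.
rewrite init_cornerE mkWK ?eqxx //; first exact: Kp_se corner_Kp.
have [vL _ _ _ _] := IL (vI' I v).
by rewrite /corner all_cat rL /= vL sL.
Qed.

End Link.

Lemma path_in (L I : {fset point}) w t : path se_step w t -> w \in I -> all (mem I) (behead (belast w t)) ->
  (forall x, x \in I ->
    [/\ x \in L, north x \in L, south x \in L, east x \in L & west x \in L]) ->
  all (mem L) t.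
Proof.
move=> + + + IL; elim: t w => //= a t IH w /andP[wa pt] wI tI.
have [_ _ sL eL _] := IL w wI.
have -> : a \in L by case/orP: wa => /eqP->.
case: t IH pt tI => // b t IH pt /= /andP[aI tI].
by apply: (IH a).
Qed.

Lemma rays_ex (L I : {fset point}) v : v \notin I ->
  (forall x, x \in (v |` I)%fset ->
    [/\ x \in L, north x \in L, south x \in L, east x \in L & west x \in L]) ->
  exists r s, [/\ Kp I (rcons r v), horizontal (rcons r v), Kp I (v :: s), vertical (v :: s)
    & all (mem L) r /\ all (mem L) s].
Proof.
move=> vI IL; have [vL nL _ _ wL] := IL v (vI' I v).
have JL x : x \in I ->
    [/\ x \in L, north x \in L, south x \in L, east x \in L & west x \in L].
  by move=> xI; apply: IL; rewrite inE xI orbT.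
have IW x : x \in I -> x \in L /\ west x \in L by case/JL.
have [h [hv hK hL hh]] := ray_ex west_step vI vL wL IW.
have [r er _] := arrives_rcons hv.
have [|s [e [sI eI ps]]] := @ray_to_boundary south I v.
  move=> s ps; apply: se_sequence_uniq; apply: vertical_se.
  exact: ps.
have pse : path se_step v (rcons s e).
  by apply: sub_path ps => x y /eqP->; apply: south_step.
exists r, (rcons s e); rewrite -er; split=> //.
- by apply: sub_sorted hh => x y /eqP->; rewrite westK.
- by rewrite KpE vI eI sI !andbT.
split; first by move: hL; rewrite er all_rcons => /andP[].
apply: (path_in pse (vI' I v)) IL; rewrite belast_rcons /=.
by apply: sub_all sI => x /= xI; rewrite inE xI orbT.
Qed.

Section LinkStep.
Variables (L : grid_shape).
Local Notation walk := (walk L).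
Local Notation insideL I := (forall x, x \in (I : {fset point}) ->
    [/\ x \in L, north x \in L, south x \in L, east x \in L & west x \in L]).
Local Notation initW := (initW L).

Lemma initW_spec (K : {fset point}) w : w \in K -> insideL K ->
  [/\ init K w (points (initW K w)), good true K (points (initW K w))
    & forall p : walk, init K w (points p) -> p = initW K w].
Proof.
move=> wK; rewrite -(fsetD1K wK); set J := (K `\ w)%fset => KL.
have wJ : w \notin J by rewrite !inE eqxx.
have [r [s [rK rh sK [sv [rL sL]]]]] := rays_ex wJ KL.
have ec := initW_corner wJ KL rK rh sK sv rL sL.
have ic p := init_cornerE wJ rK rh sK sv p.
split; first by rewrite ic ec.
  rewrite ec /= corner_Kp //=; apply/negP => /orP[].
    rewrite horizontal_cat => /and3P[_ _ h]; exact: (Kp_not_both sK h sv).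
  rewrite /corner -cat_rcons => h; apply: (Kp_not_both rK rh).
  by move: h; case: (s) => [|z s']; rewrite ?cats0 // vertical_cat => /andP[].
by move=> p; rewrite ic => /eqP e; apply: points_inj; rewrite e ec.
Qed.

(** Extending all members and adding the corner is a bijection from the faces on [I] to the faces on
    [I'] containing the corner. It raises the cardinal by one and sends the initial path at each [w]
    in [V] to the one of [I']. *)
Lemma link_step (R : comNzRingType) (c : R) (I : {fset point}) v (V : seq point) :
  v \notin I -> insideL (v |` I)%fset -> v \notin V -> {subset V <= I} ->
  \sum_(F : {set walk} | face true (v |` I)%fset F &&
       all (fun w => initW (v |` I)%fset w \in F) (v :: V)) c ^+ #|F| =
  c * \sum_(F : {set walk} | face true I F && all (fun w => initW I w \in F) V) c ^+ #|F|.
Proof.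
move=> vI IL vV VI; set I' := (v |` I)%fset.
have JL : insideL I by move=> x xI; apply: IL; rewrite inE xI orbT.
have [r [s [rK rh sK [sv [rL sL]]]]] := rays_ex vI IL.
pose pv := initW I' v.
have epv : points pv = corner v r s := initW_corner vI IL rK rh sK sv rL sL.
pose phi (p : walk) : walk := mkW L (extend v r s (points p)).
have ephi (p : walk) : good true I p -> points (phi p) = extend v r s p.
  by case/andP=> Kq _; exact: (extend_in vI IL rK sK rL sL Kq).
have phi_pv (p : walk) : good true I p -> phi p != pv.
  move=> gp; apply: contraNneq (extend_corner vI rK rh sK sv gp) => e.
  by rewrite -ephi // e epv.
have phi_inj (p q : walk) : good true I p -> good true I q -> phi p = phi q -> p = q.
  move=> gp gq /(congr1 (@points L)); rewrite !ephi // => e.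
  exact: points_inj (extend_inj vI rK sK sv gp gq e).
have phi_init w : w \in V -> phi (initW I w) = initW I' w.
  move=> wV; have wI := VI _ wV.
  have [iw gw _] := initW_spec wI JL.
  have [_ _ u'] := initW_spec (sub_ext v wI) IL.
  apply: u'; rewrite ephi //; apply: init_extend => //.
    by apply: contraNneq vV => <-.
  by case/andP: gw.
pose h (F' : {set walk}) : {set walk} := pv |: [set phi p | p in F'].
pose h' (F : {set walk}) : {set walk} := [set p : walk | good true I (points p) & phi p \in F].
have pvh F' : pv \in h F' by rewrite in_setU1 eqxx.
(* The corner is no extension of a nonstraight path, so [h'] recovers the face on [I] without
   removing the corner first. *)
rewrite (reindex_onto h h') /=; last first.
  move=> F /andP[/faceP[gF nF] /andP[pvF _]]; apply/setP => q; rewrite in_setU1.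
  apply/orP/idP => [[/eqP->//|/imsetP[p]]|qF].
    by rewrite inE => /andP[_ ? ->].
  case: (eqVneq q pv) => [|qpv]; [by left|right].
  have nc : ~ conf1 I' (corner v r s) (points q) by rewrite -epv; apply: nF; rewrite // eq_sym.
  have [|p gp eqp] := extend_onto vI rK rh sK sv (gF q qF) nc.
    by rewrite -epv; apply: contra qpv => /eqP/points_inj->.
  have pL : all (mem L) p.
    have [y [w e]] := extend_pad vI r s (proj1 (andP gp)).
    by move: (points_in q); rewrite eqp e !all_cat => /and3P[].
  have ep := mkWK (good_se gp) pL.
  have -> : q = phi (mkW L p) by apply: points_inj; rewrite ephi ep.
  apply: imset_f; rewrite inE ep gp /=.
  by rewrite (_ : phi _ = q) //; apply: points_inj; rewrite ephi ep.
rewrite big_distrr /=.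
have cardh (F' : {set walk}) : {in F', forall p : walk, good true I p} -> #|h F'| = #|F'|.+1.
  move=> gF; rewrite cardsU1 card_in_imset; last by move=> p q /gF gp /gF gq; apply: phi_inj.
  case: imsetP => [[p /gF gp e]|_]; last by rewrite add1n.
  by have := phi_pv p gp; rewrite -e eqxx.
have eqface (F' : {set walk}) : face true I' (h F') && ((pv \in h F') && all (fun w => initW I' w \in h F') V) && (h' (h F') == F')
   = face true I F' && all (fun w => initW I w \in F') V.
  have memh (p : walk) : good true I p -> {in F', forall q : walk, good true I q} -> (phi p \in h F') = (p \in F').
    move=> gp gF; rewrite in_setU1 (negbTE (phi_pv p gp)) /=.
    apply/imsetP/idP => [[q qF e]|pF]; last by exists p.
    by rewrite (phi_inj p q gp (gF q qF) e).
  rewrite pvh /=; apply/andP/andP => [[/andP[/faceP[gF nF] aV] /eqP hF]|[/faceP[gF nF] aV]].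
    have gF' : {in F', forall q : walk, good true I q}.
      by move=> q; rewrite -hF inE => /andP[].
    split.
      apply/faceP; split; first exact: gF'.
      move=> p q pF qF pq cpq; have [gp gq] := (gF' p pF, gF' q qF).
      apply: (nF (phi p) (phi q)); rewrite ?memh //.
        by apply: contra pq => /eqP/(phi_inj _ _ gp gq)->.
      rewrite !ephi //; apply: extend_conf => //.
        by case/andP: gp.
      by case/andP: gq.
    apply/allP => w wV; have := allP aV w wV; rewrite /= -phi_init // memh //.
    by have [] := initW_spec (VI _ wV) JL.
  split; last first.
    apply/eqP/setP => p; rewrite inE; apply/andP/idP => [[gp]|pF]; first by rewrite memh.
    by rewrite memh ?gF.
  apply/andP; split; last first.
    apply/allP => w wV; have := allP aV w wV; rewrite /= -phi_init // memh //.
    by have [] := initW_spec (VI _ wV) JL.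
  have [_ gpv _] := initW_spec (vI' I v) IL.
  apply/faceP; split.
    move=> p; rewrite in_setU1 => /orP[/eqP->//|/imsetP[q /gF gq ->]].
    by rewrite ephi //; apply: (extend_good vI rK sK); apply: gq.
  have nc (q : walk) : q \in F' -> ~ conf1 I' pv (phi q) /\ ~ conf1 I' (phi q) pv.
    by move=> /gF gq; rewrite epv ephi //; apply: corner_conf => //; case/andP: gq.
  move=> p q; rewrite !in_setU1.
  case/orP=> [/eqP->|/imsetP[p1 p1F ->]]; case/orP=> [/eqP->|/imsetP[q1 q1F ->]].
  - by rewrite eqxx.
  - by move=> _; case: (nc q1 q1F).
  - by move=> _; case: (nc p1 p1F).
  have [gp1 gq1] := (gF p1 p1F, gF q1 q1F).
  move=> pq; rewrite !ephi // => /(conf_restrict vI rK rh sK sv) H.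
  apply: (nF p1 q1 p1F q1F); first by apply: contraNneq pq => ->.
  by apply: H; [case/andP: gp1|case/andP: gq1].
rewrite (eq_bigl _ _ eqface); apply: eq_bigr => F' /andP[/faceP[gF _] _].
by rewrite cardh ?exprS.
Qed.

Lemma link (R : comNzRingType) (c : R) (V : seq point) (I : {fset point}) :
  insideL I -> uniq V -> {subset V <= I} ->
  \sum_(F : {set walk} | face true I F && all (fun w => initW I w \in F) V) c ^+ #|F| =
  c ^+ size V * \sum_(F : {set walk} | face true [fset x in I | x \notin V]%fset F) c ^+ #|F|.
Proof.
elim: V I => [|v V IH] I IL /=.
  move=> _ _; rewrite mul1r; apply: eq_big => [F|//]; rewrite andbT.
  by congr (face _ _ _); apply/fsetP => x; rewrite !inE andbT.
case/andP=> vV UV VI; have vI : v \in I by apply: VI; rewrite inE eqxx.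
have eI := fsetD1K vI; set J := (I `\ v)%fset in eI.
have vJ : v \notin J by rewrite !inE eqxx.
have VJ : {subset V <= J}.
  move=> x xV; rewrite !inE VI ?inE ?xV ?orbT // andbT.
  by apply: contraNneq vV => <-.
rewrite -eI in IL; rewrite -eI (link_step c vJ IL vV VJ) IH //.
  rewrite mulrA exprS; congr (_ * _); apply: eq_bigl => F.
  congr (face _ _ _); apply/fsetP => x; rewrite !inE negb_or.
  by case: (eqVneq x v) => //=; rewrite ?andbF.
by move=> x xJ; apply: IL; rewrite inE xJ orbT.
Qed.

End LinkStep.

Lemma sum_subsets (R : comNzRingType) (T : finType) (N : {set T}) (c : R) :
  (1 + c) ^+ #|N| = \sum_(V : {set T} | V \subset N) c ^+ #|V|.
Proof.
pose f (i : T) : R := if i \in N then c else 0.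
transitivity (\prod_(i : T) (f i + 1)).
  rewrite -prodr_const [RHS](bigID (mem N)) /= [X in _ = _ * X]big1 => [|i iN].
    by rewrite mulr1; apply: eq_bigr => i iN; rewrite /f iN addrC.
  by rewrite /f (negbTE iN) add0r.
rewrite bigA_distr [RHS]big_mkcond; apply: eq_big => // V _.
case: ifP => [VN|/subsetPn[i iV iN]].
  rewrite -prodr_const [RHS]big_mkcond; apply: eq_bigr => i _.
  by case: ifP => // iV; rewrite /f (subsetP VN).
by rewrite (bigD1 i) //= iV /f (negbTE iN) mul0r.
Qed.

(** * Initial paths characterized by their turns *)

Section Turns.
Variables (p : seq point) (v : point).
Hypothesis sp : se_sequence p.

Lemma infix2P a b x y : infix [:: a; b] p -> p = x ++ a :: y -> head b y = b /\ y != [::].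
Proof.
case/infixP=> c [d ec] ex; have U := se_sequence_uniq sp; rewrite ec in U ex.
have e : c ++ [:: a] ++ (b :: d) = x ++ [:: a] ++ y by rewrite /= ex.
by have [_ <-] := @uniq_cat_inj c [:: a] (b :: d) x y U isT e.
Qed.

Lemma infix2P' a b x y : infix [:: a; b] p -> p = x ++ b :: y -> last a x = a /\ x != [::].
Proof.
case/infixP=> c [d ec] ex; have U := se_sequence_uniq sp; rewrite ec in U ex.
have e : (c ++ [:: a]) ++ [:: b] ++ d = x ++ [:: b] ++ y by rewrite -catA /= ex.
have U' : uniq ((c ++ [:: a]) ++ [:: b] ++ d) by rewrite -catA.
have [<- _] := @uniq_cat_inj (c ++ [:: a]) [:: b] d x y U' isT e.
by rewrite last_cat; case: (c).
Qed.

Lemma infix2 a b x y : p = x ++ a :: b :: y -> infix [:: a; b] p.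
Proof. by move=> ->; apply/infixP; exists x, y. Qed.

(** Read backwards: a vertex that is left to the East without a turn cannot have been entered from
    the North. *)
Lemma horizontal_before x w y : p = x ++ w :: east w :: y ->
  {in rcons x w, forall z, ~~ turns_at p z} -> horizontal (rcons x w).
Proof.
elim/last_ind: x w y => [//|x a IH] w y ep nt.
have wa : se_step a w.
  by move: sp; rewrite ep se_cat se_rcons last_rcons => /and3P[_ +]; case: (x).
have ew : w = east a.
  case/orP: (wa) => /eqP // ew; have := nt w; rewrite mem_rcons inE eqxx => /(_ isT).
  rewrite /turns_at /enters_north /leaves_east /= negb_or => /andP[_].
  have -> : infix [:: north w; w] p.
    by apply: (@infix2 _ _ x (east w :: y)); rewrite ep ew southK cat_rcons.
  by rewrite (@infix2 _ _ (rcons x a) y).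
rewrite horizontal_rcons last_rcons ew eqxx implybT andbT.
apply: (IH a (east w :: y)); first by rewrite ep cat_rcons ew.
by move=> z zx; apply: nt; rewrite mem_rcons inE zx orbT.
Qed.

Lemma vertical_after x w y : p = rcons x (north w) ++ w :: y ->
  {in w :: y, forall z, ~~ turns_at p z} -> vertical (w :: y).
Proof.
elim: y x w => [//|b y IH] x w ep nt.
have wb : se_step w b.
  by move: sp; rewrite ep se_cat => /and3P[_ _ /= /andP[]].
have eb : b = south w.
  case/orP: (wb) => /eqP // eb; have := nt w; rewrite inE eqxx => /(_ isT).
  rewrite /turns_at /enters_north /leaves_east /= negb_or => /andP[_].
  have -> : infix [:: north w; w] p.
    by apply: (@infix2 _ _ x (b :: y)); rewrite ep cat_rcons.
  by rewrite (@infix2 _ _ (rcons x (north w)) y) // ep eb.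
rewrite /vertical /= eb eqxx /=; rewrite eb in ep nt *.
apply: (IH (rcons x (north w)) (south w)).
  by rewrite southK cat_rcons.
by move=> z zy; apply: nt; rewrite inE zy orbT.
Qed.

(** Without another turn, the East step into [v] propagates backwards and the South step out of it
    propagates forwards. Conversely, a turn elsewhere would break one of the two straight halves. *)
Lemma initial_turns x y : p = x ++ v :: y ->
  x != [::] -> y != [::] ->
  ([&& enters_west p [:: v], leaves_south p [:: v]
     & all (fun w => turns_at p w ==> (w == v)) p]) =
  horizontal (rcons x v) && vertical (v :: y).
Proof.
move=> ep x0 y0; have Up := se_sequence_uniq sp.
have notv z : (z \in x) || (z \in y) -> z != v.
  move=> zxy; apply: contraTneq Up => zv; rewrite ep cat_uniq /= -zv.
  by case/orP: zxy => ->; rewrite ?andbF.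
apply/and3P/andP => [[ew ls /allP nt]|[hx vy]].
  have nt' z : (z \in x) || (z \in y) -> ~~ turns_at p z.
    move=> zxy; have zp : z \in p by rewrite ep mem_cat inE; case/orP: zxy => ->; rewrite ?orbT.
    by apply/negP => tz; have := nt z zp; rewrite tz (negbTE (notv z zxy)).
  have [lx _] := infix2P' ew ep; have [hy _] := infix2P ls ep.
  case/lastP: x ep x0 {notv} nt' lx => // x a ep _ nt'; rewrite last_rcons => ea.
  case: y ep y0 nt' hy => // b y ep _ nt' /= eb.
  rewrite ea in ep nt' *; rewrite eb in ep nt' *; split.
    rewrite horizontal_rcons last_rcons westK eqxx implybT andbT.
    apply: (@horizontal_before _ _ (south v :: y)); first by rewrite ep cat_rcons westK.
    by move=> z zx; apply: nt'; rewrite zx.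
  rewrite /vertical /= eqxx; apply: (@vertical_after (rcons x (west v))).
    by rewrite southK ep -!cats1 -!catA.
  by move=> z zx; apply: nt'; rewrite zx orbT.
have lx : last o x = west v.
  by move: hx; rewrite horizontal_rcons x0 /= => /andP[_ /eqP->]; rewrite eastK.
have hy : head o y = south v.
  by case: (y) y0 vy => //= b y' _ /andP[/eqP].
split.
- case/lastP: (x) x0 ep lx => // x' a _ ep; rewrite last_rcons => ea.
  by apply: (@infix2 _ _ x' y); rewrite ep cat_rcons ea.
- case: (y) y0 ep hy => // b y' _ ep /= eb.
  by apply: (@infix2 _ _ x y'); rewrite ep eb.
apply/allP => w wp; apply/implyP => tw; apply/eqP.
move: (wp); rewrite ep mem_cat inE => /or3P[wx|/eqP//|wy].
  case/splitPr: wx ep hx {notv lx x0} => x1 x2 ep hx.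
  rewrite -catA /= in ep; rewrite rcons_cat /= horizontal_cat in hx.
  case/and3P: hx => _ hx1 hx2; case/orP: tw => /andP[t1 t2].
    have [h2 _] := infix2P t2 ep; move: hx2 h2.
    by case: (x2) => [|e x2'] /= /andP[/eqP-> _] /eqP; rewrite eq_sym south_neq_east.
  have [h1 x10] := infix2P' t1 ep; move: hx1; rewrite x10 /=.
  have -> : last o x1 = north w by case: (x1) x10 h1.
  by rewrite -{1}[w]northK south_neq_east.
case/splitPr: wy ep vy {notv hy y0} => y1 y2 ep vy.
have {}ep : p = (x ++ v :: y1) ++ w :: y2 by rewrite ep -catA.
rewrite -cat_cons vertical_cat in vy.
case/and3P: vy => _ vy1 vy2; case/orP: tw => /andP[t1 t2].
  have [h1 _] := infix2P' t1 ep; move: vy1; rewrite last_cat /= in h1 *.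
  by rewrite h1 -{1}[w]westK eq_sym south_neq_east.
have [h2 y20] := infix2P t2 ep; move: vy2 h2.
by case: (y2) y20 => //= b y2' _ /andP[/eqP-> _] /eqP; rewrite south_neq_east.
Qed.

End Turns.

Lemma Fs_ended (K : {fset point}) (s : seq point) :
  Fs K s && (last o s \in K) = [&& s != [::], all (mem K) s & se_sequence s].
Proof.
case/lastP: s => // s x; rewrite FsE last_rcons all_rcons.
apply/andP/and3P => [[/and3P[-> _ sK] xK]|[_ /andP[/= xK sK] ->]].
  by split; rewrite ?sK ?andbT //; case: (s).
by split=> //; rewrite sK andbT; case: (s) sK => //= z s' /andP[].
Qed.

(** * The complexes of a shape and their expansion over sets of vertices *)

Section Main.
Variable L : grid_shape.
Local Notation walk := (walk L).
Local Notation Int := (interior_vertices L).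

Definition inside : {fset point} := [fset x in L | is_interior L x]%fset.
Local Notation J := inside.

Lemma insideE x : (x \in J) = is_interior L x.
Proof. by rewrite !inE /= /is_interior; case: (x \in L). Qed.

Lemma insideP x : x \in J ->
  [/\ x \in L, north x \in L, south x \in L, east x \in L & west x \in L].
Proof. by rewrite insideE => /andP[? /and4P[]]. Qed.

Lemma is_pathE (p : walk) : is_path L p = Kp J p.
Proof.
have := points_in p; case: (points p) => [|x [|y s]] //= /and3P[xL yL sL].
rewrite /is_boundary xL -!insideE.
have -> : last y s \in L by have := mem_last y s; rewrite inE => /orP[/eqP->|/(allP sL)].
rewrite /Kp; congr [&& _, _, _ & _]; apply: eq_all => z; by rewrite /= insideE.
Qed.

Lemma all_inside s : all (mem J) s = all (is_interior L) s.
Proof. by apply: eq_all => x /=; rewrite insideE. Qed.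

Lemma friendly_infix s t u : friendly_along s t u -> u != [::] ->
  uniq s -> uniq t -> infix u s.
Proof.
move=> f u0 Us Ut; have /(friendly_alongP Us Ut u0)[p1 [p2 [_ [_ [-> _ _ _]]]]] := f.
exact: infix_infix.
Qed.

Lemma friendly_infix_r s t u : friendly_along s t u -> u != [::] ->
  uniq s -> uniq t -> infix u t.
Proof.
move=> f u0 Us Ut; have /(friendly_alongP Us Ut u0)[_ [_ [p1 [p2 [_ -> _ _]]]]] := f.
exact: infix_infix.
Qed.

Lemma is_segmentE (s : seq point) : is_segment L s = [&& s != [::], all (mem J) s & se_sequence s].
Proof. by rewrite /is_segment all_inside. Qed.

Lemma friendlyE (s t : seq point) : se_sequence s -> se_sequence t -> friendly L s t = conf L J s t.
Proof.
move=> ss st; have Us := se_sequence_uniq ss; have Ut := se_sequence_uniq st.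
apply: eq_existsb => u; rewrite is_segmentE -!andbA; case u0: (points u != [::]) => //=.
congr (_ && _); case: orP => H; rewrite ?andbF // andbT.
case: H => H; last have := friendly_infix_r H u0 Ut Us; first have := friendly_infix H u0 Us Ut.
  by move=> /se_infix ->.
by move=> /se_infix ->.
Qed.

(** Paths start and end outside [J], so the alternatives of starting or ending with a segment of
    [J], by which friendliness differs from kissing, do not occur. *)
Lemma kissing_conf (p q : seq point) : Kp J p -> Kp J q -> kissing L p q = conf L J p q.
Proof.
move=> Kq Kq'; rewrite -(friendlyE (Kp_se Kq) (Kp_se Kq')).
apply: eq_existsb => u; case su: (is_segment L (points u)) => //=.
move: su; rewrite is_segmentE => /and3P[u0 uJ su].
have no (r : seq point) : Kp J r -> (starts_with r (points u) = false) * (ends_with r (points u) = false).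
  move=> Kr; split; apply/negP.
    case/prefixP=> w e; have [|/eqP//] := @Kp_inner J r (points u) [::] w Kr e.
    by rewrite u0.
  case/suffixP=> w e; have e' : r = w ++ points u ++ [::] by rewrite cats0.
  by have [|_ /eqP//] := @Kp_inner J r (points u) w [::] Kr e'; rewrite u0.
by rewrite /friendly_along /kiss_along !no.
Qed.

Lemma NK_faceE (F : {set walk}) : NK_face F = face true J F.
Proof.
have e (p : walk) : [&& is_path L p, ~~ horizontal p & ~~ vertical p] = good true J p.
  by rewrite is_pathE /= /straight negb_or.
rewrite /NK_face /face.
set b1 := [forall p in _, _]; set b2 := [forall p in F, good true J _].
have -> : b1 = b2 by apply: eq_forallb => p; rewrite e.
rewrite {}/b1 {}/b2; case: (boolP [forall p in F, _]) => //= /forallP gF.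
apply: eq_forallb => p; case pF: (p \in F) => //=.
apply: eq_forallb => q; case qF: (q \in F) => //=.
have /andP[Kq _] := implyP (gF p) pF; have /andP[Kq' _] := implyP (gF q) qF.
by rewrite kissing_conf.
Qed.

Definition ended (I : {fset point}) (F : {set walk}) : bool :=
  [forall s : walk in F, last o (points s) \in I].

Lemma endedP (I : {fset point}) (F : {set walk}) : reflect (forall s : walk, s \in F -> last o (points s) \in I) (ended I F).
Proof. exact: (iffP forall_inP). Qed.

Lemma NF_faceE (S : {set walk}) : NF_face S = face false J S && ended J S.
Proof.
have e (s : walk) : is_segment L s = good false J s && (last o s \in J).
  by rewrite is_segmentE -Fs_ended.
rewrite /NF_face /face /ended; apply/andP/andP => [[gS nS]|[/andP[gS nS] eS]].
  have gS' (s : walk) : s \in S -> good false J s && (last o s \in J).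
    by move=> sS; rewrite -e; apply: (forall_inP gS).
  split; last by apply/forall_inP => s /gS' /andP[].
  apply/andP; split; first by apply/forall_inP => s /gS' /andP[].
  apply/forall_inP => s sS; apply/forall_inP => q qS; apply/implyP => sq.
  have /andP[gs _] := gS' s sS; have /andP[gq _] := gS' q qS.
  rewrite -(friendlyE (good_se gs) (good_se gq)).
  exact: (implyP (forall_inP (forall_inP nS s sS) q qS) sq).
split; first by apply/forall_inP => s sS; rewrite e (forall_inP gS) // (forall_inP eS).
apply/forall_inP => s sS; apply/forall_inP => q qS; apply/implyP => sq.
have gs := forall_inP gS s sS; have gq := forall_inP gS q qS.
rewrite (friendlyE (good_se gs) (good_se gq)).
exact: (implyP (forall_inP (forall_inP nS s sS) q qS) sq).
Qed.

(** One segment with its last vertex outside [I] annihilates the whole product. *)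
Lemma Z_ended (R : comNzRingType) (I : {fset point}) (t : R) :
  Z L false I (fun=> 0) t = \sum_(F : {set walk} | face false I F && ended I F) t ^+ #|F|.
Proof.
rewrite /Z [RHS]big_mkcondr; apply: eq_bigr => F _.
case: (boolP (ended I F)) => [/endedP eF|].
  by rewrite -prodr_const; apply: eq_bigr => p pF; rewrite /wt eF.
case/forall_inPn => p pF lp; rewrite (bigD1 p) //= /wt (negbTE lp).
by rewrite mul0r.
Qed.

Lemma Z_path (R : comNzRingType) (I : {fset point}) (z t : R) :
  Z L true I (fun=> z) t = \sum_(F : {set walk} | face true I F) z ^+ #|F|.
Proof.
apply: eq_bigr => F /faceP[gF _]; rewrite -prodr_const; apply: eq_bigr => p /gF /andP[Kq _].
by rewrite /wt (negbTE (Kp_last Kq)).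
Qed.

Definition lazyW (w : L) : walk := mkW L [:: val w].

Lemma lazyWE w : points (lazyW w) = [:: val w].
Proof. by rewrite mkWK //= andbT; apply: valP. Qed.

Lemma lazyW_inj : injective lazyW.
Proof.
by move=> a b /(congr1 (@points L)); rewrite !lazyWE => -[/val_inj].
Qed.

Lemma inside_val (w : L) : (w \in Int) = (val w \in J).
Proof. by rewrite inE insideE. Qed.

Lemma mem_eps (S : {set walk}) w : w \in Int -> (lazyW w \in eps S) =
  (lazyW w \in S) && [forall q : walk in S, (q != lazyW w) ==> (val w \notin points q)].
Proof.
rewrite inside_val => wJ; rewrite inE; congr (_ && _).
have -> : is_lazy L (lazyW w).
  by rewrite /is_lazy is_segmentE lazyWE /= wJ.
rewrite /=; apply: eq_forallb => q; rewrite lazyWE infix1s.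
by [].
Qed.

Definition lazies (S : {set walk}) : {set L} := [set w : L | lazyW w \in eps S].

Lemma eps_lazy (S : {set walk}) (s : walk) : s \in eps S -> exists2 w, w \in Int & s = lazyW w.
Proof.
rewrite inE => /and3P[_ /andP[+ +] _].
rewrite is_segmentE => /and3P[_ sJ _].
case es: (points s) sJ => [|x [|y p]] //= /andP[xJ _] _.
have xL : x \in L by have [] := insideP xJ.
exists (FSetSub xL); first by rewrite inside_val.
by apply: points_inj; rewrite es lazyWE.
Qed.

Lemma card_lazies (S : {set walk}) : #|eps S| = #|lazies S|.
Proof.
rewrite -(card_imset _ lazyW_inj); congr #|pred_of_set _|; apply/setP => s.
apply/idP/imsetP => [sS|[w]]; last by rewrite in_set => ? ->.
by have [w wI es] := eps_lazy sS; exists w; rewrite // in_set -es.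
Qed.

Lemma lazies_sub (S : {set walk}) : lazies S \subset Int.
Proof.
apply/subsetP => w; rewrite in_set => /eps_lazy[w' wI /lazyW_inj->].
by [].
Qed.

Definition pts (V : {set L}) : seq point := [seq val w | w <- enum V].
Definition minus (V : {set L}) : {fset point} := [fset x in J | x \notin pts V]%fset.

Lemma minusE V x : (x \in minus V) = (x \in J) && (x \notin pts V).
Proof. by rewrite !inE. Qed.

Lemma val_pts V w : (val w \in pts V) = (w \in V).
Proof. by rewrite mem_map ?mem_enum //; apply: val_inj. Qed.

(** That [V] indexes members of epsilon means that the lazy segments at [V] belong to [S] and the
    other members avoid [V]. A lazy segment conflicts only with segments through its vertex, so the
    rest is an arbitrary face on [minus V]. *)
Lemma lazy_sum (R : comNzRingType) (t : R) (V : {set L}) : V \subset Int ->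
  \sum_(S : {set walk} | NF_face S && (V \subset lazies S)) t ^+ #|S| =
  t ^+ #|V| * Z L false (minus V) (fun=> 0) t.
Proof.
move=> VI; rewrite Z_ended; set I := minus V.
pose LV : {set walk} := [set lazyW w | w in V].
have subJ : {subset I <= J} by move=> x; rewrite minusE => /andP[].
have LVS (S : {set walk}) : V \subset lazies S -> LV \subset S.
  move=> VS; apply/subsetP => s /imsetP[w wV ->].
  by have := subsetP VS w wV; rewrite in_set mem_eps ?(subsetP VI) // => /andP[].
have memLV (s : walk) : s \in LV -> exists2 w, w \in V & points s = [:: val w].
  by case/imsetP=> w wV ->; exists w; rewrite ?lazyWE.
have avoidV (s : walk) w : all (mem I) (points s) -> w \in V -> val w \notin points s.
  move=> sI wV; apply/negP => /(allP sI) /=; rewrite minusE val_pts wV andbF //.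
rewrite (reindex_onto (fun F' => LV :|: F') (fun F => F :\: LV)) /=; last first.
  move=> F /andP[_ /LVS LF]; apply/setP => s; rewrite !inE.
  by case: (boolP (s \in LV)) => [/(subsetP LF)->|].
rewrite big_distrr /=.
have main (F' : {set walk}) :
    NF_face (LV :|: F') && (V \subset lazies (LV :|: F')) && ((LV :|: F') :\: LV == F') =
    face false I F' && ended I F'.
  rewrite NF_faceE.
  apply/andP/andP => [[/andP[/andP[/faceP[gF nF] /endedP eF] VS] /eqP hF]|[/faceP[gF nF] /endedP eF]].
    have sF (s : walk) : s \in F' -> s \in LV :|: F' /\ s \notin LV.
      by rewrite -{1}hF in_setD => /andP[sL ->].
    have sI (s : walk) : s \in F' -> all (mem I) (points s).
      move=> /sF[sF' sLV]; have gs := gF s sF'; have lJ := eF s sF'.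
      have /and3P[_ sJ _] : [&& points s != [::], all (mem J) (points s) & se_sequence (points s)].
        by rewrite -Fs_ended lJ andbT.
      apply/allP => x xs; rewrite /= minusE; have /= -> /= := allP sJ x xs.
      apply/negP => /mapP[w]; rewrite mem_enum => wV ex.
      have := subsetP VS w wV; rewrite in_set mem_eps ?(subsetP VI) // => /andP[_ /forall_inP/(_ s sF')].
      rewrite -ex xs implybF negbK => /eqP es; case/negP: sLV.
      by rewrite es; apply: imset_f.
    have gI (s : walk) : s \in F' -> good false I s /\ last o (points s) \in I.
      move=> sF'; have [/gF gs _] := sF s sF'; apply/andP.
      rewrite Fs_ended (sI s sF') (good_se gs) andbT.
      by case: (points s) gs.
    split; last by apply/endedP => s /gI[].
    apply/faceP; split=> [s /gI[]//|s q sF' qF' sq c].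
    have [sS _] := sF s sF'; have [qS _] := sF q qF'.
    by apply: (nF s q sS qS sq); apply: conf1_sub c.
  have sI (s : walk) : s \in F' -> all (mem I) (points s).
    move=> sF'; have : Fs I (points s) && (last o (points s) \in I).
      by rewrite eF // andbT; apply: (gF s sF').
    by rewrite Fs_ended => /and3P[].
  have dis (s : walk) : s \in F' -> s \notin LV.
    move=> sF'; apply/negP => /memLV[w wV es].
    by have := avoidV s w (sI s sF') wV; rewrite es inE eqxx.
  have segJ (s : walk) : s \in LV :|: F' -> all (mem J) (points s).
    rewrite in_setU => /orP[/memLV[w wV ->]|/sI sI'].
      by rewrite /= andbT -inside_val (subsetP VI).
    by apply: sub_all sI'; apply: subJ.
  have inI (s : walk) (u : seq point) : infix u (points s) -> s \in F' -> all (mem I) u.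
    by move=> us sF'; apply/allP => x xu; apply: (allP (sI s sF')); apply: mem_infix us x xu.
  have infL (s : walk) (u : seq point) : infix u (points s) -> u != [::] -> s \in LV ->
      exists2 w, w \in V & val w \in u /\ points s = [:: val w].
    move=> us u0 /memLV[w wV es]; exists w => //; split=> //; move: us; rewrite es.
    case: u u0 => // x u _ xu; have : x \in [:: val w] by apply: (mem_infix xu); rewrite inE eqxx.
    by rewrite inE => /eqP->; rewrite inE eqxx.
  split; last first.
    apply/eqP/setP => s; rewrite in_setD in_setU.
    by case: (boolP (s \in F')) => [/dis->|_]; rewrite ?orbT // orbF andNb.
  apply/andP; split; last first.
    apply/subsetP => w wV; rewrite in_set mem_eps ?(subsetP VI) //.
    rewrite in_setU imset_f //=; apply/forall_inP => q; rewrite in_setU => /orP[/memLV[w' w'V eq]|qF'].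
      apply/implyP; apply: contra; rewrite eq inE => /eqP e.
      by apply/eqP/points_inj; rewrite eq lazyWE; congr [:: _]; exact: esym e.
    by rewrite (avoidV q w (sI q qF') wV) implybT.
  have gJ (s : walk) : s \in LV :|: F' -> good false J s /\ last o (points s) \in J.
    move=> sS; apply/andP; rewrite Fs_ended segJ //=.
    move: sS; rewrite in_setU => /orP[/memLV[w _ ->]//|/gF gs].
    by rewrite (good_se gs) andbT; case: (points s) gs.
  apply/andP; split; last by apply/endedP => s /gJ[].
  apply/faceP; split=> [s /gJ[]//|s q sS qS sq c].
  case: (c) => u [p1 [p2 [q1 [q2 [/andP[u0 uJ] ep eq i1 i2]]]]].
  have us : infix u (points s) by rewrite ep infix_infix.
  have uq : infix u (points q) by rewrite eq infix_infix.
  move: sS qS; rewrite !in_setU.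
  case/orP=> [sL|sF']; case/orP=> [qL|qF'].
  - have [w wV [wu es]] := infL s u us u0 sL.
    have [w' w'V [_ eq']] := infL q u uq u0 qL.
    have := mem_infix uq wu; rewrite eq' inE => /eqP ew.
    by move/eqP: sq; apply; apply: points_inj; rewrite es eq' ew.
  - have [w wV [wu _]] := infL s u us u0 sL.
    by have := avoidV q w (sI q qF') wV; rewrite (mem_infix uq wu).
  - have [w wV [wu _]] := infL q u uq u0 qL.
    by have := avoidV s w (sI s sF') wV; rewrite (mem_infix us wu).
  apply: (nF s q sF' qF' sq); exists u, p1, p2, q1, q2; split=> //.
  by rewrite u0 (inI s u us sF').
rewrite (eq_bigl _ _ main); apply: eq_bigr => F'.
rewrite -main => /andP[_ /eqP hF].
have <- : #|LV| = #|V| by apply: card_imset lazyW_inj.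
rewrite -exprD; congr (_ ^+ _); rewrite cardsU; have -> : LV :&: F' = set0.
  by rewrite -hF setIDA setIC setDIl setDv setI0.
by rewrite cards0 subn0.
Qed.

Definition inits (F : {set walk}) : {set L} := [set w in Int | initW L J (val w) \in F].

Lemma Kp_mid (K : {fset point}) x v y : Kp K (x ++ v :: y) -> x != [::] -> y != [::] -> v \in K.
Proof.
case: x => // z x; case/lastP: y => // y e; rewrite cat_cons -rcons_cons -rcons_cat KpE.
by case/and4P=> _ _ _; rewrite all_cat /= => /and3P[].
Qed.

Lemma Kp_head (K : {fset point}) p : Kp K p -> head o p \notin K.
Proof. by case: p => [|x [|y p]] // /and4P[]. Qed.

Lemma init_turns (p : seq point) (v : point) : Kp J p -> v \in J -> init J v p =
  (v \in p) && [&& enters_west p [:: v], leaves_south p [:: v]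
                 & all (fun w => turns_at p w ==> (w == v)) p].
Proof.
move=> Kq vJ; have sp := Kp_se Kq; apply/initP/andP => [[x [y [ep _ hx vy]]]|[vp tv]].
  have x0 : x != [::].
    by apply: contraTneq vJ => x0; have := Kp_head Kq; rewrite ep x0.
  have y0 : y != [::].
    by apply: contraTneq vJ => y0; have := Kp_last Kq; rewrite ep y0 last_cat.
  by rewrite (initial_turns sp ep x0 y0) hx vy ep mem_cat inE eqxx orbT.
have [x [y ep]] : exists x y, p = x ++ v :: y.
  by case/splitPr: vp => x y; exists x, y.
case/and3P: (tv) => ew ls _.
have [_ x0] := infix2P' sp ew ep; have [_ y0] := infix2P sp ls ep.
by exists x, y; move: tv; rewrite (initial_turns sp ep x0 y0) => /andP[].
Qed.

Lemma is_initialE (p : walk) : is_initial L p = [exists w in Int, p == initW L J (val w)].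
Proof.
rewrite /is_initial is_pathE; apply/andP/exists_inP => [[Kq /hasP[v vp tv]]|[w wI /eqP->]].
  have vJ : v \in J.
    have [x [y ep]] : exists x y, points p = x ++ v :: y.
      by case/splitPr: vp => x y; exists x, y.
    have sp := Kp_se Kq; case/and3P: (tv) => ew ls _.
    have [_ x0] := infix2P' sp ew ep; have [_ y0] := infix2P sp ls ep.
    by apply: (Kp_mid (x := x) (y := y)); rewrite -?ep.
  have vL : v \in L by have [] := insideP vJ.
  exists (FSetSub vL); first by rewrite inside_val.
  have [_ _ u] := initW_spec vJ insideP.
  by apply/eqP/u; rewrite init_turns // vp tv.
rewrite inside_val in wI; have [iw _ _] := initW_spec wI insideP.
have Kq : Kp J (points (initW L J (val w))) by case/and4P: iw.
split=> //; rewrite init_turns // in iw; case/andP: iw => wp tw.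
by apply/hasP; exists (val w).
Qed.

(** An initial path turns at one vertex only, which can thus be recovered from it. *)
Lemma initW_inj : {in Int &, injective (fun w => initW L J (val w))}.
Proof.
move=> a b; rewrite !inside_val => aJ bJ e.
have [ia _ _] := initW_spec aJ insideP; have [ib _ _] := initW_spec bJ insideP.
have Kq : Kp J (points (initW L J (val a))) by case/and4P: ia.
rewrite -e in ib; rewrite init_turns // in ia; rewrite init_turns // in ib.
case/and4P: ia => _ _ _ /allP at_; case/and4P: ib => bp eb lb _.
apply: val_inj; apply/eqP; rewrite eq_sym.
by have := at_ _ bp; rewrite /turns_at eb lb.
Qed.

Lemma card_inits (F : {set walk}) : #|F :&: initial_paths L| = #|inits F|.
Proof.
have <- : #|[set initW L J (val w) | w in inits F]| = #|inits F|.
  apply: card_in_imset => a b; rewrite !in_set => /andP[aI _] /andP[bI _].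
  by apply: initW_inj; rewrite in_set.
congr #|pred_of_set _|; apply/setP => p; rewrite in_setI [p \in initial_paths _]in_set is_initialE.
apply/andP/imsetP => [[pF /exists_inP[w wI /eqP e]]|[w]].
  by exists w; rewrite // inE wI -e.
by rewrite inE => /andP[wI wF] ->; split=> //; apply/exists_inP; exists w.
Qed.

Lemma card_fset_sub (K : {fset point}) : (forall x, x \in K -> x \in L) ->
  #|` K| = #|[set w : L | val w \in K]|.
Proof.
move=> KL; rewrite cardE -(size_map val); apply: perm_size; apply: uniq_perm.
- exact: fset_uniq.
- by rewrite map_inj_uniq ?enum_uniq //; apply: val_inj.
move=> x; apply/idP/mapP => [xK|[w]]; last by rewrite mem_enum inE => ? ->.
by exists (FSetSub (KL x xK)); rewrite // mem_enum inE.
Qed.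

Lemma card_minus (V : {set L}) : V \subset Int -> (#|` minus V| + #|V|)%N = #|Int|.
Proof.
move=> VI; rewrite card_fset_sub; last by move=> x; rewrite minusE => /andP[/insideP[]].
rewrite -(cardsID V Int) (setIidPr VI) addnC; congr (_ + #|pred_of_set _|)%N.
by apply/setP => w; rewrite in_setD in_set minusE val_pts -inside_val andbC.
Qed.

Lemma path_sum (R : comNzRingType) (c : R) (V : {set L}) : V \subset Int ->
  \sum_(F : {set walk} | NK_face F && (V \subset inits F)) c ^+ #|F| =
  c ^+ #|V| * \sum_(F : {set walk} | face true (minus V) F) c ^+ #|F|.
Proof.
move=> VI; have UV : uniq (pts V) by rewrite map_inj_uniq ?enum_uniq //; apply: val_inj.
have VJ : {subset pts V <= J}.
  by move=> x /mapP[w]; rewrite mem_enum => /(subsetP VI); rewrite inside_val => ? ->.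
have := link c insideP UV VJ; rewrite size_map -cardE => <-.
apply: eq_bigl => F; rewrite NK_faceE; congr (_ && _).
apply/subsetP/allP => H w.
  by case/mapP=> w'; rewrite mem_enum => /H; rewrite in_set => /andP[_ ?] ->.
by move=> wV; rewrite in_set (subsetP VI) //= H // val_pts.
Qed.

End Main.

Lemma regroup (R : comNzRingType) (a b c d e f : R) :
  b * c * (d * (e * (a * f))) = a * b * (d * e * (c * f)).
Proof. by ring. Qed.

Theorem corollary6p3 (L : grid_shape) (K : fieldType) (x y : K) (hx : x != 0) :
  H_triangle L (x + 1) (y + 1) =
  x ^+ #|interior_vertices L| *
    F_triangle L (1 / x) ((1 + y * (x + 1)) / x).
Proof.
have -> : H_triangle L (x + 1) (y + 1) =
  \sum_(V : {set L} | V \subset interior_vertices L)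
    y ^+ #|V| * ((x + 1) ^+ #|V| * Z L false (minus V) (fun=> 0) (x + 1)).
  rewrite /H_triangle; under eq_bigr => S _.
    (* The power of y + 1 is the sum of [y ^+ #|V|] over the subsets [V] of the lazy vertices. *)
    rewrite card_lazies [y + 1]addrC sum_subsets mulr_sumr; over.
  rewrite (exchange_big_dep (fun V : {set L} => V \subset interior_vertices L)) /=; last first.
    by move=> S V _ VS; apply: subset_trans VS (lazies_sub S).
  apply: eq_bigr => V VI; rewrite -lazy_sum // mulr_sumr.
  by apply: eq_bigr => S _; rewrite mulrC.
have -> : F_triangle L (1 / x) ((1 + y * (x + 1)) / x) =
  \sum_(V : {set L} | V \subset interior_vertices L)
    (y * (x + 1)) ^+ #|V| * (x^-1 ^+ #|V| *
       \sum_(F : {set walk L} | face true (minus V) F) x^-1 ^+ #|F|).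
  rewrite /F_triangle; under eq_bigr => F _.
    (* Both variables carry a factor 1/x, so every face gets x^(-|F|); what remains is a power of 1
       + y(x + 1), again expanded over subsets. *)
    rewrite div1r exprMn mulrCA -exprD [(_ + #|F :&: _|)%N]addnC cardsID.
    rewrite card_inits sum_subsets mulr_suml; over.
  rewrite (exchange_big_dep (fun V : {set L} => V \subset interior_vertices L)) /=; last first.
    move=> F V _ VF; apply: subset_trans VF _.
    by apply/subsetP => w; rewrite in_set => /andP[].
  by apply: eq_bigr => V VI; rewrite -path_sum // mulr_sumr.
rewrite mulr_sumr; apply: eq_bigr => V VI.
have KL z : z \in minus V ->
    [/\ z \in L, north z \in L, south z \in L, east z \in L & west z \in L].
  by rewrite minusE => /andP[/insideP].
(* With all exit weights zero, the segment side keeps only segments inside [minus V] and the path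
   weight becomes 1/x. *)
have := Z_shift KL (fun=> 0) (mulfV hx).
rewrite -(card_minus VI) exprD [x + 1]addrC => <-.
rewrite (_ : Z L true _ _ _ = Z L true (minus V) (fun=> x^-1) (1 + x)); last first.
  by apply: Z_ext => p; rewrite add0r mulr1.
rewrite Z_path; set S := \sum_(F | _) _.
have xV : x ^+ #|V| * x^-1 ^+ #|V| = 1 by rewrite -exprMn mulfV // expr1n.
by rewrite exprMn -regroup xV mul1r.
Qed.
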